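(* Let $X$ be a complex Banach space. The following statements are equivalent: (a) $(x_n n^{-s})_{n}$ is RUC in $\mathcal H_2(X)$ for every choice of $(x_n)_n\subset X$. (b) $\mathcal H_2(X)\subset \mathcal H^{rad}_2(X)$. (c) $X$ has type $2$.
   Context: $\mathbb N=\{1,2,\dots\}$, $\mathbb T=\{z\in\mathbb C:|z|=1\}$, and $\mathbb T^{\mathbb N}$ carries its normalized Haar measure. $\mathbb Z^{(\mathbb N)}$ and $\mathbb N_0^{(\mathbb N)}$ are the sets of eventually null sequences of integers and of non-negative integers, respectively; $z^\alpha=\prod_i z_i^{\alpha_i}$. Let $p_1<p_2<\cdots$ be the primes; for $\alpha\in\mathbb N_0^{(\mathbb N)}$ put $n(\alpha)=\prod_i p_i^{\alpha_i}$ (a bijection onto $\mathbb N$). Hardy spaces. For $1\le p<\infty$ and $f\in L_p(\mathbb T^{\mathbb N},X)$ (Bochner space), $\hat f(\alpha)=\int_{\mathbb T^{\mathbb N}}f(w)w^{-\alpha}\,dw$. $H_p(\mathbb T^{\mathbb N},X)$ is the closed subspace of those $f\in L_p(\mathbb T^{\mathbb N},X)$ with $\hat f(\alpha)=0$ for all $\alpha\in\mathbb Z^{(\mathbb N)}\setminus\mathbb N_0^{(\mathbb N)}$. A formal Dirichlet series $D=\sum_n x_n n^{-s}$ with $x_n\in X$ belongs to $\mathcal H_p(X)$ if there is $f\in H_p(\mathbb T^{\mathbb N},X)$ with $\hat f(\alpha)=x_{n(\alpha)}$ for all $\alpha\in\mathbb N_0^{(\mathbb N)}$, and then $\|D\|_{\mathcal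 H_p(X)}=\|f\|_{L_p(\mathbb T^{\mathbb N},X)}$. $\mathcal H^{rad}_p(X)$ is the set of formal Dirichlet series $\sum_n x_n n^{-s}$ with $x_n\in X$ such that $\sum_n\varepsilon_n x_n n^{-s}\in\mathcal H_p(X)$ for almost every $(\varepsilon_n)_n\in\{-1,+1\}^{\mathbb N}$ (Haar probability measure). RUC. A sequence $(y_n)_n$ in a Banach space $Y$ is RUC if there is a constant $C$ such that $\mathbb E\|\sum_{n=1}^m\varepsilon_n a_n y_n\|\le C\|\sum_{n=1}^m a_n y_n\|$ for every $m\in\mathbb N$ and all scalars $(a_n)_{n=1}^m\subset\mathbb C$, where $\mathbb E$ is the expectation over independent uniform signs $\varepsilon_n=\pm1$. For $(x_n n^{-s})_n$ in $\mathcal H_p(X)$ this inequality is the definition (some $x_n$ may be zero). $X$ has type $2$ if there is $C$ with $(\mathbb E\|\sum_{n=1}^N\varepsilon_n x_n\|^2)^{1/2}\le C(\sum_{n=1}^N\|x_n\|^2)^{1/2}$ for all $N$ and all $x_1,\dots,x_N\in X$. *)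

(* Defs.v *)
From HB Require Import structures.
From mathcomp Require Import all_boot all_order all_algebra.
From mathcomp Require Import finmap.
From mathcomp Require Import complex.
From mathcomp Require Import all_classical all_reals all_analysis.

Set Implicit Arguments.
Unset Strict Implicit.
Unset Printing Implicit Defensive.

Import Order.TTheory GRing.Theory Num.Theory.
Import numFieldNormedType.Exports.

Local Open Scope classical_set_scope.
Local Open Scope ring_scope.
Local Open Scope complex_scope.

(** Conventions.  The set of positive integers is encoded by [nat] through
    [n |-> n.+1]: a sequence [(x_n)_(n >= 1)] is a function [x] on [nat] with
    [x n] standing for the term of index [n + 1]; in particular a formal
    Dirichlet series is its sequence of coefficients [D : nat -> X], [D n] being
    the coefficient of [(n + 1)^(-s)]. *)

(** The norm of a normed module over [R[i]] is [R[i]]-valued in the library (and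
    has zero imaginary part); this is the same norm, as an element of [R]. *)
Definition rnorm (R : realType) (X : normedModType R[i]) (x : X) : R :=
  complex.Re `|x|.

(** ** Measures on countable powers *)

(** [nat -> T] with the product sigma-algebra; for the circle and for a finite
    [T] this is the Borel sigma-algebra of the product topology. *)
Definition pow_nat (T : Type) : Type := nat -> T.

HB.instance Definition _ (T : pointedType) := Pointed.copy (pow_nat T) (nat -> T).

Definition pow_nat_measurable d (T : measurableType d) : set (set (pow_nat T)) :=
  <<s \bigcup_(i in [set: nat])
        preimage_set_system [set: pow_nat T] (fun w => w i) (@measurable d T) >>.

HB.instance Definition _ d (T : measurableType d) :=
  @isMeasurable.Build d (pow_nat T) (@pow_nat_measurable d T)
    (@sigma_algebra0 _ _ _) (@sigma_algebraC _ _) (@sigma_algebra_bigcup _ _ _).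

(** [mu] is the normalized Haar measure of the compact group [T^nat] with the
    coordinatewise operation [op]; [T] will be the circle or the group of signs. *)
Definition haar d (T : measurableType d) (R : realType) (op : T -> T -> T)
    (mu : probability (pow_nat T) R) : Prop :=
  forall (w : nat -> T) (A : set (pow_nat T)), measurable A ->
    mu [set z : pow_nat T | A (fun i => op (w i) (z i))] = mu A.

Definition circle (R : realType) : Type := {z : R[i] | `|z| == 1}.

Definition circle1 (R : realType) : circle R :=
  exist _ 1 (introT eqP (normr1 _)).

Lemma circle_mul_subproof (R : realType) (z w : circle R) :
  `|sval z * sval w| == 1.
Proof. by rewrite normrM (eqP (svalP z)) (eqP (svalP w)) mulr1. Qed.

Definition circle_mul (R : realType) (z w : circle R) : circle R :=
  exist _ (sval z * sval w) (circle_mul_subproof z w).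

HB.instance Definition _ (R : realType) :=
  Choice.copy (circle R) {z : R[i] | `|z| == 1}.
HB.instance Definition _ (R : realType) := isPointed.Build (circle R) (circle1 R).

Definition circle_borel (R : realType) : set (set (circle R)) :=
  <<s [set [set z : circle R | U (sval z)] | U in @open R[i]^o] >>.

HB.instance Definition _ (R : realType) :=
  @isMeasurable.Build default_measure_display (circle R) (@circle_borel R)
    (@sigma_algebra0 _ _ _) (@sigma_algebraC _ _) (@sigma_algebra_bigcup _ _ _).

Definition polytorus (R : realType) : Type := pow_nat (circle R).

(** Signs are encoded by booleans, [b] standing for [(-1) ^+ b]; multiplication
    of signs is then [addb]. *)
Definition signs : Type := pow_nat bool.

(** ** Bochner integral *)

Definition simple_fun (R : realType) (X : normedModType R[i]) d
    (T : measurableType d) (s : T -> X) : Prop :=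
  finite_set (range s) /\ forall x, measurable (s @^-1` [set x]).

(** Pointwise limits of simple functions everywhere, rather than almost
    everywhere: every class of strongly measurable functions modulo null sets
    contains such a representative. *)
Definition strongly_measurable (R : realType) (X : normedModType R[i]) d
    (T : measurableType d) (f : T -> X) : Prop :=
  exists s : nat -> T -> X,
    (forall n, simple_fun (s n)) /\ (forall t, s ^~ t @ \oo --> f t).

Definition simple_integral (R : realType) (X : normedModType R[i]) d
    (T : measurableType d) (mu : probability T R) (s : T -> X) : X :=
  \sum_(x \in range s) (fine (mu (s @^-1` [set x])))%:C *: x.

Definition is_bochner_integral (R : realType) (X : normedModType R[i]) d
    (T : measurableType d) (mu : probability T R) (f : T -> X) (v : X) : Prop :=
  strongly_measurable f /\
  exists s : nat -> T -> X,
    [/\ forall n, simple_fun (s n),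
        (fun n => \int[mu]_t (rnorm (f t - s n t))%:E)%E @ \oo --> 0%E &
        (fun n => simple_integral mu (s n)) @ \oo --> v].

Definition bochner_integral (R : realType) (X : normedModType R[i]) d
    (T : measurableType d) (mu : probability T R) (f : T -> X) : X :=
  xget 0 [set v | is_bochner_integral mu f v].

Definition Lpnorm (R : realType) (X : normedModType R[i]) d
    (T : measurableType d) (mu : probability T R) (p : R) (f : T -> X) : \bar R :=
  Lnorm mu p%:E (fun t => (rnorm (f t))%:E).

Definition in_Lp (R : realType) (X : normedModType R[i]) d
    (T : measurableType d) (mu : probability T R) (p : R) (f : T -> X) : Prop :=
  strongly_measurable f /\ (Lpnorm mu p f < +oo)%E.

(** ** Hardy spaces on the infinite-dimensional torus *)

Definition multi_index : Type := {fsfun nat -> int with 0}.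

Definition nonneg_index (alpha : multi_index) : Prop := forall i, 0 <= alpha i.

Definition monomial (R : realType) (alpha : multi_index) (z : polytorus R) : R[i] :=
  \prod_(i <- finsupp alpha) sval (z i) ^ alpha i.

Definition fourier_coef (R : realType) (X : normedModType R[i])
    (mu : probability (polytorus R) R) (f : polytorus R -> X)
    (alpha : multi_index) : X :=
  bochner_integral mu (fun w => (monomial alpha w)^-1 *: f w).

Definition in_Hp (R : realType) (X : normedModType R[i])
    (mu : probability (polytorus R) R) (p : R) (f : polytorus R -> X) : Prop :=
  in_Lp mu p f /\
  forall alpha, ~ nonneg_index alpha -> fourier_coef mu f alpha = 0.

(** ** Dirichlet series *)

Lemma next_prime_subproof (n : nat) : exists p, (n < p)%N && prime p.
Proof. by have [p np pp] := prime_above n; exists p; rewrite np. Qed.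

Definition next_prime (n : nat) : nat := ex_minn (next_prime_subproof n).

(** The primes in increasing order, from [nth_prime 0 = 2]. *)
Definition nth_prime (i : nat) : nat := iter i.+1 next_prime 0.

(** Only used for nonnegative [alpha], where the absolute value is harmless. *)
Definition nat_of_index (alpha : multi_index) : nat :=
  (\prod_(i <- finsupp alpha) nth_prime i ^ `|alpha i|)%N.

Definition bohr_lift (R : realType) (X : normedModType R[i])
    (mu : probability (polytorus R) R) (p : R) (D : nat -> X)
    (f : polytorus R -> X) : Prop :=
  in_Hp mu p f /\
  forall alpha, nonneg_index alpha ->
    fourier_coef mu f alpha = D (nat_of_index alpha).-1.

Definition in_HDp (R : realType) (X : normedModType R[i])
    (mu : probability (polytorus R) R) (p : R) (D : nat -> X) : Prop :=
  exists f, bohr_lift mu p D f.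

(** Meaningful for [D] such that [in_HDp mu p D]: the lift is then unique up to
    null sets and its norm is finite. *)
Definition HDnorm (R : realType) (X : normedModType R[i])
    (mu : probability (polytorus R) R) (p : R) (D : nat -> X) : R :=
  fine (Lpnorm mu p (xget (cst 0) [set f | bohr_lift mu p D f])).

Definition in_HDrad (R : realType) (X : normedModType R[i])
    (mu : probability (polytorus R) R) (P : probability signs R) (p : R)
    (D : nat -> X) : Prop :=
  {ae P, forall e : signs, in_HDp mu p (fun n => (-1) ^+ (e n) *: D n)}.

Definition dirichlet_term (R : realType) (X : normedModType R[i])
    (x : nat -> X) (n : nat) : nat -> X :=
  fun k => if k == n then x n else 0.

(** ** Random signs *)

Definition Esign (R : realType) (m : nat) (F : {ffun 'I_m -> bool} -> R) : R :=
  (2 ^+ m)^-1 * \sum_(e : {ffun 'I_m -> bool}) F e.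

Definition RUC (R : realType) (Y : lmodType R[i]) (nrm : Y -> R)
    (y : nat -> Y) : Prop :=
  exists C : R, forall (m : nat) (a : 'I_m -> R[i]),
    Esign (fun e => nrm (\sum_(n < m) ((-1) ^+ (e n) * a n) *: y n))
      <= C * nrm (\sum_(n < m) a n *: y n).

Definition type2 (R : realType) (X : normedModType R[i]) : Prop :=
  exists C : R, forall (N : nat) (x : 'I_N -> X),
    Num.sqrt (Esign (fun e => rnorm (\sum_(n < N) (-1) ^+ (e n) *: x n) ^+ 2))
      <= C * Num.sqrt (\sum_(n < N) rnorm (x n) ^+ 2).

(* Main.v *)
Require Import Defs.
From HB Require Import structures.
From mathcomp Require Import all_boot all_order all_algebra.
From mathcomp Require Import finmap.
From mathcomp Require Import complex.
From mathcomp Require Import all_classical all_reals all_analysis.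
From mathcomp Require Import measurable_realfun.
From mathcomp Require Import ring lra zify.

Import Order.TTheory GRing.Theory Num.Theory.
Import numFieldNormedType.Exports.
Local Open Scope classical_set_scope.
Local Open Scope ring_scope.
Local Open Scope complex_scope.
Set Implicit Arguments.
Unset Strict Implicit.
Unset Printing Implicit Defensive.


Section Averages.
Context {R : realType}.

Definition avg (T : finType) (F : T -> R) : R := #|T|%:R^-1 * \sum_t F t.

Lemma avgE (T : finType) (F : T -> R) : avg F = #|T|%:R^-1 * \sum_t F t.
Proof. by []. Qed.

Lemma avgD (T : finType) (F G : T -> R) :
  avg (fun t => F t + G t) = avg F + avg G.
Proof. by rewrite /avg big_split mulrDr. Qed.

Lemma avgZ (T : finType) (c : R) (F : T -> R) :
  avg (fun t => c * F t) = c * avg F.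
Proof. by rewrite /avg -mulr_sumr mulrCA. Qed.

Lemma avgZr (T : finType) (c : R) (F : T -> R) :
  avg (fun t => F t * c) = avg F * c.
Proof. by rewrite /avg -mulr_suml mulrA. Qed.

Lemma avg_sum (T I : finType) (F : I -> T -> R) :
  avg (fun t => \sum_i F i t) = \sum_i avg (F i).
Proof. by rewrite /avg exchange_big mulr_sumr. Qed.

Lemma eq_avg (T : finType) (F G : T -> R) : F =1 G -> avg F = avg G.
Proof. by move=> FG; rewrite /avg; congr (_ * _); apply: eq_bigr. Qed.

Lemma ler_avg (T : finType) (F G : T -> R) :
  (forall t, F t <= G t) -> avg F <= avg G.
Proof.
by move=> FG; rewrite ler_wpM2l ?invr_ge0 ?ler0n//; apply: ler_sum.
Qed.

Lemma avg_ge0 (T : finType) (F : T -> R) : (forall t, 0 <= F t) -> 0 <= avg F.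
Proof. by move=> F0; rewrite mulr_ge0 ?invr_ge0 ?ler0n ?sumr_ge0. Qed.

Lemma avg_cst (T : finType) (t : T) (c : R) : avg (fun _ : T => c) = c.
Proof.
rewrite /avg sumr_const -[c *+ _]mulr_natl mulrA mulVf ?mul1r// pnatr_eq0 -lt0n.
by apply/card_gt0P; exists t.
Qed.

Lemma avg_exchange (S T : finType) (F : S -> T -> R) :
  avg (fun s => avg (F s)) = avg (fun t => avg (F ^~ t)).
Proof.
rewrite /avg -!mulr_sumr mulrCA; do 2!congr (_ * _).
exact: exchange_big.
Qed.

Lemma avg_reindex (S T : finType) (h : S -> T) (F : T -> R) :
  bijective h -> avg (fun s => F (h s)) = avg F.
Proof.
move=> bh; rewrite /avg (bij_eq_card bh); congr (_ * _).
by rewrite [RHS](reindex h)//; apply: onW_bij.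
Qed.

(** Averages are squeezed between the values of a function that is within
    [r] of a constant. *)
Lemma avg_dist (T : finType) (t : T) (F : T -> R) (a r : R) :
  (forall s, `|F s - a| <= r) -> `|avg F - a| <= r.
Proof.
move=> Fa; rewrite -[a](avg_cst t) -[in r](avg_cst t r) ler_norml.
apply/andP; split.
  rewrite -subr_ge0 opprK -addrA [_ + avg _]addrC addrA -avgD subr_ge0.
  by apply: ler_avg => s; have := Fa s; rewrite ler_norml; lra.
rewrite lerBlDr -avgD; apply: ler_avg => s.
by have := Fa s; rewrite ler_norml; lra.
Qed.

Lemma avg_sqr_le (T : finType) (F : T -> R) :
  avg F ^+ 2 <= avg (fun t => F t ^+ 2).
Proof.
case: (pickP T) => [t _|T0].
  have : 0 <= avg (fun t => (F t - avg F) ^+ 2).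
    by apply: avg_ge0 => s; exact: sqr_ge0.
  under eq_avg do rewrite sqrrB.
  rewrite (eq_avg (G := fun s => F s ^+ 2 + (- (avg F *+ 2)) * F s + avg F ^+ 2)).
    by rewrite !avgD avgZ (avg_cst t); nra.
  by move=> s; ring.
by rewrite /avg !big_pred0// !mulr0 expr0n.
Qed.

End Averages.

Section Cube.
Context {R : realType}.

Notation cube I := {ffun I -> bool}.

Lemma Esign_avg m (F : cube 'I_m -> R) : Esign F = avg F.
Proof. by rewrite /Esign /avg card_ffun card_bool card_ord natrX. Qed.

Definition addc (I : finType) (d e : cube I) : cube I :=
  [ffun i => d i (+) e i].

Lemma addcK (I : finType) (d : cube I) : involutive (addc d).
Proof. by move=> e; apply/ffunP => i; rewrite !ffunE addbA addbb addFb. Qed.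

Lemma avg_addc (I : finType) (d : cube I) (F : cube I -> R) :
  avg (fun e => F (addc d e)) = avg F.
Proof. exact/avg_reindex/inv_bij/addcK. Qed.

Definition delta_cube (I : finType) (i : I) : cube I := [ffun j => j == i].
Definition neg_cube (I : finType) : cube I := [ffun=> true].

Definition walsh (I : finType) (S : {set I}) (e : cube I) : R :=
  \prod_(i in S) (-1) ^+ (e i).

Definition walsh_coef (I : finType) (h : cube I -> R) (S : {set I}) : R :=
  avg (fun e => h e * walsh S e).

Lemma walsh_addc (I : finType) (S : {set I}) (d e : cube I) :
  walsh S (addc d e) = walsh S d * walsh S e.
Proof.
by rewrite /walsh -big_split; apply: eq_bigr => i _; rewrite ffunE signr_addb.
Qed.

Lemma sum_walsh (I : finType) (d e : cube I) :
  \sum_S walsh S d * walsh S e = (d == e)%:R * #|cube I|%:R :> R.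
Proof.
transitivity (\prod_i ((-1) ^+ (addc d e i) + 1) : R).
  rewrite bigA_distr /=; apply: eq_bigr => S _.
  by rewrite -walsh_addc /walsh big_mkcond.
have [<-|de] := eqVneq d e.
  rewrite mul1r card_ffun card_bool natrX -prodr_const.
  by apply: eq_bigr => i _; rewrite ffunE addbb expr0 -natr1.
rewrite mul0r; have [i /eqP dei] : exists i, d i != e i.
  by apply/existsP; rewrite -negb_forall; apply: contra de => /eqfunP /ffunP ->.
rewrite (bigD1 i)//= ffunE; have -> : d i (+) e i by case: (d i) (e i) dei => -[].
by rewrite expr1 addNr mul0r.
Qed.

Lemma walsh_parseval (I : finType) (f g : cube I -> R) :
  \sum_S walsh_coef f S * walsh_coef g S = avg (fun e => f e * g e).
Proof.
have N0 : #|cube I|%:R != 0 :> R by rewrite pnatr_eq0 card_ffun card_bool expn_eq0.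
rewrite /walsh_coef /avg.
set N := #|cube I|%:R in N0 *.
transitivity (N^-1 * N^-1 * \sum_d \sum_e f d * g e * \sum_S walsh S d * walsh S e : R).
  under eq_bigr do rewrite mulrACA.
  rewrite -mulr_sumr; congr (_ * _).
  under eq_bigr do rewrite mulr_suml.
  rewrite exchange_big; apply: eq_bigr => d _.
  under eq_bigr do rewrite mulr_sumr.
  rewrite exchange_big; apply: eq_bigr => e _.
  rewrite mulr_sumr; apply: eq_bigr => S _.
  by rewrite mulrACA.
rewrite -mulrA; congr (_ * _); rewrite mulr_sumr; apply: eq_bigr => d _.
under eq_bigr do rewrite sum_walsh.
rewrite (bigD1 d)//= eqxx mul1r big1 => [|e ed].
  by rewrite addr0 mulrCA mulVf ?mulr1.
by rewrite eq_sym (negPf ed) mul0r mulr0.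
Qed.

Lemma walsh_coef_addc (I : finType) (f : cube I -> R) (d : cube I) (S : {set I}) :
  walsh_coef (fun e => f (addc d e)) S = walsh S d * walsh_coef f S.
Proof.
rewrite /walsh_coef -(avg_addc d) -avgZ; apply: eq_avg => e.
by rewrite addcK walsh_addc; ring.
Qed.

Lemma walsh_delta (I : finType) (S : {set I}) (i : I) :
  walsh S (delta_cube i) = 1 - (i \in S)%:R *+ 2 :> R.
Proof.
rewrite /walsh; under eq_bigr do rewrite ffunE.
have [iS|iS] := boolP (i \in S).
  rewrite (bigD1 i)//= eqxx expr1 big1 ?mulr1 => [|j /andP[_ /negPf->]//].
  by rewrite opprD addrA subrr add0r.
rewrite big1 ?mul0rn ?subr0// => j jS.
by case: eqP => // ji; rewrite -ji jS in iS.
Qed.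

Lemma walsh_neg (I : finType) (S : {set I}) :
  walsh S (neg_cube I) = (-1) ^+ #|S| :> R.
Proof.
by rewrite /walsh -prodr_const; apply: eq_bigr => i _; rewrite ffunE expr1.
Qed.

(** Expanding [h] in Walsh functions, the flip hypothesis says that
    [\sum_S (#|S| - 1) * coef_S ^+ 2 <= 0], where the only negative term is the
    one of the empty set because evenness removes the sets of size one.  This
    is the argument of Latala and Oleszkiewicz for the sharp constant in
    Kahane's inequality. *)
Lemma even_cube_L2_L1 (I : finType) (h : cube I -> R) :
  (forall e, h (addc (neg_cube I) e) = h e) ->
  (forall e, 0 <= h e) ->
  (forall e, (#|I|%:R - 2) * h e <= \sum_i h (addc (delta_cube i) e)) ->
  avg (fun e => h e ^+ 2) <= 2 * avg h ^+ 2.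
Proof.
move=> heven h0 hflip; pose c := walsh_coef h.
have c0E : c finset.set0 = avg h.
  by apply: eq_avg => e; rewrite /walsh finset.big_set0 mulr1.
have codd (S : {set I}) : odd #|S| -> c S = 0.
  move=> oS; have := walsh_coef_addc h (neg_cube I) S.
  rewrite walsh_neg -signr_odd oS expr1.
  rewrite (_ : walsh_coef _ S = c S); last by apply: eq_avg => e; rewrite heven.
  by rewrite -/(c S); lra.
have cS : \sum_S c S ^+ 2 = avg (fun e => h e ^+ 2).
  by rewrite -walsh_parseval; apply: eq_bigr => S _; rewrite expr2.
have : (#|I|%:R - 2) * avg (fun e => h e ^+ 2) <=
       \sum_i avg (fun e => h e * h (addc (delta_cube i) e)).
  rewrite -avg_sum -avgZ; apply: ler_avg => e.
  by rewrite -mulr_sumr expr2 mulrCA ler_wpM2l.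
have -> : \sum_i avg (fun e => h e * h (addc (delta_cube i) e)) =
          \sum_(S : {set I}) (#|I|%:R - #|S|%:R *+ 2) * c S ^+ 2.
  under eq_bigr do rewrite -walsh_parseval.
  rewrite exchange_big; apply: eq_bigr => S _ /=.
  under eq_bigr do rewrite walsh_coef_addc walsh_delta mulrCA -/(c S) -expr2.
  rewrite -mulr_suml sumrB sumr_const; congr ((_ - _) * _).
  by rewrite sumrMnl -natr_sum -sum1_card [in RHS]big_mkcond; congr (_%:R *+ 2); apply: eq_bigr => i _; case: (i \in S).
rewrite -cS mulr_sumr -subr_ge0 -sumrB => H.
rewrite -c0E -subr_ge0.
have -> : 2 * c finset.set0 ^+ 2 - \sum_S c S ^+ 2 =
    \sum_S ((S == finset.set0)%:R * 2 - 1) * c S ^+ 2.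
  under [RHS]eq_bigr do rewrite mulrBl mul1r.
  rewrite sumrB; congr (_ - _); rewrite (bigD1 finset.set0)//= eqxx mul1r big1.
    by rewrite addr0.
  by move=> S /negPf->; rewrite mul0r mul0r.
rewrite -(pmulr_rge0 _ (ltr0n _ 2)) mulr_sumr; apply: le_trans H _.
apply: ler_sum => S _.
set x := c S ^+ 2.
have [->|S0] := eqVneq S finset.set0.
  by rewrite finset.cards0 mul0rn subr0 mul1r mulrBl; nra.
have : (0 < #|S|)%N by rewrite card_gt0.
rewrite mul0r sub0r mulN1r; case En : #|S| => [//|[|n]] _.
  by rewrite /x codd ?En// expr0n /= oppr0 !mulr0 subr0 lexx.
have x0 : 0 <= x by exact: sqr_ge0.
have : 0 <= n%:R * x by rewrite mulr_ge0.
by rewrite -[n.+2%:R]natr1 -[n.+1%:R]natr1 -[_ *+ 2]mulr_natr; nra.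
Qed.

End Cube.

Section Rademacher.
Context {R : realType}.

Notation cube I := {ffun I -> bool}.
Notation C := R[i].

Definition cabs (a : C) : R := complex.Re `|a|.

Lemma normC_cabs (a : C) : `|a| = (cabs a)%:C.
Proof. by case: a => a b; rewrite /cabs normc_def. Qed.

Lemma cabsM (a b : C) : cabs (a * b) = cabs a * cabs b.
Proof.
by apply: (@complexI R); rewrite rmorphM/= -!normC_cabs normrM.
Qed.

Lemma cabs_ge0 (a : C) : 0 <= cabs a.
Proof. by rewrite -(@lecR R) -normC_cabs normr_ge0. Qed.

Lemma ler_cabsD (a b : C) : cabs (a + b) <= cabs a + cabs b.
Proof. by rewrite -(@lecR R) rmorphD/= -!normC_cabs ler_normD. Qed.

Lemma cabs_real (a : R) : cabs a%:C = `|a|.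
Proof. by rewrite /cabs normc_def /= expr0n addr0 sqrtr_sqr. Qed.

Lemma cabs_sqr (a : C) : cabs a ^+ 2 = complex.Re a ^+ 2 + complex.Im a ^+ 2.
Proof.
by case: a => a b; rewrite /cabs normc_def /= sqr_sqrtr// addr_ge0// sqr_ge0.
Qed.

Lemma cabs_sign (b : bool) : cabs ((-1) ^+ b) = 1.
Proof. by case: b; rewrite /cabs ?expr1 ?normrN normr1. Qed.

Lemma cabs1 : cabs (1 : C) = 1. Proof. exact: (cabs_sign false). Qed.

Lemma cabs_eq0 (a : C) : (cabs a == 0) = (a == 0).
Proof. by rewrite -(inj_eq (@complexI R)) -normC_cabs normr_eq0. Qed.

Lemma cabsV (a : C) : cabs a^-1 = (cabs a)^-1.
Proof.
have [->|a0] := eqVneq a 0; first by rewrite invr0 (cabs_real 0) normr0 invr0.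
apply: (@mulIf _ (cabs a)); first by rewrite cabs_eq0.
by rewrite -cabsM mulVf// cabs1 mulVf// cabs_eq0.
Qed.

Lemma cabsX (a : C) n : cabs (a ^+ n) = cabs a ^+ n.
Proof. by elim: n => [|n IH]; rewrite ?expr0 ?cabs1// !exprS cabsM IH. Qed.

Definition seminorm (V : lmodType C) (N : V -> R) : Prop :=
  (forall u v, N (u + v) <= N u + N v) /\
  (forall a v, N (a *: v) = cabs a * N v).

Section Seminorm.
Variables (V : lmodType C) (N : V -> R).
Hypothesis sN : seminorm N.

Lemma seminorm0 : N 0 = 0.
Proof. by rewrite -(scale0r 0) sN.2 cabs_real normr0 mul0r. Qed.

Lemma seminormN v : N (- v) = N v.
Proof. by rewrite -scaleN1r sN.2 -(expr1 (-1)) (cabs_sign true) mul1r. Qed.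

Lemma seminorm_ge0 v : 0 <= N v.
Proof.
have := sN.1 v (- v); rewrite subrr seminorm0 seminormN.
by rewrite -mulr2n pmulrn_lge0.
Qed.

Lemma seminorm_sum (I : Type) (r : seq I) (P : pred I) (F : I -> V) :
  N (\sum_(i <- r | P i) F i) <= \sum_(i <- r | P i) N (F i).
Proof.
elim/big_rec2: _ => [|i y x _ IH]; first by rewrite seminorm0.
by apply: le_trans (sN.1 _ _) _; rewrite lerD2l.
Qed.

Lemma seminormZ_real (a : R) v : N (a%:C *: v) = `|a| * N v.
Proof. by rewrite sN.2 cabs_real. Qed.

Lemma seminormZ_sign (b : bool) v : N ((-1) ^+ b *: v) = N v.
Proof. by rewrite sN.2 cabs_sign mul1r. Qed.

End Seminorm.

Lemma cabs_seminorm : seminorm (cabs : C^o -> R).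
Proof. by split; [exact: ler_cabsD | exact: cabsM]. Qed.

Definition rsum (V : lmodType C) (I : finType) (e : cube I) (v : I -> V) : V :=
  \sum_i (-1) ^+ (e i) *: v i.

Lemma rsum_addc (V : lmodType C) (I : finType) (d e : cube I) (v : I -> V) :
  rsum (addc d e) v = rsum e (fun i => (-1) ^+ (d i) *: v i).
Proof.
by apply: eq_bigr => i _; rewrite ffunE signr_addb scalerA mulrC.
Qed.

Lemma rsum_scale (V : lmodType C) (I : finType) (e : cube I) (a : C) (v : I -> V) :
  rsum e (fun i => a *: v i) = a *: rsum e v.
Proof.
by rewrite /rsum scaler_sumr; apply: eq_bigr => i _; rewrite !scalerA mulrC.
Qed.

Lemma eq_rsum (V : lmodType C) (I : finType) (e : cube I) (v w : I -> V) :
  v =1 w -> rsum e v = rsum e w.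
Proof. by move=> vw; apply: eq_bigr => i _; rewrite vw. Qed.

Lemma kahane (V : lmodType C) (N : V -> R) (I : finType) (v : I -> V) :
  seminorm N ->
  avg (fun e : cube I => N (rsum e v) ^+ 2) <=
    2 * avg (fun e : cube I => N (rsum e v)) ^+ 2.
Proof.
move=> sN; apply: even_cube_L2_L1 => [e|e|e].
- rewrite rsum_addc (@eq_rsum _ _ _ _ (fun i => (-1) *: v i)) => [|i].
    by rewrite rsum_scale scaleN1r seminormN.
  by rewrite ffunE expr1.
- exact: seminorm_ge0.
have -> : \sum_i N (rsum (addc (delta_cube i) e) v) =
          \sum_i N (rsum e v - 2%:R *: ((-1) ^+ e i *: v i)).
  apply: eq_bigr => i _; congr N.
  rewrite rsum_addc /rsum (bigD1 i)//= [in RHS](bigD1 i)//= ffunE eqxx expr1.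
  rewrite addrAC; congr (_ + _).
    by rewrite scaleN1r scalerN scaler_nat mulr2n opprD addrA subrr add0r.
  by apply: eq_bigr => j /negPf ji; rewrite ffunE ji expr0 scale1r.
apply: le_trans (seminorm_sum sN _ _ _).
rewrite sumrB sumr_const -scaler_sumr -/(rsum e v) -[rsum e v *+ _]scaler_nat -scalerBl.
rewrite sN.2 ler_wpM2r ?seminorm_ge0//.
have -> : #|I|%:R - 2%:R = (#|I|%:R - 2)%:C :> C.
  by rewrite rmorphB !rmorph_nat.
by rewrite cabs_real ler_norm.
Qed.

(** Mean of [F] for the product measure on the cube with [i]-th mean sign [a i]. *)
Definition cube_weight (I : finType) (a : I -> R) (d : cube I) : R :=
  \prod_i ((1 + (-1) ^+ (d i) * a i) / 2).

Lemma sum_cube_weight (I : finType) (a : I -> R) : \sum_d cube_weight a d = 1.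
Proof.
rewrite -(bigA_distr_bigA (fun (i : I) (b : bool) => (1 + (-1) ^+ b * a i) / 2)) /=.
by rewrite big1// => i _; rewrite big_bool/= expr1 expr0; field.
Qed.

Lemma sum_cube_weight_sign (I : finType) (a : I -> R) (j : I) :
  \sum_d cube_weight a d * (-1) ^+ (d j) = a j.
Proof.
transitivity (\sum_(d : cube I)
   \prod_i (((1 + (-1) ^+ (d i) * a i) / 2) * (if i == j then (-1) ^+ (d i) else 1))).
  apply: eq_bigr => d _; rewrite big_split /=; congr (_ * _).
  by rewrite -big_mkcond big_pred1_eq.
rewrite -(bigA_distr_bigA
  (fun (i : I) (b : bool) => (1 + (-1) ^+ b * a i) / 2 * (if i == j then (-1) ^+ b else 1))) /=.
rewrite (bigD1 j)//= [X in _ * X]big1 => [|i /negPf ij].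
  by rewrite big_bool/= eqxx expr1 expr0; field.
by rewrite big_bool/= ij expr1 expr0; field.
Qed.

Definition jensen (phi : R -> R) : Prop :=
  (forall x y, 0 <= x -> x <= y -> phi x <= phi y) /\
  forall (T : finType) (w x : T -> R), (forall t, 0 <= w t) -> \sum_t w t = 1 ->
    (forall t, 0 <= x t) -> phi (\sum_t w t * x t) <= \sum_t w t * phi (x t).

Lemma jensen_id : jensen id. Proof. by split. Qed.

Lemma jensen_sqr : jensen (fun x => x ^+ 2).
Proof.
split=> [x y x0 xy|T w x w0 w1 x0]; first by have y0 := le_trans x0 xy; rewrite /= ler_sqr ?nnegrE.
set m := \sum_t _.
have : 0 <= \sum_t w t * (x t - m) ^+ 2.
  by apply: sumr_ge0 => t _; rewrite mulr_ge0// sqr_ge0.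
have -> : \sum_t w t * (x t - m) ^+ 2 = \sum_t w t * x t ^+ 2 - m ^+ 2.
  transitivity (\sum_t (w t * x t ^+ 2 - 2 * m * (w t * x t) + m ^+ 2 * w t)).
    by apply: eq_bigr => t _; ring.
  by rewrite big_split/= sumrB -!mulr_sumr w1 -/m; ring.
by rewrite subr_ge0.
Qed.

Lemma contraction (V : lmodType C) (N : V -> R) (phi : R -> R) (I : finType)
    (v : I -> V) (a : I -> R) :
  seminorm N -> jensen phi -> (forall i, `|a i| <= 1) ->
  avg (fun e : cube I => phi (N (rsum e (fun i => (a i)%:C *: v i)))) <=
  avg (fun e : cube I => phi (N (rsum e v))).
Proof.
move=> sN [phi_mono phi_conv] a1.
have w0 d : 0 <= cube_weight a d.
  apply: prodr_ge0 => i _; rewrite divr_ge0//.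
  have /lerNnormlW := a1 i; have /ler_normlW := a1 i.
  by case: (d i); rewrite ?expr1 ?expr0; lra.
have aE e : rsum e (fun i => (a i)%:C *: v i) =
    \sum_d (cube_weight a d)%:C *: rsum (addc d e) v.
  under [RHS]eq_bigr do rewrite rsum_addc -rsum_scale.
  rewrite exchange_big; apply: eq_bigr => i _ /=.
  rewrite -scaler_sumr; congr (_ *: _).
  under eq_bigr do rewrite scalerA.
  rewrite -scaler_suml -(sum_cube_weight_sign a i) rmorph_sum; congr (_ *: _).
  by apply: eq_bigr => d _; rewrite rmorphM rmorph_sign.
apply: (@le_trans _ _ (avg (fun e : cube I =>
    \sum_d cube_weight a d * phi (N (rsum (addc d e) v))))).
  apply: ler_avg => e; rewrite aE; apply: le_trans (phi_conv _ _ _ w0 (sum_cube_weight a) _).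
    apply: phi_mono; first exact: seminorm_ge0.
    apply: le_trans (seminorm_sum sN _ _ _) _; apply: ler_sum => d _.
    by rewrite seminormZ_real// ger0_norm.
  by move=> d; exact: seminorm_ge0.
rewrite avg_sum; under eq_bigr do rewrite avgZ (avg_addc _ (fun e => phi (N (rsum e v)))).
by rewrite -mulr_suml sum_cube_weight mul1r.
Qed.

Lemma contraction_ge (V : lmodType C) (N : V -> R) (phi : R -> R) (I : finType)
    (v : I -> V) (k : R) (a : I -> R) :
  seminorm N -> jensen phi -> 0 <= k -> (forall i, k <= a i) ->
  avg (fun e : cube I => phi (N (k%:C *: rsum e v))) <=
  avg (fun e : cube I => phi (N (rsum e (fun i => (a i)%:C *: v i)))).
Proof.
move=> sN jphi k0 ka; pose b i := k / a i.
have b1 i : `|b i| <= 1.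
  have a0 : 0 <= a i by exact: le_trans (ka i).
  rewrite ger0_norm ?divr_ge0// /b.
  have [->|an0] := eqVneq (a i) 0; first by rewrite invr0 mulr0.
  by rewrite ler_pdivrMr ?mul1r// lt0r an0.
apply: le_trans (contraction (fun i => (a i)%:C *: v i) sN jphi b1).
apply: ler_avg => e; rewrite -rsum_scale (@eq_rsum _ _ e _ (fun i => (b i)%:C *: ((a i)%:C *: v i)))// => i.
rewrite scalerA -rmorphM /b; have [a0|an0] := eqVneq (a i) 0; last by rewrite divfK.
have k00 : k = 0 by apply/eqP; rewrite eq_le k0 -a0 ka.
by rewrite k00 a0 mulr0.
Qed.

Lemma ler_Re_cabs (a : C) : `|complex.Re a| <= cabs a.
Proof.
rewrite -(@ler_pXn2r _ 2)// ?nnegrE ?cabs_ge0// real_normK ?num_real//.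
by rewrite cabs_sqr lerDl sqr_ge0.
Qed.

Lemma ler_Im_cabs (a : C) : `|complex.Im a| <= cabs a.
Proof.
rewrite -(@ler_pXn2r _ 2)// ?nnegrE ?cabs_ge0// real_normK ?num_real//.
by rewrite cabs_sqr lerDr sqr_ge0.
Qed.

Lemma cabs_i : cabs 'i%C = 1.
Proof. by rewrite /cabs normc_def /= expr0n expr1n add0r sqrtr1. Qed.

Lemma seminorm_rsum_complex (V : lmodType C) (N : V -> R) (I : finType)
    (v : I -> V) (a : I -> C) (e : cube I) :
  seminorm N ->
  N (rsum e (fun i => a i *: v i)) <=
    N (rsum e (fun i => (complex.Re (a i))%:C *: v i)) +
    N (rsum e (fun i => (complex.Im (a i))%:C *: v i)).
Proof.
move=> sN; rewrite -[X in _ <= _ + X]mul1r -cabs_i -sN.2 -rsum_scale.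
apply: le_trans (sN.1 _ _); rewrite /rsum -big_split/= le_eqVlt.
apply/orP; left; apply/eqP; congr N.
by apply: eq_bigr => i _; rewrite -scalerDr scalerA -scalerDl {1}[a i]complexE.
Qed.

Lemma contraction_complex (V : lmodType C) (N : V -> R) (I : finType)
    (v : I -> V) (a : I -> C) :
  seminorm N -> (forall i, cabs (a i) <= 1) ->
  avg (fun e : cube I => N (rsum e (fun i => a i *: v i))) <=
  2 * avg (fun e : cube I => N (rsum e v)).
Proof.
move=> sN a1; rewrite mulrDl mul1r.
have re1 i := le_trans (ler_Re_cabs (a i)) (a1 i).
have im1 i := le_trans (ler_Im_cabs (a i)) (a1 i).
apply: le_trans (lerD (contraction _ sN jensen_id re1) (contraction _ sN jensen_id im1)).
by rewrite -avgD; apply: ler_avg => e; exact: seminorm_rsum_complex.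
Qed.

Lemma contraction_complex_sqr (V : lmodType C) (N : V -> R) (I : finType)
    (v : I -> V) (a : I -> C) :
  seminorm N -> (forall i, cabs (a i) <= 1) ->
  avg (fun e : cube I => N (rsum e (fun i => a i *: v i)) ^+ 2) <=
  4 * avg (fun e : cube I => N (rsum e v) ^+ 2).
Proof.
move=> sN a1.
have re1 i := le_trans (ler_Re_cabs (a i)) (a1 i).
have im1 i := le_trans (ler_Im_cabs (a i)) (a1 i).
have H := lerD (contraction v sN jensen_sqr re1) (contraction v sN jensen_sqr im1).
apply: (@le_trans _ _ (2 * (avg (fun e => N (rsum e (fun i => (complex.Re (a i))%:C *: v i)) ^+ 2)
  + avg (fun e => N (rsum e (fun i => (complex.Im (a i))%:C *: v i)) ^+ 2)))); last by lra.
rewrite -avgD -avgZ; apply: ler_avg => e.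
have := seminorm_rsum_complex v a e sN.
have := seminorm_ge0 sN (rsum e (fun i => a i *: v i)).
by set x := N _; set y := N _; set z := N _; have := sqr_ge0 (y - z); nra.
Qed.

Lemma avg_sign2 (I : finType) (i j : I) :
  avg (fun e : cube I => (-1) ^+ (e i) * (-1) ^+ (e j)) = (i == j)%:R :> R.
Proof.
have [->|ij] := eqVneq i j.
  rewrite (@eq_avg _ _ _ (fun=> 1)) ?(avg_cst [ffun=> true])// => e.
  by rewrite -signr_addb addbb.
have := avg_addc (delta_cube i) (fun e : cube I => (-1) ^+ (e i) * (-1) ^+ (e j) : R).
rewrite (@eq_avg _ _ _ (fun e : cube I => (-1) * ((-1) ^+ (e i) * (-1) ^+ (e j)))).
  by rewrite avgZ mulr0n; lra.
by move=> e; rewrite !ffunE eqxx eq_sym (negPf ij) signr_addb expr1 mulrA.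
Qed.

Lemma avg_sqr_rsum (I : finType) (b : I -> R) :
  avg (fun e : cube I => (\sum_i (-1) ^+ (e i) * b i) ^+ 2) = \sum_i b i ^+ 2.
Proof.
transitivity (avg (fun e : cube I =>
   \sum_i \sum_j (b i * b j) * ((-1) ^+ (e i) * (-1) ^+ (e j)))).
  apply: eq_avg => e; rewrite expr2 mulr_suml; apply: eq_bigr => i _.
  by rewrite mulr_sumr; apply: eq_bigr => j _; ring.
rewrite avg_sum; apply: eq_bigr => i _; rewrite avg_sum (bigD1 i)//= big1.
  by rewrite avgZ avg_sign2 eqxx mulr1 addr0.
by move=> j /negPf ji; rewrite avgZ avg_sign2 eq_sym ji mulr0.
Qed.

Lemma khintchine (I : finType) (a : I -> C) :
  \sum_i cabs (a i) ^+ 2 <=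
    2 * avg (fun e : cube I => cabs (rsum e (a : I -> C^o))) ^+ 2.
Proof.
apply: le_trans (kahane (a : I -> C^o) cabs_seminorm).
rewrite (@eq_avg _ _ _ (fun e : cube I =>
   (\sum_i (-1) ^+ (e i) * complex.Re (a i)) ^+ 2 +
   (\sum_i (-1) ^+ (e i) * complex.Im (a i)) ^+ 2)).
  rewrite avgD !avg_sqr_rsum -big_split/=.
  by rewrite le_eqVlt; apply/orP; left; apply/eqP/eq_bigr => i _; exact: cabs_sqr.
move=> e; rewrite cabs_sqr /rsum !raddf_sum /=.
by congr (_ ^+ 2 + _ ^+ 2); apply: eq_bigr => i _; case: (e i); case: (a i) => x y;
  rewrite ?expr1 ?expr0 /=; simpc; rewrite /GRing.scale/=; ring.
Qed.

Lemma sum_pair (V : nmodType) (J D : finType) (F : J * D -> V) :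
  \sum_i F i = \sum_j \sum_d F (j, d).
Proof. by rewrite pair_big /=; apply: eq_bigr => -[]. Qed.

Lemma avg_pair (J D : finType) (F : J * D -> R) :
  avg F = avg (fun j => avg (fun d => F (j, d))).
Proof. by rewrite /avg card_prod natrM invfM -mulrA sum_pair -mulr_sumr. Qed.

(** Replacing the independent symmetric variables
    [xi j = \sum_d e (j, d) * c d] by signs times their mean absolute value:
    multiplying [e (j, .)] by a common sign does not change the law, and that
    sign can absorb the sign of [xi j]. *)
Lemma rsum_blocks_ge (V : lmodType C) (N : V -> R) (J D : finType)
    (v : J -> V) (c : D -> R) (k : R) :
  seminorm N -> 0 <= k -> k ^+ 2 * 2 <= \sum_d c d ^+ 2 ->
  k * avg (fun e : cube J => N (rsum e v)) <=
  avg (fun e : cube (J * D)%type => N (rsum e (fun i => (c i.2)%:C *: v i.1))).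
Proof.
move=> sN k0 kc.
pose xi (e : cube (J * D)%type) j := \sum_d (-1) ^+ (e (j, d)) * c d.
have rsumE e : rsum e (fun i => (c i.2)%:C *: v i.1) = \sum_j (xi e j)%:C *: v j.
  rewrite /rsum sum_pair.
  apply: eq_bigr => j _; rewrite /xi rmorph_sum scaler_suml; apply: eq_bigr => d _.
  by rewrite scalerA rmorphM rmorph_sign.
pose G (d : cube J) (e : cube (J * D)%type) := N (\sum_j ((-1) ^+ d j * xi e j)%:C *: v j).
pose m j := avg (fun e => `|xi e j|).
have km j : k <= m j.
  have := khintchine (fun i : J * D => ((i.1 == j)%:R * c i.2)%:C).
  rewrite sum_pair.
  rewrite (bigD1 j)//= [X in _ + X]big1 => [|j' /negPf j'j]; last first.
    by rewrite big1// => d _; rewrite j'j mul0r cabs_real normr0 expr0n.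
  rewrite addr0; under eq_bigr do rewrite eqxx mul1r cabs_real real_normK ?num_real//.
  rewrite (@eq_avg _ _ _ (fun e => `|xi e j|)) => [|e]; last first.
    rewrite -cabs_real; congr cabs.
    rewrite /rsum sum_pair.
    rewrite (bigD1 j)//= [X in _ + X]big1 => [|j' /negPf j'j]; last first.
      by rewrite big1// => d _; rewrite j'j mul0r scaler0.
    rewrite addr0 /xi rmorph_sum; apply: eq_bigr => d _.
    by rewrite eqxx mul1r rmorphM rmorph_sign.
  move=> H; have {H} : k ^+ 2 <= m j ^+ 2.
    by rewrite -(ler_pM2r (ltr0n _ 2)) (le_trans kc)// mulrC.
  by rewrite ler_sqr// nnegrE; apply: avg_ge0.
have -> : avg (fun e : cube (J * D)%type => N (rsum e (fun i => (c i.2)%:C *: v i.1)))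
        = avg (fun d => avg (G d)).
  rewrite [RHS](@eq_avg _ _ _ (fun=> avg (fun e => N (\sum_j (xi e j)%:C *: v j)))).
    by rewrite (avg_cst [ffun=> true]); apply: eq_avg => e; rewrite rsumE.
  move=> d; rewrite -[RHS](avg_addc [ffun i => d i.1]); apply: eq_avg => e.
  congr N; apply: eq_bigr => j _; congr (_%:C *: _); rewrite /xi mulr_sumr.
  by apply: eq_bigr => i _; rewrite !ffunE/= signr_addb mulrA.
have -> : avg (fun d => avg (G d)) =
    avg (fun d : cube J => avg (fun e => N (\sum_j ((-1) ^+ d j * `|xi e j|)%:C *: v j))).
  rewrite avg_exchange [RHS]avg_exchange; apply: eq_avg => e.
  rewrite -(avg_addc [ffun j => (xi e j < 0)]); apply: eq_avg => d; congr N.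
  apply: eq_bigr => j _; rewrite !ffunE signr_addb -mulrA mulrCA.
  congr ((_ * _)%:C *: _).
  have [x0|x0] := ltP (xi e j) 0; first by rewrite ltr0_norm// expr1 mulN1r.
  by rewrite ger0_norm// expr0 mul1r.
have := contraction_ge v sN jensen_id k0 km; rewrite (@eq_avg _ _ _ (fun e => k * N (rsum e v))).
  rewrite avgZ => /le_trans; apply; apply: ler_avg => d.
  have -> : rsum d (fun i => (m i)%:C *: v i) =
     (#|cube (J * D)%type|%:R^-1)%:C *: \sum_e \sum_j ((-1) ^+ d j * `|xi e j|)%:C *: v j.
    rewrite exchange_big scaler_sumr; apply: eq_bigr => j _.
    rewrite -scaler_suml !scalerA -rmorph_sum/= -rmorphM/=; congr (_ *: _).
    rewrite -mulr_sumr mulrCA [in RHS]rmorphM. by congr (_ * _); case: (d j); rewrite ?expr1 ?expr0 ?rmorphN ?rmorph1.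
  rewrite seminormZ_real// ger0_norm ?invr_ge0//= /avg ler_wpM2l ?invr_ge0//.
  exact: seminorm_sum.
by move=> e /=; rewrite seminormZ_real// ger0_norm.
Qed.

End Rademacher.

Section AlmostPeriodicMean.
Context {R : realType}.
Variables (T : Type) (mul : T -> T -> T) (U : set T) (one : T).
Hypothesis mulA : associative mul.
Hypothesis U1 : U one.
Hypothesis UM : forall g h, U g -> U h -> U (mul g h).
Hypothesis Udiv : forall g g0, U g -> U g0 -> exists2 h, U h & mul g h = g0.
Variables (Phi : T -> R) (B : R).
Hypothesis PhiB : forall g, U g -> `|Phi g| <= B.
Hypothesis Phi_ap : forall r, 0 < r ->
  exists (I : finType) (k : I -> T), (forall i, U (k i)) /\
    forall h, U h -> exists i, forall g g', U g -> U g' ->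
      `|Phi (mul (mul g h) g') - Phi (mul (mul g (k i)) g')| <= r.

(** The existence of a mean for almost periodic functions on a group: averages
    of translates come arbitrarily close to a constant.  The constant is the
    infimum [M] of the suprema of all such averages.  Take an average whose
    supremum is almost [M]; if it were much below [M] somewhere, then, every
    group element being moved close to that place by one of finitely many
    translations, averaging over these translations would push the supremum
    below [M]. *)
Lemma almost_periodic_mean (delta : R) : 0 < delta ->
  exists (I : finType) (k : I -> T) (a : R), (exists i : I, true) /\ (forall i, U (k i)) /\
    forall g, U g -> `|avg (fun i => Phi (mul g (k i))) - a| <= delta.
Proof.
move=> d0.
pose S : set R := [set s | exists (I : finType) (i0 : I) (k : I -> T),
  (forall i, U (k i)) /\ forall g, U g -> avg (fun i => Phi (mul g (k i))) <= s].
have S0 : S !=set0.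
  exists B, unit, tt, (fun=> one); split => // g Ug.
  apply: le_trans (ler_norm _) _; rewrite -[avg _]subr0; apply: (avg_dist tt) => _.
  by rewrite subr0; apply/PhiB/UM.
have lS : has_lbound S.
  exists (- B) => s [I [i0 [k [Uk Hk]]]]; apply: le_trans (Hk _ U1).
  suff : `|avg (fun i => Phi (mul one (k i)))| <= B by move=> /lerNnormlW.
  rewrite -[avg _]subr0; apply: (avg_dist i0) => i.
  by rewrite subr0; apply/PhiB/UM.
pose M := inf S.
have [J [k [Uk netk]]] := Phi_ap (divr_gt0 d0 (ltr0n _ 4)).
have [j0 _] := netk _ U1.
have n0 : 0 < #|J|%:R :> R by rewrite ltr0n; apply/card_gt0P; exists j0.
have [||s [I [i0 [q [Uq Hq]]]] sM] := @inf_adherent _ S (delta / (4 * #|J|%:R)).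
- by rewrite divr_gt0// mulr_gt0.
- by split.
rewrite -/M in sM; set eta := delta / _ in sM.
have eta0 : eta * (4 * #|J|%:R) = delta by rewrite /eta divfK// mulf_neq0// lt0r_neq0.
have n1 : 1 <= #|J|%:R :> R by rewrite ler1n -(ltr0n R).
have eta_gt0 : 0 < eta by rewrite /eta divr_gt0// mulr_gt0.
exists I, q, M; split; [by exists i0|split=> // g0 Ug0].
set A := fun g => avg (fun i => Phi (mul g (q i))).
have Aub g : U g -> A g <= M + eta by move=> Ug; apply/(le_trans (Hq _ Ug))/ltW.
rewrite -/(A g0) ler_norml; apply/andP; split; last first.
  by rewrite lerBlDl (le_trans (Aub _ Ug0))// lerD2l; nra.
rewrite lerBrDl leNgt; apply/negP => Alow.
have : S (M - eta).
  exists (J * I)%type, (j0, i0), (fun p => mul (k p.1) (q p.2)).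
  split=> [p|g Ug]; first exact: UM.
  have -> : avg (fun i => Phi (mul g (mul (k i.1) (q i.2)))) =
            avg (fun j => A (mul g (k j))).
    by rewrite avg_pair; apply: eq_avg => j; apply: eq_avg => i; rewrite mulA.
  have [h Uh ghg0] := Udiv Ug Ug0.
  have [j netj] := netk _ Uh.
  have Aj : A (mul g (k j)) <= M - delta + delta / 4.
    apply: (@le_trans _ _ (A g0 + delta / 4)); last by rewrite lerD2r ltW.
    rewrite -ghg0 -lerBlDl /A; apply: le_trans (ler_norm _) _.
    rewrite -[X in `|_ - X|]mul1r -mulNr -avgZ -avgD -[avg _]subr0.
    apply: (avg_dist i0) => i; rewrite subr0 mulN1r distrC.
    exact: netj.
  rewrite /avg ler_pdivrMl// (bigD1 j)//=.
  apply: (@le_trans _ _ (M - delta + delta / 4 + \sum_(i | i != j) (M + eta))).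
    by rewrite lerD// ler_sum// => i _; apply/Aub/UM.
  have -> : \sum_(i | i != j) (M + eta) = (M + eta) * (#|J|%:R - 1).
    rewrite sumr_const cardC1 -[_ *+ _]mulr_natr; congr (_ * _).
    by rewrite -[in RHS](prednK (n := #|J|)) -?(ltr0n R)// -natr1 addrK.
  by nra.
move=> /(ge_inf lS); rewrite -/M lerBrDl gerDr; lra.
Qed.

End AlmostPeriodicMean.

Section Unitary.
Context {R : realType}.

Notation cube I := {ffun I -> bool}.
Notation C := R[i].

Definition adj m n (g : 'M[C]_(m, n)) : 'M[C]_(n, m) := (map_mx conjc g)^T.

Definition unitary n : set 'M[C]_n := [set g | g *m adj g = 1%:M].

Lemma adjM m n p (g : 'M[C]_(m, n)) (h : 'M[C]_(n, p)) :
  adj (g *m h) = adj h *m adj g.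
Proof. by rewrite /adj map_mxM trmx_mul. Qed.

Lemma adjK m n (g : 'M[C]_(m, n)) : adj (adj g) = g.
Proof. by apply/matrixP => i j; rewrite !mxE conjcK. Qed.

Lemma adjE m n (g : 'M[C]_(m, n)) i j : adj g i j = conjc (g j i).
Proof. by rewrite !mxE. Qed.

Lemma unitary1 n : @unitary n 1%:M.
Proof. by rewrite /unitary/= mul1mx; apply/matrixP => i j; rewrite !mxE eq_sym conjc_nat. Qed.

Lemma unitaryM n (g h : 'M[C]_n) : unitary g -> unitary h -> unitary (g *m h).
Proof.
rewrite /unitary/= => Ug Uh.
by rewrite adjM mulmxA -(mulmxA g) Uh mulmx1.
Qed.

Lemma unitary_div n (g g0 : 'M[C]_n) : unitary g -> unitary g0 ->
  exists2 h, unitary h & g *m h = g0.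
Proof.
move=> Ug Ug0; exists (adj g *m g0); last by rewrite mulmxA Ug mul1mx.
by apply: unitaryM => //; rewrite /unitary/= adjK; exact: mulmx1C.
Qed.

Lemma mul_conjc (a : C) : a * conjc a = (cabs a ^+ 2)%:C.
Proof. by rewrite cabs_sqr add_Re2_Im2 sqr_normc. Qed.

Lemma mul_adj_diag m n (g : 'M[C]_(m, n)) i :
  (g *m adj g) i i = (\sum_j cabs (g i j) ^+ 2)%:C.
Proof.
by rewrite mxE rmorph_sum; apply: eq_bigr => j _; rewrite adjE mul_conjc.
Qed.

Lemma unitary_row n (g : 'M[C]_n) i : unitary g -> \sum_j cabs (g i j) ^+ 2 = 1.
Proof. by move=> Ug; apply: complexI; rewrite -mul_adj_diag Ug mxE eqxx. Qed.

Lemma cabs_conjc (a : C) : cabs (conjc a) = cabs a.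
Proof. by case: a => a b; rewrite /cabs !normc_def /= sqrrN. Qed.

Lemma unitary_col n (g : 'M[C]_n) j : unitary g -> \sum_i cabs (g i j) ^+ 2 = 1.
Proof.
move=> Ug; rewrite -(@unitary_row _ (adj g) j).
  by apply: eq_bigr => i _; rewrite adjE cabs_conjc.
by rewrite /unitary/= adjK; exact: mulmx1C.
Qed.

Lemma unitary_cabs n (g : 'M[C]_n) i j : unitary g -> cabs (g i j) <= 1.
Proof.
move=> Ug; rewrite -(@expr_le1 _ 2)// ?cabs_ge0// -(unitary_row i Ug).
by rewrite (bigD1 j)//= lerDl; apply: sumr_ge0 => k _; exact: sqr_ge0.
Qed.

(** A finite [r]-net of the unitary group: one representative for each cell of
    a grid that contains a unitary matrix. *)
Lemma unitary_net n (r : R) : 0 < r ->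
  exists (I : finType) (k : I -> 'M[C]_n), (forall i, unitary (k i)) /\
    forall h, unitary h -> exists i, forall a b, cabs (h a b - k i a b) <= r.
Proof.
move=> r0; pose K := (Num.truncn (2 / r)).+1.
have K0 : 0 < K%:R :> R by rewrite ltr0n.
have Kr : 2 / K%:R < r.
  by rewrite ltr_pdivrMr// mulrC -ltr_pdivrMr// truncnS_gt.
pose cell (x : R) : 'I_(K.*2.+1) := inord (Num.truncn ((x + 1) * K%:R)).
have cellP x y : `|x| <= 1 -> `|y| <= 1 -> cell x = cell y -> `|x - y| <= 1 / K%:R.
  have bnd (z : R) : `|z| <= 1 -> ((z + 1) * K%:R >= 0) && (Num.truncn ((z + 1) * K%:R) < K.*2.+1)%N.
    rewrite ler_norml => /andP[z1 z2]; apply/andP; split; first by rewrite mulr_ge0//; lra.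
    rewrite ltnS -(ler_nat R); apply: (@le_trans _ _ ((z + 1) * K%:R)); first by rewrite truncn_le mulr_ge0//; lra.
    by rewrite -mul2n natrM ler_wpM2r//; lra.
  move=> /bnd/andP[x0 xK] /bnd/andP[y0 yK] /(congr1 val); rewrite /= !inordK// => E.
  have /andP[y1 y2] := truncn_itv y0; have /andP[x1 x2] := truncn_itv x0.
  rewrite -E in y1 y2.
  rewrite ler_pdivlMr// -[K%:R](ger0_norm (ltW K0)) -normrM ler_norml.
  rewrite -natr1 in y2; rewrite -natr1 in x2.
  by apply/andP; split; lra.
pose code (h : 'M[C]_n) : {ffun 'I_n * 'I_n -> 'I_(K.*2.+1) * 'I_(K.*2.+1)} :=
  [ffun p => (cell (complex.Re (h p.1 p.2)), cell (complex.Im (h p.1 p.2)))].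
have /boolp.choice [k kP] : forall c : {ffun 'I_n * 'I_n -> 'I_(K.*2.+1) * 'I_(K.*2.+1)},
    exists k : 'M[C]_n, unitary k /\ forall h, unitary h -> code h = c -> code k = c.
  move=> c.
  have [[h [Uh hc]]|nh] := pselect (exists h, unitary h /\ code h = c).
    by exists h.
  by exists 1%:M; split=> [|h Uh hc]; [exact: unitary1|case: nh; exists h].
exists _, k; split=> [c|h Uh]; first by have [] := kP c.
exists (code h) => a b; have [Uk /(_ h Uh erefl)] := kP (code h).
set g := k _ in Uk * => /ffunP/(_ (a, b)); rewrite !ffunE /= => -[Ere Eim].
have le1 (z : C) : cabs z <= 1 -> `|complex.Re z| <= 1 /\ `|complex.Im z| <= 1.
  by move=> z1; split; apply: le_trans z1; [exact: ler_Re_cabs|exact: ler_Im_cabs].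
have [hr hi] := le1 _ (unitary_cabs a b Uh).
have [gr gi] := le1 _ (unitary_cabs a b Uk).
have := cellP _ _ hr gr (esym Ere); have := cellP _ _ hi gi (esym Eim).
move: (h a b) (g a b) => -[h1 h2] [g1 g2] /= Him Hre; apply: le_trans (ltW Kr).
rewrite [_ - _]complexE; apply: le_trans (ler_cabsD _ _) _.
by rewrite cabsM cabs_i mul1r !cabs_real /=; lra.
Qed.

End Unitary.

Section Rotation.
Context {R : realType}.

Notation cube I := {ffun I -> bool}.
Notation C := R[i].

Lemma ler_cabs_sum (I : finType) (F : I -> C) : cabs (\sum_i F i) <= \sum_i cabs (F i).
Proof. exact: (seminorm_sum (@cabs_seminorm R)). Qed.

Variables (V : lmodType C) (N : V -> R) (n : nat) (y : 'I_n.+1 -> V).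
Hypothesis sN : seminorm N.

Let M_ := 'M[C]_n.+1.
Let total : R := \sum_j N (y j).
Let lin (g : M_) : V := \sum_j g j 0 *: y j.
Let Phi (g : M_) : R := N (lin g) ^+ 2.

Let total_ge0 : 0 <= total.
Proof. by apply: sumr_ge0 => j _; exact: seminorm_ge0. Qed.

Let lin_le (g : M_) (r : R) : (forall j, cabs (g j 0) <= r) -> N (lin g) <= r * total.
Proof.
move=> gr; apply: le_trans (seminorm_sum sN _ _ _) _; rewrite mulr_sumr.
by apply: ler_sum => j _; rewrite sN.2 ler_wpM2r ?seminorm_ge0.
Qed.

Let linB (g h : M_) : lin (g - h) = lin g - lin h.
Proof. by rewrite /lin -sumrB; apply: eq_bigr => j _; rewrite !mxE scalerBl. Qed.

Let Phi_lip (g h : M_) (r : R) : unitary g -> unitary h ->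
  (forall j, cabs (g j 0 - h j 0) <= r) -> `|Phi g - Phi h| <= r * (2 * total ^+ 2).
Proof.
move=> Ug Uh ghr.
have Ng : N (lin g) <= total by rewrite -[total]mul1r lin_le// => j; exact: unitary_cabs.
have Nh : N (lin h) <= total by rewrite -[total]mul1r lin_le// => j; exact: unitary_cabs.
have Ngh : N (lin g - lin h) <= r * total.
  by rewrite -linB lin_le// => j; rewrite !mxE.
have H1 : N (lin g) <= N (lin h) + N (lin g - lin h).
  by rewrite -{1}[lin g](subrKC (lin h)) sN.1.
have H2 : N (lin h) <= N (lin g) + N (lin g - lin h).
  by rewrite -(seminormN sN (lin g - _)) opprB -{1}[lin h](subrKC (lin g)) sN.1.
have := seminorm_ge0 sN (lin g); have := seminorm_ge0 sN (lin h).
have := seminorm_ge0 sN (lin g - lin h).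
rewrite /Phi; set a := N (lin g) in Ng H1 H2 *; set b := N (lin h) in Nh H1 H2 *.
set c := N _ in Ngh H1 H2 * => c0 b0 a0.
rewrite subr_sqr normrM (ger0_norm (addr_ge0 a0 b0)).
have ab : `|a - b| <= r * total by rewrite ler_norml; apply/andP; split; lra.
have -> : r * (2 * total ^+ 2) = (r * total) * (total + total) by ring.
by apply: ler_pM => //; [exact: addr_ge0|exact: lerD].
Qed.

Let Phi_bound (g : M_) : unitary g -> `|Phi g| <= total ^+ 2.
Proof.
move=> Ug; rewrite ger0_norm ?sqr_ge0// /Phi ler_sqr ?nnegrE ?seminorm_ge0//.
by rewrite -[total]mul1r lin_le// => j; exact: unitary_cabs.
Qed.

Let Phi_ap (r : R) : 0 < r ->
  exists (I : finType) (k : I -> M_), (forall i, unitary (k i)) /\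
    forall h, unitary h -> exists i, forall g g', unitary g -> unitary g' ->
      `|Phi (g *m h *m g') - Phi (g *m k i *m g')| <= r.
Proof.
move=> r0; pose L := (n.+1%:R * n.+1%:R) * (2 * total ^+ 2) + 1.
have L0 : 0 < L by rewrite ltr_wpDl// !mulr_ge0// sqr_ge0.
have [I [k [Uk netk]]] := @unitary_net R n.+1 (r / L) (divr_gt0 r0 L0).
exists I, k; split=> // h Uh; have [i hi] := netk _ Uh; exists i => g g' Ug Ug'.
apply: (@le_trans _ _ ((n.+1%:R * n.+1%:R * (r / L)) * (2 * total ^+ 2))); last first.
  by rewrite mulrAC mulrA ler_pdivrMr// [leLHS]mulrC ler_wpM2l// /L ?ltW ?ltrDl.
apply: Phi_lip; try by apply: unitaryM => //; exact: unitaryM.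
move=> j; have -> : (g *m h *m g') j 0 - (g *m k i *m g') j 0 =
    \sum_b \sum_a g j a * (h a b - k i a b) * g' b 0.
  transitivity ((g *m (h - k i) *m g') j 0); first by rewrite mulmxBr mulmxBl !mxE.
  by rewrite !mxE; apply: eq_bigr => b _; rewrite !mxE mulr_suml; apply: eq_bigr => a _; rewrite !mxE.
apply: le_trans (ler_cabs_sum _) _.
apply: (@le_trans _ _ (\sum_(b < n.+1) \sum_(a < n.+1) (r / L))); last first.
  by rewrite !sumr_const !card_ord -[_ *+ n.+1 *+ _]mulr_natl -[(r / L) *+ _]mulr_natl mulrA.
apply: ler_sum => b _; apply: le_trans (ler_cabs_sum _) _; apply: ler_sum => a _.
rewrite !cabsM -[leRHS]mul1r -[leRHS]mulr1.
by rewrite !ler_pM ?mulr_ge0 ?cabs_ge0// unitary_cabs.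
Qed.

Definition signmx (e : cube 'I_n.+1) : M_ := diag_mx (\row_j (-1) ^+ (e j)).

Lemma signmxE e (g : M_) j k : (signmx e *m g) j k = (-1) ^+ (e j) * g j k.
Proof. by rewrite mul_diag_mx !mxE. Qed.

Lemma conjc_sign (b : bool) : conjc ((-1) ^+ b) = (-1) ^+ b :> C.
Proof. by rewrite rmorph_sign. Qed.

Lemma conjc_sign1 (b : bool) : conjc ((-1) ^+ b - 1) = (-1) ^+ b - 1 :> C.
Proof. by rewrite [LHS]rmorphB [X in X - _]rmorph_sign [X in _ - X]rmorph1. Qed.

Lemma unitary_signmx e : unitary (signmx e).
Proof.
apply/matrixP => j k; rewrite signmxE adjE !mxE.
have [->|kj] := eqVneq k j; last by rewrite mulr0n rmorph0 mulr0.
by rewrite mulr1n conjc_sign -signr_addb addbb.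
Qed.

Definition shiftmx (t : 'I_n.+1) : M_ := \matrix_(i, j) (j == i + t)%:R.

Lemma shiftmxE t (g : M_) j k : (shiftmx t *m g) j k = g (j + t) k.
Proof.
rewrite mxE (bigD1 (j + t))//= mxE eqxx mul1r big1 ?addr0// => i /negPf ij.
by rewrite mxE ij mul0r.
Qed.

Lemma unitary_shiftmx t : unitary (shiftmx t).
Proof.
apply/matrixP => j k; rewrite shiftmxE adjE !mxE conjc_nat.
by congr (_%:R); rewrite (inj_eq (addIr t)).
Qed.

Variables (m : nat) (u : 'M[C]_(m, n.+1)).
Hypothesis uu : u *m adj u = 1%:M.

Definition reflmx (e : cube 'I_m) : M_ :=
  1%:M + adj u *m diag_mx (\row_i ((-1) ^+ (e i) - 1)) *m u.

Lemma unitary_reflmx e : unitary (reflmx e).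
Proof.
rewrite /unitary/=; pose d : 'rV[C]_m := \row_i ((-1) ^+ (e i) - 1).
have dd : diag_mx d *m diag_mx d = - (diag_mx d + diag_mx d).
  apply/matrixP => i j; rewrite mul_diag_mx !mxE.
  by case: eqP => [->|_]; case: (e _); rewrite ?mulr1n ?mulr0n ?expr1 ?expr0; ring.
have adjd : adj (diag_mx d) = diag_mx d.
  apply/matrixP => i j; rewrite adjE !mxE eq_sym; case: eqP => [->|_].
    by rewrite !mulr1n conjc_sign1.
  by rewrite !mulr0n rmorph0.
have -> : adj (reflmx e) = reflmx e.
  rewrite /reflmx {1}/adj map_mxD linearD /= -!/(adj _) !adjM adjK adjd mulmxA.
  by congr (_ + _); apply/matrixP => i j; rewrite adjE !mxE conjc_nat eq_sym.
rewrite /reflmx mulmxDl mul1mx mulmxDr mulmx1 -!addrA -[RHS]addr0; congr (1%:M + _).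
set A := adj u *m _ *m u.
have -> : A *m A = adj u *m (diag_mx d *m diag_mx d) *m u.
  by rewrite /A !mulmxA -[_ *m u *m adj u]mulmxA uu mulmx1.
by rewrite dd mulmxN mulNmx mulmxDr mulmxDl -/A addrA subrr.
Qed.

Let x i := \sum_j conjc (u i j) *: y j.

Let lin_reflmx e (g : M_) :
  lin (reflmx e *m g) =
  (lin g - \sum_i (u *m g) i 0 *: x i) + rsum e (fun i => (u *m g) i 0 *: x i).
Proof.
have -> : reflmx e *m g = g + adj u *m (diag_mx (\row_i ((-1) ^+ (e i) - 1)) *m (u *m g)).
  by rewrite /reflmx mulmxDl mul1mx !mulmxA.
set h := _ *m (u *m g); rewrite -addrA; set w := u *m g in h *.
have -> : lin (g + adj u *m h) = lin g + lin (adj u *m h).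
  by rewrite /lin -big_split; apply: eq_bigr => j _; rewrite !mxE scalerDl.
congr (_ + _); rewrite addrC /rsum -sumrB /lin.
transitivity (\sum_i \sum_j ((-1) ^+ e i - 1) *: (w i 0 *: (conjc (u i j) *: y j))).
  rewrite exchange_big; apply: eq_bigr => j _ /=.
  rewrite mxE scaler_suml; apply: eq_bigr => i _.
  by rewrite adjE /h mul_diag_mx !mxE !scalerA; congr (_ *: _); ring.
by apply: eq_bigr => i _; rewrite -!scaler_sumr -/(x i) scalerBl scale1r.
Qed.

(** The average of [Phi] over random sign changes of the coordinates controls
    [a] from above by the type inequality; the one over reflections in the
    directions of the rows of [u] controls it from below, because these rows
    are flat and so, by Khintchine, no coefficient of a randomly signed unit
    vector is small on average. *)
Lemma rotation_type2 (K : R) :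
  (forall i j, cabs (u i j) ^+ 2 = n.+1%:R^-1) ->
  (forall z : 'I_n.+1 -> V,
    avg (fun e : cube 'I_n.+1 => N (rsum e z) ^+ 2) <= K * \sum_j N (z j) ^+ 2) ->
  avg (fun e : cube 'I_m => N (rsum e x) ^+ 2) <= 8 * K * \sum_j N (y j) ^+ 2.
Proof.
move=> uflat typeK; apply/ler_addgt0Pr => eps eps0.
set J := n.+1%:R in uflat; have J0 : 0 < J :> R by [].
set S := \sum_j _; set X := avg _.
pose delta := eps / (16 * J); have d0 : 0 < delta by rewrite divr_gt0// mulr_gt0.
have [I [k [a [[i0 _] [Uk ka]]]]] := @almost_periodic_mean R M_ mulmx (@unitary R n.+1)
  1%:M (@mulmxA _ _ _ _ _) (@unitary1 R n.+1) (@unitaryM R n.+1) (@unitary_div R n.+1) Phi _ Phi_bound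
  Phi_ap delta d0.
have upper : a - delta <= K * S / J.
  apply: (@le_trans _ _ (avg (fun t => avg (fun e => avg (fun i =>
      Phi (signmx e *m shiftmx t *m k i)))))).
    rewrite -(avg_cst (ord0 : 'I_n.+1) (a - delta)); apply: ler_avg => t.
    rewrite -(avg_cst ([ffun=> true] : cube 'I_n.+1) (a - delta)); apply: ler_avg => e.
    have := ka _ (unitaryM (unitary_signmx e) (unitary_shiftmx t)).
    by rewrite ler_norml => /andP[]; lra.
  have -> : avg (fun t => avg (fun e => avg (fun i => Phi (signmx e *m shiftmx t *m k i)))) =
    avg (fun i => avg (fun t => avg (fun e => Phi (signmx e *m shiftmx t *m k i)))).
    rewrite [RHS]avg_exchange; apply: eq_avg => t; exact: avg_exchange.
  rewrite -(avg_cst i0 (K * S / J)); apply: ler_avg => i.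
  apply: (@le_trans _ _ (avg (fun t => K * \sum_j N (k i (j + t) 0 *: y j) ^+ 2))).
    apply: ler_avg => t; apply: le_trans (typeK _); apply: ler_avg => e.
    rewrite /Phi le_eqVlt; apply/orP; left; apply/eqP; congr (N _ ^+ 2).
    by apply: eq_bigr => j _; rewrite -mulmxA signmxE shiftmxE scalerA.
  rewrite avgZ; have -> : avg (fun t => \sum_j N (k i (j + t) 0 *: y j) ^+ 2) = S / J; last by rewrite mulrA.
  rewrite avg_sum /S mulr_suml; apply: eq_bigr => j _.
  under eq_avg do rewrite sN.2 exprMn.
  rewrite avgZr mulrC; congr (_ * _).
  rewrite (avg_reindex (fun l => cabs (k i l 0) ^+ 2) (h := fun t => j + t)).
    by rewrite /avg unitary_col// card_ord mulr1.
  by exists (fun t => t - j) => t; [rewrite addrC addKr|rewrite addrC subrK].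
have lower : X / (8 * J) <= a + delta.
  pose P : finType := (I * cube 'I_n.+1)%type.
  pose g (p : P) : M_ := signmx p.2 *m k p.1.
  pose c (p : P) l := (u *m g p) l 0.
  apply: (@le_trans _ _ (avg (fun e => avg (fun p : P => Phi (reflmx e *m g p))))); last first.
    rewrite -(avg_cst ([ffun=> true] : cube 'I_m) (a + delta)); apply: ler_avg => e.
    rewrite avg_pair avg_exchange -(avg_cst ([ffun=> true] : cube 'I_n.+1) (a + delta)); apply: ler_avg => eta.
    under eq_avg do rewrite /g mulmxA.
    have := ka _ (unitaryM (unitary_reflmx e) (unitary_signmx eta)).
    by rewrite ler_norml => /andP[]; lra.
  pose kap : R := Num.sqrt (2 * J)^-1.
  have kap2 : kap ^+ 2 = (2 * J)^-1 by rewrite sqr_sqrtr// invr_ge0 mulr_ge0.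
  have kap_c l : kap <= avg (fun p => cabs (c p l)).
    rewrite avg_pair -(avg_cst i0 kap); apply: ler_avg => i.
    have := khintchine (fun j => u l j * k i j 0).
    have -> : \sum_j cabs (u l j * k i j 0) ^+ 2 = J^-1.
      under eq_bigr do rewrite cabsM exprMn uflat.
      by rewrite -mulr_sumr unitary_col// mulr1.
    rewrite (@eq_avg _ _ _ (fun e => cabs (c (i, e) l))) => [H|e]; last first.
      by rewrite /c mxE; congr cabs; apply: eq_bigr => j _; rewrite signmxE mulrCA.
    rewrite -(@ler_pXn2r _ 2)// ?nnegrE ?sqrtr_ge0//; last by apply: avg_ge0 => e; exact: cabs_ge0.
    by rewrite kap2 invfM ler_pdivrMl.
  apply: (@le_trans _ _ (avg (fun e => avg (fun p => 4^-1 *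
       N (rsum e (fun l => (cabs (c p l))%:C *: x l)) ^+ 2)))); last first.
    rewrite avg_exchange [leRHS]avg_exchange; apply: ler_avg => p.
    under [leRHS]eq_avg do rewrite /Phi lin_reflmx -/(c p).
    rewrite avgZ ler_pdivrMl//.
    apply: (@le_trans _ _ (4 * avg (fun e => N (rsum e (fun l => c p l *: x l)) ^+ 2))).
      pose q l := if c p l == 0 then 0 else (cabs (c p l))%:C / c p l.
      have q1 l : cabs (q l) <= 1.
        rewrite /q; case: ifPn => [_|c0]; first by rewrite (cabs_real 0) normr0.
        by rewrite cabsM cabsV cabs_real ger0_norm ?cabs_ge0// divff// cabs_eq0.
      apply: le_trans (contraction_complex_sqr (fun l => c p l *: x l) sN q1).
      apply: ler_avg => e; rewrite le_eqVlt; apply/orP; left; apply/eqP; congr (N _ ^+ 2).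
      apply: eq_rsum => l; rewrite scalerA /q; case: ifPn => [/eqP->|c0]; last by rewrite divfK.
      by rewrite mulr0 (cabs_real 0) normr0.
    rewrite ler_pM2l//; pose s (e : cube 'I_m) := rsum e (fun l => c p l *: x l).
    pose r := lin (g p) - \sum_i c p i *: x i.
    change (avg (fun e => N (s e) ^+ 2) <= avg (fun e => N (r + s e) ^+ 2)).
    have sym : avg (fun e => N (r + s e) ^+ 2) = avg (fun e => N (r - s e) ^+ 2).
      rewrite -(avg_addc (neg_cube 'I_m)); apply: eq_avg => e; congr (N (_ + _) ^+ 2).
      rewrite /s rsum_addc -scaleN1r -rsum_scale; apply: eq_rsum => l.
      by rewrite ffunE expr1.
    rewrite -(ler_pM2l (ltr0n _ 2)) -avgZ.
    have -> : 2%:R * avg (fun e => N (r + s e) ^+ 2) =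
        avg (fun e => N (r + s e) ^+ 2 + N (r - s e) ^+ 2) by rewrite avgD -sym; ring.
    apply: ler_avg => e; have := sN.1 (r + s e) (- (r - s e)).
    have -> : r + s e - (r - s e) = (2%:R : R)%:C *: s e.
      by rewrite rmorph_nat scaler_nat mulr2n opprB addrC addrA subrK.
    rewrite (seminormN sN) (seminormZ_real sN) ger0_norm//.
    have := seminorm_ge0 sN (s e).
    by set p1 := N (s e); set p2 := N (r + s e); set p3 := N (r - s e) => p10 H;
      have := sqr_ge0 (p2 - p3); nra.
  under eq_avg do rewrite avgZ.
  rewrite avgZ; pose mu l := avg (fun p => cabs (c p l)).
  apply: (@le_trans _ _ (4^-1 * avg (fun e => N (rsum e (fun l => (mu l)%:C *: x l)) ^+ 2))).
    have := contraction_ge x sN jensen_sqr (sqrtr_ge0 _) kap_c.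
    rewrite (@eq_avg _ _ _ (fun e => kap ^+ 2 * N (rsum e x) ^+ 2)) => [|e]; last first.
      by rewrite seminormZ_real// exprMn real_normK ?num_real.
    rewrite avgZ -/X kap2 => H; apply: (@le_trans _ _ (4^-1 * ((2 * J)^-1 * X))).
      by rewrite le_eqVlt; apply/orP; left; apply/eqP; field; rewrite lt0r_neq0.
    by rewrite ler_pM2l// invr_gt0.
  rewrite ler_pM2l ?invr_gt0//; apply: ler_avg => e.
  apply: le_trans (avg_sqr_le _).
  rewrite ler_sqr ?nnegrE ?(seminorm_ge0 sN)//; last first.
    by apply: avg_ge0 => p; exact: seminorm_ge0.
  have -> : rsum e (fun i => (mu i)%:C *: x i) =
     (#|P|%:R^-1)%:C *: \sum_p rsum e (fun l => (cabs (c p l))%:C *: x l).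
    rewrite exchange_big scaler_sumr; apply: eq_bigr => l _ /=.
    rewrite -scaler_sumr -scaler_suml !scalerA -rmorph_sum/= mulrCA.
    by congr (_ *: _); congr (_ * _); rewrite -[RHS]rmorphM.
  rewrite seminormZ_real// ger0_norm ?invr_ge0//= /avg ler_wpM2l ?invr_ge0//.
  exact: seminorm_sum.
have : X <= (8 * J) * (K * S / J + 2 * delta).
  rewrite mulrC -ler_pdivrMr ?mulr_gt0//; apply: (le_trans lower).
  by rewrite -lerBrDr (_ : _ - delta = K * S / J + delta) 1?addrC -?lerBlDl//; ring.
have -> : 8 * J * (K * S / J + 2 * delta) = 8 * K * S + eps.
  by rewrite /delta; field; rewrite lt0r_neq0.
by [].
Qed.

End Rotation.

Section Rnorm.
Context {R : realType} {X : normedModType R[i]}.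
Notation C := R[i].
Implicit Types x y : X.

Lemma normE x : `|x| = (rnorm x)%:C.
Proof. by rewrite RRe_real// normr_real. Qed.

Lemma rnorm_seminorm : seminorm (@rnorm R X).
Proof.
split=> [x y|a x]; first by rewrite -lecR rmorphD/= -!normE ler_normD.
by apply: complexI; rewrite [RHS]rmorphM/= -normE normrZ normC_cabs normE.
Qed.

Lemma rnorm_ge0 x : 0 <= rnorm x.
Proof. exact: seminorm_ge0 rnorm_seminorm x. Qed.

Lemma rnorm0 : rnorm (0 : X) = 0.
Proof. exact: seminorm0 rnorm_seminorm. Qed.

Lemma rnormN x : rnorm (- x) = rnorm x.
Proof. exact: seminormN rnorm_seminorm x. Qed.

Lemma rnormB x y : rnorm (x - y) = rnorm (y - x).
Proof. by rewrite -rnormN opprB. Qed.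

Lemma rnormD x y : rnorm (x + y) <= rnorm x + rnorm y.
Proof. exact: rnorm_seminorm.1. Qed.

Lemma rnormZ a x : rnorm (a *: x) = cabs a * rnorm x.
Proof. exact: rnorm_seminorm.2. Qed.

Lemma rnorm_eq0 x : rnorm x = 0 -> x = 0.
Proof. by move=> x0; apply/normr0_eq0; rewrite normE x0. Qed.

Lemma rnorm_dist x y : `|rnorm x - rnorm y| <= rnorm (x - y).
Proof.
have := rnormD (x - y) y; have := rnormD (y - x) x; rewrite !subrK (rnormB y).
by rewrite ler_norml; lra.
Qed.

Lemma cvg_rnorm (u : nat -> X) (l : X) :
  u @ \oo --> l <-> (fun n => rnorm (l - u n)) @ \oo --> (0 : R).
Proof.
split=> [/cvgrPdist_lt ul|/cvgrPdist_lt ul].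
  apply/cvgrPdist_lt => e e0; have e0' : 0 < e%:C :> C by rewrite ltcR.
  near=> n; rewrite sub0r normrN ger0_norm ?rnorm_ge0// -ltcR -normE.
  by near: n; apply: ul.
apply/cvgrPdist_lt => e e0.
have eE : e = (complex.Re e)%:C by rewrite RRe_real// gtr0_real.
have e0' : 0 < complex.Re e by rewrite -ltcR -eE.
near=> n; rewrite normE eE ltcR -[rnorm _]ger0_norm ?rnorm_ge0// -normrN -sub0r.
by near: n; apply: ul.
Unshelve. all: by end_near. Qed.

Lemma cvg_rnormP (u : nat -> X) (l : X) : u @ \oo --> l <->
  forall e : R, 0 < e -> \forall n \near \oo, rnorm (l - u n) < e.
Proof.
rewrite cvg_rnorm; split=> [/cvgrPdist_lt ul e e0|ul].
  near=> n; rewrite -[rnorm _]ger0_norm ?rnorm_ge0// -normrN -sub0r.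
  by near: n; apply: ul.
apply/cvgrPdist_lt => e e0; near=> n.
by rewrite sub0r normrN ger0_norm ?rnorm_ge0//; near: n; apply: ul.
Unshelve. all: by end_near. Qed.

Lemma cvg_rnorm_comp (u : nat -> X) (l : X) :
  u @ \oo --> l -> (fun n => rnorm (u n)) @ \oo --> rnorm l.
Proof.
move=> /cvg_rnormP ul; apply/cvgrPdist_lt => e e0; near=> n.
by apply: le_lt_trans (rnorm_dist _ _) _; near: n; exact: ul.
Unshelve. all: by end_near. Qed.

End Rnorm.

Section Simple.
Context {R : realType} d (T : measurableType d).
Notation C := R[i].

(** Functions to any set with finitely many values on measurable pieces; this
    general form lets several simple functions be handled jointly. *)
Definition pwcst (Y : Type) (s : T -> Y) : Prop :=
  finite_set (range s) /\ forall y, measurable (s @^-1` [set y]).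

Lemma pwcst_preimage (Y : Type) (s : T -> Y) (A : set Y) :
  pwcst s -> measurable (s @^-1` A).
Proof.
move=> [fs ms].
have -> : s @^-1` A = \bigcup_(y in range s `&` A) s @^-1` [set y].
  apply/seteqP; split=> [t At|t [y [_ Ay]] /= ->//].
  by exists (s t) => //; split=> //; exists t.
by apply: fin_bigcup_measurable => //; exact: finite_setIl.
Qed.

Lemma pwcst_comp (Y Z : Type) (s : T -> Y) (g : Y -> Z) :
  pwcst s -> pwcst (g \o s).
Proof.
move=> ps; split=> [|z]; last exact: (pwcst_preimage (g @^-1` [set z]) ps).
apply: (sub_finite_set (B := g @` range s)); last exact: finite_image ps.1.
by move=> _ [t _ <-]; exists (s t) => //; exists t.
Qed.

Lemma pwcst_pair (Y Z : Type) (s : T -> Y) (r : T -> Z) :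
  pwcst s -> pwcst r -> pwcst (fun t => (s t, r t)).
Proof.
move=> [fs ms] [fr mr]; split.
  apply: (sub_finite_set (B := range s `*` range r)); last exact: finite_setX.
  by move=> _ [t _ <-]; split=> /=; exists t.
move=> [y z]; have -> : (fun t => (s t, r t)) @^-1` [set (y, z)] =
   s @^-1` [set y] `&` r @^-1` [set z].
  by apply/seteqP; split=> [t /= [-> ->]|t /= [-> ->]].
exact: measurableI.
Qed.

Lemma pwcst_cst (Y : Type) (y : Y) : pwcst (fun _ : T => y).
Proof.
split; first by apply: (sub_finite_set (B := [set y])) => // _ [t _ <-].
move=> z; have [->|yz] := pselect (z = y).
  by rewrite (_ : _ @^-1` _ = setT)//; apply/seteqP.
by rewrite (_ : _ @^-1` _ = set0)//; apply/seteqP; split=> t //= yz'; apply: yz.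
Qed.

Lemma pwcst_if (Y : Type) (A : set T) (s r : T -> Y) : measurable A ->
  pwcst s -> pwcst r -> pwcst (fun t => if t \in A then s t else r t).
Proof.
move=> mA ps pr.
have pA : pwcst (fun t => t \in A).
  split; first exact: finite_finset.
  move=> [].
    by rewrite (_ : _ @^-1` _ = A)//; apply/seteqP; split=> t; [exact: set_mem|exact: mem_set].
  rewrite (_ : _ @^-1` _ = ~` A); first exact: measurableC.
  by apply/seteqP; split=> t /=; [move/negbT; rewrite notin_setE|move=> At; apply/negbTE; rewrite notin_setE].
exact: (pwcst_comp (fun p => if p.1 then p.2.1 else p.2.2) (pwcst_pair pA (pwcst_pair ps pr))).
Qed.

End Simple.

Section StronglyMeasurable.
Context {R : realType} {X : normedModType R[i]} d (T : measurableType d).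
Notation C := R[i].
Implicit Types (f g : T -> X) (s : nat -> T -> X).

Lemma pwcst_rnorm (Y : Type) (s : T -> Y) (g : Y -> R) :
  pwcst s -> measurable_fun setT (g \o s).
Proof.
move=> ps _ B mB; rewrite setTI -[_ @^-1` _]/(s @^-1` (g @^-1` B)).
exact: pwcst_preimage.
Qed.

Lemma simple_pwcst (s : T -> X) : simple_fun s = pwcst s. Proof. by []. Qed.

(** Separability of the range and measurability of the distances to a dense
    sequence: unlike the definition, this is stable under pointwise limits. *)
Definition dense_measurable (e : nat -> X) f : Prop :=
  (forall t (r : R), 0 < r -> exists i, rnorm (f t - e i) < r) /\
  forall i, measurable_fun setT (fun t => rnorm (f t - e i)).

Fixpoint nearest (e : nat -> X) f (n : nat) (t : T) : X :=
  if n is n'.+1 then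
    if t \in [set t | rnorm (f t - e n') < rnorm (f t - nearest e f n' t)]
    then e n' else nearest e f n' t
  else 0.

Lemma nearest_pwcst e f n : dense_measurable e f -> measurable_fun setT (fun t => rnorm (f t)) ->
  pwcst (nearest e f n) /\ measurable_fun setT (fun t => rnorm (f t - nearest e f n t)).
Proof.
move=> [_ me] mf; elim: n => [|n [IH mn]] /=.
  by split; [exact: pwcst_cst|under eq_fun do rewrite subr0].
have mA : measurable [set t | rnorm (f t - e n) < rnorm (f t - nearest e f n t)].
  rewrite -[X in measurable X]setTI; exact: (measurable_fun_ltr (me n) mn).
split; first by apply: pwcst_if => //; exact: pwcst_cst.
rewrite (_ : (fun t => _) = (fun t => Num.min (rnorm (f t - e n)) (rnorm (f t - nearest e f n t)))).
  exact: measurable_minr.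
apply/funext => t; case: ifPn => [|]; rewrite ?inE ?notin_setE /=.
  by move=> /ltW /min_idPl ->.
by move=> /negP; rewrite -leNgt => /min_idPr ->.
Qed.

Lemma nearest_le0 e f n t : rnorm (f t - nearest e f n t) <= rnorm (f t).
Proof.
elim: n => [|n IH] /=; first by rewrite subr0.
by case: ifPn => //; rewrite inE /= => H; apply/(le_trans (ltW H)).
Qed.

Lemma nearest_le e f n i t : (i < n)%N ->
  rnorm (f t - nearest e f n t) <= rnorm (f t - e i).
Proof.
elim: n => // n IH; rewrite ltnS leq_eqVlt => /orP[/eqP ->|ni] /=.
  by case: ifPn => //; rewrite notin_setE /= => /negP; rewrite -leNgt.
case: ifPn => [|_]; last exact: IH.
by rewrite inE /= => /ltW H; exact: le_trans (IH ni).
Qed.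

Lemma nearest_cvg e f t : dense_measurable e f -> nearest e f ^~ t @ \oo --> f t.
Proof.
move=> [de _]; apply/cvg_rnormP => r r0; have [i ir] := de t r r0.
near=> n; apply: le_lt_trans ir; apply: nearest_le.
by near: n; exact: nbhs_infty_gt.
Unshelve. all: by end_near. Qed.

Lemma strongly_measurable_dense f : strongly_measurable f -> exists e, dense_measurable e f.
Proof.
move=> [s [ss sf]].
have : exists e : nat -> X, forall n t, exists i, e i = s n t.
  have /countable_injP[h hinj] : countable (\bigcup_n range (s n)).
    by apply: bigcup_countable => // n _; apply: finite_set_countable; exact: (ss n).1.
  exists (fun i => xget 0 [set x | (\bigcup_n range (s n)) x /\ h x = i]) => n t.
  have st : (\bigcup_n range (s n)) (s n t) by exists n => //; exists t.
  exists (h (s n t)); case: xgetP => [x _ [Ax hx]|/(_ (s n t))[]//].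
  by apply: hinj; rewrite ?inE.
move=> [e es]; exists e; split=> [t r r0|i].
  have /cvg_rnormP/(_ r r0) [n _ /(_ n (leqnn n)) nr] := sf t.
  by have [i ei] := es n t; exists i; rewrite ei.
apply: (measurable_fun_cvg (h := fun n t => rnorm (s n t - e i))).
  by move=> n; apply: (pwcst_rnorm (fun x => rnorm (x - e i)) (ss n)).
move=> t _; apply: (@cvg_rnorm_comp _ _ (fun n => s n t - e i)).
by apply: cvgB; [exact: sf|exact: cvg_cst].
Qed.

Lemma measurable_rnorm f : strongly_measurable f -> measurable_fun setT (fun t => rnorm (f t)).
Proof.
move=> [s [ss sf]]; apply: (measurable_fun_cvg (h := fun n t => rnorm (s n t))).
  by move=> n; exact: (pwcst_rnorm _ (ss n)).
by move=> t _; apply: cvg_rnorm_comp; exact: sf.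
Qed.

Lemma dense_strongly_measurable (e : nat -> X) f :
  (forall t (r : R), 0 < r -> exists i, rnorm (f t - e i) < r) ->
  (forall x, measurable_fun setT (fun t => rnorm (f t - x))) -> strongly_measurable f.
Proof.
move=> de me; have De : dense_measurable e f by [].
have m0 : measurable_fun setT (fun t => rnorm (f t)) by have := me 0; under eq_fun do rewrite subr0.
exists (nearest e f); split=> [n|t]; last exact: nearest_cvg.
by have [] := nearest_pwcst n De m0.
Qed.

(** Simple approximations dominated by the function, as dominated convergence requires. *)
Lemma simple_approx f : strongly_measurable f -> exists s,
  [/\ forall n, simple_fun (s n), forall t, s ^~ t @ \oo --> f t &
      forall n t, rnorm (f t - s n t) <= rnorm (f t)].
Proof.
move=> smf; have [e De] := strongly_measurable_dense smf.
exists (nearest e f); split => [n|t|n t].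
- by have [] := nearest_pwcst n De (measurable_rnorm smf).
- exact: nearest_cvg.
- exact: nearest_le0.
Qed.

Lemma strongly_measurable_simple (s : T -> X) : simple_fun s -> strongly_measurable s.
Proof. by move=> ss; exists (fun=> s); split=> // t; exact: cvg_cst. Qed.

Lemma strongly_measurable_cst (x : X) : strongly_measurable (fun _ : T => x).
Proof. exact/strongly_measurable_simple/pwcst_cst. Qed.

Lemma strongly_measurableD f g :
  strongly_measurable f -> strongly_measurable g -> strongly_measurable (fun t => f t + g t).
Proof.
move=> [s [ss sf]] [r [sr rg]]; exists (fun n t => s n t + r n t); split=> [n|t].
  exact: (pwcst_comp (fun p => p.1 + p.2) (pwcst_pair (ss n) (sr n))).
by apply: cvgD; [exact: sf|exact: rg].
Qed.

Lemma strongly_measurable_sum (I : Type) (r : seq I) (P : pred I) (F : I -> T -> X) :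
  (forall i, strongly_measurable (F i)) ->
  strongly_measurable (fun t => \sum_(i <- r | P i) F i t).
Proof.
move=> mF; elim: r => [|i r IH]; first by under eq_fun do rewrite big_nil; exact: strongly_measurable_cst.
under eq_fun do rewrite big_cons; case: (P i) => //.
exact: strongly_measurableD.
Qed.

Lemma strongly_measurable_comp f d' (T' : measurableType d') (h : T' -> T) :
  measurable_fun setT h -> strongly_measurable f -> strongly_measurable (f \o h).
Proof.
move=> mh [s [ss sf]]; exists (fun n => s n \o h); split=> [n|t]; last exact: sf.
split=> [|x].
  by apply: sub_finite_set (ss n).1 => _ [t _ <-]; exists (h t).
by rewrite comp_preimage -[X in measurable X]setTI; apply: mh => //; exact: (ss n).2.
Qed.

Lemma strongly_measurable_lim (f_ : nat -> T -> X) f :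
  (forall n, strongly_measurable (f_ n)) -> (forall t, f_ ^~ t @ \oo --> f t) ->
  strongly_measurable f.
Proof.
move=> mf ff.
have /boolp.choice[e De] : forall n, exists e, dense_measurable e (f_ n).
  by move=> n; exact: strongly_measurable_dense.
pose E k : X := if @choice.unpickle (nat * nat)%type k is Some p then e p.1 p.2 else 0.
apply: (@dense_strongly_measurable E f) => [t r r0|x].
  have r20 : 0 < r / 2 by rewrite divr_gt0.
  have /cvg_rnormP/(_ _ r20)[n _ /(_ n (leqnn n)) nr] := ff t.
  have [i ir] := (De n).1 t _ r20; exists (choice.pickle (n, i)); rewrite /E choice.pickleK /=.
  have -> : f t - e n i = (f t - f_ n t) + (f_ n t - e n i) by rewrite addrA subrK.
  by apply: le_lt_trans (rnormD _ _) _; lra.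
apply: (measurable_fun_cvg (h := fun n t => rnorm (f_ n t - x))) => [n|t _].
  apply: measurable_rnorm; apply: strongly_measurableD => //.
  exact: strongly_measurable_cst.
apply: (@cvg_rnorm_comp _ _ (fun n => f_ n t - x)).
by apply: cvgB; [exact: ff|exact: cvg_cst].
Qed.

End StronglyMeasurable.

Section ScalarTimes.
Context {R : realType} {X : normedModType R[i]} d (T : measurableType d).

Lemma strongly_measurableZ (c : T -> R[i]^o) (f : T -> X) :
  strongly_measurable c -> strongly_measurable f ->
  strongly_measurable (fun t => c t *: f t).
Proof.
move=> [s [ss sf]] [r [sr rg]]; exists (fun n t => s n t *: r n t); split=> [n|t].
  exact: (pwcst_comp (fun p => p.1 *: p.2) (pwcst_pair (ss n) (sr n))).
by apply: cvgZ; [exact: sf|exact: rg].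
Qed.

Lemma strongly_measurableN (f : T -> X) :
  strongly_measurable f -> strongly_measurable (fun t => - f t).
Proof.
move=> mf; under eq_fun do rewrite -scaleN1r.
by apply: strongly_measurableZ => //; exact: strongly_measurable_cst.
Qed.

Lemma strongly_measurableB (f g : T -> X) :
  strongly_measurable f -> strongly_measurable g -> strongly_measurable (fun t => f t - g t).
Proof. by move=> mf mg; apply: strongly_measurableD => //; exact: strongly_measurableN. Qed.

Lemma strongly_measurable_if (A : set T) (f : T -> X) : measurable A ->
  strongly_measurable f -> strongly_measurable (fun t => if t \in A then f t else 0).
Proof.
move=> mA [s [ss sf]]; exists (fun n t => if t \in A then s n t else 0); split=> [n|t].
  by apply: pwcst_if; [exact: mA|exact: ss|exact: pwcst_cst].
by case: ifPn => _; [exact: sf|exact: cvg_cst].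
Qed.

End ScalarTimes.

Section L2.
Context {R : realType} {X : normedModType R[i]} d (T : measurableType d).
Variable mu : probability T R.
Implicit Types f g : T -> X.

Definition N2 f : R := fine (Lpnorm mu 2 f).
Definition I1 f : \bar R := (\int[mu]_t (rnorm (f t))%:E)%E.
Definition I2 f : \bar R := (\int[mu]_t (rnorm (f t) ^+ 2)%:E)%E.

Lemma I2_ge0 f : (0 <= I2 f)%E.
Proof. by apply: integral_ge0 => t _; rewrite lee_fin sqr_ge0. Qed.

Lemma I1_ge0 f : (0 <= I1 f)%E.
Proof. by apply: integral_ge0 => t _; rewrite lee_fin rnorm_ge0. Qed.

Lemma Lnorm2E (h : T -> R) :
  (Lnorm mu 2%:E (EFin \o h) = (\int[mu]_t (h t ^+ 2)%:E) `^ 2^-1)%E.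
Proof.
rewrite unlock; congr (_ `^ _)%E; apply: eq_integral => t _.
by rewrite [(EFin \o h) t]/= abse_EFin poweR_EFin powR_mulrn// real_normK ?num_real.
Qed.

Lemma Lpnorm_sqr f : (Lpnorm mu 2 f `^ 2 = I2 f)%E.
Proof.
rewrite /Lpnorm poweR_Lnorm//; apply: eq_integral => t _.
by rewrite abse_EFin poweR_EFin ger0_norm ?rnorm_ge0// powR_mulrn ?rnorm_ge0.
Qed.

Lemma N2_ge0 f : 0 <= N2 f.
Proof. by apply/fine_ge0/Lnorm_ge0. Qed.

Lemma in_L2P f : in_Lp mu 2 f <-> strongly_measurable f /\ (I2 f < +oo)%E.
Proof.
split=> -[mf H]; split=> //.
  by rewrite -Lpnorm_sqr poweR_lty.
move: H; rewrite -Lpnorm_sqr; case: (Lpnorm mu 2 f) (Lnorm_ge0 mu 2%:E (fun t => (rnorm (f t))%:E)) => //.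
  by move=> r _ _; rewrite ltry.
by rewrite poweRyr.
Qed.

Lemma in_L2_measurable f : in_Lp mu 2 f -> strongly_measurable f.
Proof. by case. Qed.

Lemma N2_fin f : in_Lp mu 2 f -> Lpnorm mu 2 f = (N2 f)%:E.
Proof. by move=> [_ H]; rewrite fineK// ge0_fin_numE// Lnorm_ge0. Qed.

Lemma N2_sqr f : in_Lp mu 2 f -> I2 f = (N2 f ^+ 2)%:E.
Proof.
by move=> Lf; rewrite -Lpnorm_sqr N2_fin// poweR_EFin powR_mulrn// N2_ge0.
Qed.

Lemma measurable_rnorm_sqr f : strongly_measurable f ->
  measurable_fun setT (fun t => (rnorm (f t) ^+ 2)%:E).
Proof. by move=> mf; apply/measurable_EFinP/measurable_funX/measurable_rnorm. Qed.

Lemma measurable_rnormE f : strongly_measurable f ->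
  measurable_fun setT (fun t => (rnorm (f t))%:E).
Proof. by move=> mf; apply/measurable_EFinP/measurable_rnorm. Qed.

Lemma N2_le (Y : normedModType R[i]) (f : T -> X) (g : T -> Y) (K : R) :
  strongly_measurable f -> strongly_measurable g ->
  0 <= K -> (forall t, rnorm (f t) <= K * rnorm (g t)) ->
  (I2 f <= (K ^+ 2)%:E * \int[mu]_t (rnorm (g t) ^+ 2)%:E)%E.
Proof.
move=> mf mg K0 fg; rewrite -ge0_integralZl_EFin ?sqr_ge0//.
- apply: ge0_le_integral => //.
  + by move=> t _; rewrite lee_fin sqr_ge0.
  + exact: measurable_rnorm_sqr.
  + by apply: measurable_funeM; apply/measurable_EFinP/measurable_funX/measurable_rnorm.
  + move=> t _; rewrite -EFinM lee_fin -exprMn ler_sqr ?nnegrE ?rnorm_ge0//.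
    by rewrite mulr_ge0// rnorm_ge0.
- by move=> t _; rewrite lee_fin sqr_ge0.
- by apply/measurable_EFinP/measurable_funX/measurable_rnorm.
Qed.

Lemma N2D f g : in_Lp mu 2 f -> in_Lp mu 2 g ->
  in_Lp mu 2 (fun t => f t + g t) /\ N2 (fun t => f t + g t) <= N2 f + N2 g.
Proof.
move=> Lf Lg; have mf := Lf.1; have mg := Lg.1.
have mfg := strongly_measurableD mf mg.
have H : (Lpnorm mu 2 (fun t => f t + g t)%R <= Lpnorm mu 2 f + Lpnorm mu 2 g)%E.
  have := @minkowski_EFin _ _ _ mu _ _ 2 (measurable_rnorm mf) (measurable_rnorm mg).
  rewrite ler1n => /(_ isT); apply: le_trans.
  rewrite [leLHS]Lnorm2E Lnorm2E; apply: gt0_ler_poweR; rewrite ?invr_ge0// ?in_itv/=.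
  - by rewrite I2_ge0 leey.
  - by rewrite integral_ge0 ?leey// => t _; rewrite lee_fin sqr_ge0.
  apply: ge0_le_integral => //.
  - by move=> t _; rewrite lee_fin sqr_ge0.
  - exact: measurable_rnorm_sqr.
  - apply/measurable_EFinP/measurable_funX/measurable_funD; exact: measurable_rnorm.
  - move=> t _; rewrite lee_fin ler_sqr ?nnegrE ?addr_ge0 ?rnorm_ge0//.
    exact: rnormD.
have L : in_Lp mu 2 (fun t => f t + g t).
  by split=> //; apply: le_lt_trans H _; apply: lte_add_pinfty; [exact: Lf.2|exact: Lg.2].
by split=> //; rewrite -lee_fin EFinD -!N2_fin.
Qed.

Lemma I1_le_N2 f : in_Lp mu 2 f -> (I1 f <= (N2 f)%:E)%E.
Proof.
move=> Lf; have mf := Lf.1.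
have := @hoelder _ _ _ mu _ (cst 1) 2 2 (measurable_rnorm mf) (measurable_cst _).
have -> : 2^-1 + 2^-1 = 1 :> R by field.
rewrite ltr0n => /(_ isT isT erefl).
rewrite Lnorm1 [X in (_ * X)%E](_ : _ = 1%E); last first.
  by rewrite -(poweR1r (2^-1 : R)) -(@probability_setT _ _ _ mu) -Lnorm_cst1.
rewrite mule1 -N2_fin//; apply: le_trans; rewrite le_eqVlt; apply/orP; left; apply/eqP.
by apply: eq_integral => t _; rewrite /= mulr1 ger0_norm// rnorm_ge0.
Qed.

Lemma in_L2_le f g (K : R) : strongly_measurable f -> in_Lp mu 2 g ->
  0 <= K -> (forall t, rnorm (f t) <= K * rnorm (g t)) ->
  in_Lp mu 2 f /\ N2 f <= K * N2 g.
Proof.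
move=> mf Lg K0 fg; have := N2_le mf Lg.1 K0 fg.
rewrite -/(I2 g) (N2_sqr Lg) -EFinM -exprMn => H.
have Lf : in_Lp mu 2 f by apply/in_L2P; split=> //; apply: le_lt_trans H _; rewrite ltry.
split=> //; move: H; rewrite (N2_sqr Lf) lee_fin ler_sqr ?nnegrE ?N2_ge0//.
by rewrite mulr_ge0// N2_ge0.
Qed.

Lemma in_L2Z (c : T -> R[i]^o) f (K : R) : strongly_measurable c -> in_Lp mu 2 f ->
  0 <= K -> (forall t, cabs (c t) <= K) ->
  in_Lp mu 2 (fun t => c t *: f t) /\ N2 (fun t => c t *: f t) <= K * N2 f.
Proof.
move=> mc Lf K0 cK; apply: in_L2_le => //; first exact: strongly_measurableZ Lf.1.
by move=> t; rewrite rnormZ ler_wpM2r// rnorm_ge0.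
Qed.

Lemma in_L2_bounded f (K : R) : strongly_measurable f -> (forall t, rnorm (f t) <= K) ->
  in_Lp mu 2 f.
Proof.
move=> mf fK; apply/in_L2P; split=> //.
apply: (@le_lt_trans _ _ (\int[mu]_t (K ^+ 2)%:E)%E).
  apply: ge0_le_integral => //.
  - by move=> t _; rewrite lee_fin sqr_ge0.
  - exact: measurable_rnorm_sqr.
  - by move=> t _; rewrite lee_fin ler_sqr ?nnegrE ?rnorm_ge0// (le_trans _ (fK t))// rnorm_ge0.
by rewrite integral_cst// [X in (_ * X)%E]probability_setT mule1 ltry.
Qed.

Lemma in_L2N f : in_Lp mu 2 f -> in_Lp mu 2 (fun t => - f t) /\ N2 (fun t => - f t) = N2 f.
Proof.
move=> Lf; have mf := strongly_measurableN Lf.1.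
have E : I2 (fun t => - f t) = I2 f by apply: eq_integral => t _; rewrite rnormN.
have Lnf : in_Lp mu 2 (fun t => - f t) by apply/in_L2P; rewrite E; split=> //; exact: ((in_L2P f).1 Lf).2.
split=> //; move: E; rewrite !N2_sqr// => -[] /eqP.
by rewrite eqrXn2 ?N2_ge0// => /eqP.
Qed.

Lemma N2B f g : in_Lp mu 2 f -> in_Lp mu 2 g ->
  in_Lp mu 2 (fun t => f t - g t) /\ N2 (fun t => f t - g t) <= N2 f + N2 g.
Proof. by move=> Lf Lg; have [Ln <-] := in_L2N Lg; exact: N2D. Qed.

Lemma in_L2_0 : in_Lp mu 2 (fun=> 0 : X).
Proof. by apply: (@in_L2_bounded _ 0); [exact: strongly_measurable_cst|move=> t; rewrite rnorm0]. Qed.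

Lemma N2_0 : N2 (fun=> 0 : X) = 0.
Proof.
have := N2_sqr in_L2_0; rewrite /I2; under eq_integral do rewrite rnorm0 expr0n.
by rewrite integral0 => -[] /esym /eqP; rewrite sqrf_eq0 => /eqP.
Qed.

Lemma in_L2_sum (I : Type) (r : seq I) (P : pred I) (F : I -> T -> X) :
  (forall i, in_Lp mu 2 (F i)) ->
  in_Lp mu 2 (fun t => \sum_(i <- r | P i) F i t) /\
  N2 (fun t => \sum_(i <- r | P i) F i t) <= \sum_(i <- r | P i) N2 (F i).
Proof.
move=> LF; elim: r => [|i r [IH1 IH2]].
  by under eq_fun do rewrite big_nil; rewrite big_nil N2_0; split=> //; exact: in_L2_0.
under eq_fun do rewrite big_cons; rewrite big_cons; case: ifP => // _.
by have [L H] := N2D (LF i) IH1; split=> //; apply/(le_trans H); rewrite lerD2l.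
Qed.

End L2.

Section L2Dom.
Context {R : realType} {X Y : normedModType R[i]} d (T : measurableType d).
Variable mu : probability T R.

Lemma in_L2_dom (f : T -> X) (g : T -> Y) (K : R) : strongly_measurable f -> in_Lp mu 2 g ->
  0 <= K -> (forall t, rnorm (f t) <= K * rnorm (g t)) ->
  in_Lp mu 2 f /\ N2 mu f <= K * N2 mu g.
Proof.
move=> mf Lg K0 fg; have := N2_le mu mf Lg.1 K0 fg.
rewrite -/(I2 mu g) (N2_sqr Lg) -EFinM -exprMn => H.
have Lf : in_Lp mu 2 f by apply/in_L2P; split=> //; apply: le_lt_trans H _; rewrite ltry.
split=> //; move: H; rewrite (N2_sqr Lf) lee_fin ler_sqr ?nnegrE ?N2_ge0//.
by rewrite mulr_ge0// N2_ge0.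
Qed.

End L2Dom.

Section IntegralTools.
Context {R : realType} d (T : measurableType d).
Variable mu : probability T R.

Lemma dominated_cvg0 (h : nat -> T -> R) (g : T -> R) :
  (forall n, measurable_fun setT (h n)) -> measurable_fun setT g ->
  (forall n t, 0 <= h n t <= g t) -> (\int[mu]_t (g t)%:E < +oo)%E ->
  (forall t, h ^~ t @ \oo --> 0) ->
  (fun n => \int[mu]_t (h n t)%:E)%E @ \oo --> 0%E.
Proof.
move=> mh mg hg ig h0.
have g0 t : 0 <= g t by have /andP[/le_trans h1 /h1] := hg 0%N t.
have [|||||_ _] := @dominated_convergence _ _ _ mu setT measurableT (fun n t => (h n t)%:E) (cst 0%E) (EFin \o g).
- by move=> n; apply/measurable_EFinP.
- exact: measurable_cst.
- by apply/nearW => t _; apply: cvg_EFin; [exact: nearW|exact: h0].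
- apply/integrableP; split; first exact/measurable_EFinP.
  by under eq_integral do rewrite /= ger0_norm//.
- by apply/nearW => t n _; have /andP[? ?] := hg n t; rewrite abse_EFin ger0_norm// lee_fin.
by rewrite integral0.
Qed.

Lemma squeeze_ereal0 (a b : nat -> \bar R) :
  (forall n, 0 <= a n <= b n)%E -> b @ \oo --> 0%E -> a @ \oo --> 0%E.
Proof.
move=> ab b0; apply: (@squeeze_cvge _ _ _ _ (fun=> 0%E) _ b) => //; last exact: cvg_cst.
exact: nearW.
Qed.

End IntegralTools.

Section Bochner.
Context {R : realType} {X : normedModType R[i]} d (T : measurableType d).
Variable mu : probability T R.
Implicit Types (f g : T -> X) (s r : T -> X).

Notation m A := (fine (mu A)).

Definition pwcst_values (Y : choiceType) (q : T -> Y) : seq Y := fset_set (range q).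

Lemma mem_values (Y : choiceType) (q : T -> Y) t : pwcst q -> q t \in pwcst_values q.
Proof. by move=> [fq _]; rewrite in_fset_set// inE; exists t. Qed.

Lemma values_uniq (Y : choiceType) (q : T -> Y) : uniq (pwcst_values q).
Proof. exact: finmap.fset_uniq. Qed.

Lemma measure_partition (Y : choiceType) (q : T -> Y) (A : set T) :
  pwcst q -> measurable A ->
  m A = \sum_(y <- pwcst_values q) m (A `&` q @^-1` [set y]).
Proof.
move=> pq mA; have mAq y : measurable (A `&` q @^-1` [set y]).
  by apply: measurableI => //; exact: pq.2.
rewrite sum_fine => [|y _]; last exact: fin_num_measure.
rewrite -fsbig_finite; last exact: pq.1.
rewrite -measure_fin_bigcup//; last 2 first.
- exact: pq.1.
- by apply/trivIsetP => x y _ _ /eqP xy; apply/seteqP; split=> // t [[_ /= tx] [_ /= ty]]; apply: xy; rewrite -tx.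
congr (fine (mu _)); apply/seteqP; split=> [t At|t [y _ []]//].
by exists (q t) => //; exists t.
Qed.

Lemma simple_integral_comp (Y : choiceType) (q : T -> Y) (phi : Y -> X) : pwcst q ->
  simple_integral mu (phi \o q) =
  \sum_(y <- pwcst_values q) (m (q @^-1` [set y]))%:C *: phi y.
Proof.
move=> pq; have pphi := pwcst_comp phi pq.
rewrite /simple_integral fsbig_finite; last exact: pphi.1.
transitivity (\sum_(x <- pwcst_values (phi \o q)) \sum_(y <- pwcst_values q)
    (if phi y == x then (m (q @^-1` [set y]))%:C *: x else 0)).
  apply: eq_bigr => x _; rewrite (measure_partition pq) ?rmorph_sum ?scaler_suml; last exact: pphi.2.
  apply: eq_bigr => y _; case: eqP => [<-|yx].
    congr ((m _)%:C *: _); apply/seteqP; split=> t /= => [[]//|->//].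
  rewrite (_ : _ `&` _ = set0) ?measure0 ?scale0r//.
  by apply/seteqP; split=> // t [/= tx ty]; apply: yx; rewrite -tx ty.
rewrite exchange_big big_seq [RHS]big_seq; apply: eq_bigr => y yq.
rewrite (bigD1_seq (phi y)) ?values_uniq//=.
  by rewrite eqxx big1 ?addr0// => x /negPf; rewrite eq_sym => ->.
move: yq; rewrite in_fset_set ?inE; last exact: pq.1.
by move=> [t _ <-]; exact: (mem_values t pphi).
Qed.

Lemma simple_integralE s : simple_fun s ->
  simple_integral mu s = \sum_(x <- pwcst_values s) (m (s @^-1` [set x]))%:C *: x.
Proof. by move=> ss; exact: (simple_integral_comp id ss). Qed.

Lemma simple_integral_lin (a : R[i]) s r : simple_fun s -> simple_fun r ->
  simple_integral mu (fun t => a *: s t + r t) =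
  a *: simple_integral mu s + simple_integral mu r.
Proof.
move=> ss sr; have p := pwcst_pair ss sr.
rewrite (simple_integral_comp (fun p => a *: p.1 + p.2) p).
rewrite (simple_integral_comp fst p) (simple_integral_comp snd p).
rewrite scaler_sumr -big_split/=; apply: eq_bigr => y _.
by rewrite scalerDr !scalerA mulrC.
Qed.

Lemma integral_pwcst (Y : choiceType) (q : T -> Y) (g : Y -> R) : pwcst q ->
  (forall y, 0 <= g y) ->
  (\int[mu]_t (g (q t))%:E)%E = (\sum_(y <- pwcst_values q) g y * m (q @^-1` [set y]))%:E.
Proof.
move=> pq g0.
have mg : measurable_fun setT (fun t => (g (q t))%:E).
  by apply/measurable_EFinP; exact: (pwcst_rnorm g pq).
have -> : [set: T] = \big[setU/set0]_(y <- pwcst_values q) q @^-1` [set y].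
  apply/seteqP; split=> // t _; rewrite -bigcup_seq; exists (q t) => //=.
  exact: mem_values.
rewrite ge0_integral_bigsetU//=; last 5 first.
- by move=> y; exact: pq.2.
- exact: values_uniq.
- by apply/trivIsetP => x y _ _ /eqP xy; apply/seteqP; split=> // t [/= tx ty]; apply: xy; rewrite -tx.
- by apply: measurable_funTS.
- by move=> t _; rewrite lee_fin.
rewrite -sumEFin; apply: eq_bigr => y _.
rewrite (eq_integral (cst (g y)%:E)); last by move=> t; rewrite inE /= => ->.
have mq : measurable (q @^-1` [set y]) by exact: pq.2.
by rewrite integral_cst// EFinM fineK//; exact: fin_num_measure.
Qed.

Lemma simple_integral_le s : simple_fun s ->
  ((rnorm (simple_integral mu s))%:E <= I1 mu s)%E.
Proof.
move=> ss; rewrite /I1 (integral_pwcst ss (@rnorm_ge0 _ X)) lee_fin simple_integralE//.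
apply: le_trans (seminorm_sum rnorm_seminorm _ _ _) _.
apply: ler_sum => x _; rewrite (seminormZ_real rnorm_seminorm) ger0_norm ?fine_ge0//.
by rewrite mulrC.
Qed.

Lemma I1_D f g : strongly_measurable f -> strongly_measurable g ->
  (I1 mu (fun t => f t + g t)%R <= I1 mu f + I1 mu g)%E.
Proof.
move=> mf mg; rewrite /I1 -ge0_integralD//; try by move=> t _; rewrite lee_fin rnorm_ge0.
- apply: ge0_le_integral => //; try by move=> t _; rewrite lee_fin rnorm_ge0.
  + by apply/measurable_rnormE/strongly_measurableD.
  + by apply: emeasurable_funD; exact: measurable_rnormE.
  + by move=> t _; rewrite -EFinD lee_fin rnormD.
- exact: measurable_rnormE.
- exact: measurable_rnormE.
Qed.

Lemma I1_opp f : I1 mu (fun t => - f t)%R = I1 mu f.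
Proof. by apply: eq_integral => t _; rewrite rnormN. Qed.

Lemma I1_dist f g (h : T -> X) :
  strongly_measurable f -> strongly_measurable g -> strongly_measurable h ->
  (I1 mu (fun t => g t - h t)%R <= I1 mu (fun t => f t - g t)%R + I1 mu (fun t => f t - h t)%R)%E.
Proof.
move=> mf mg mh.
have := I1_D (strongly_measurableB mg mf) (strongly_measurableB mf mh).
under [X in (X <= _)%E -> _]eq_integral do rewrite addrA subrK.
rewrite (_ : I1 mu (fun t => g t - f t)%R = I1 mu (fun t => f t - g t)%R)//.
by apply: eq_integral => t _; rewrite rnormB.
Qed.

Lemma simple_integralB_le s r : simple_fun s -> simple_fun r ->
  ((rnorm (simple_integral mu s - simple_integral mu r))%:E <= I1 mu (fun t => s t - r t)%R)%E.
Proof.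
move=> ss sr.
have -> : simple_integral mu s - simple_integral mu r = simple_integral mu (fun t => s t - r t).
  rewrite addrC -scaleN1r -simple_integral_lin//; congr simple_integral.
  by apply/funext => t; rewrite scaleN1r addrC.
apply: simple_integral_le.
exact: (pwcst_comp (fun p => p.1 - p.2) (pwcst_pair ss sr)).
Qed.

Lemma rnorm_fin_lim (u : nat -> X) (v : X) : u @ \oo --> v ->
  (fun n => (rnorm (u n))%:E) @ \oo --> (rnorm v)%:E.
Proof. by move=> uv; apply: cvg_EFin; [exact: nearW|exact: cvg_rnorm_comp]. Qed.

Lemma lim_le_ereal (a b : nat -> \bar R) (x y : \bar R) :
  a @ \oo --> x -> b @ \oo --> y -> (forall n, a n <= b n)%E -> (x <= y)%E.
Proof.
move=> ax byy ab; have c1 := cvgP _ ax; have c2 := cvgP _ byy.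
rewrite -(cvg_lim (@ereal_hausdorff R) ax) -(cvg_lim (@ereal_hausdorff R) byy).
by apply: lee_lim => //; exact: nearW.
Qed.

Lemma bochner_le f v : is_bochner_integral mu f v -> ((rnorm v)%:E <= I1 mu f)%E.
Proof.
move=> [mf [s [ss sf sv]]].
have H : (fun n => I1 mu f + I1 mu (fun t => f t - s n t)%R)%E @ \oo --> I1 mu f.
  rewrite -[X in _ --> X]adde0; apply: cvgeD => //; last exact: cvg_cst.
  by rewrite fin_num_adde_defl.
apply: (lim_le_ereal (rnorm_fin_lim sv) H) => n.
apply: le_trans (simple_integral_le (ss n)) _.
have msn := strongly_measurable_simple (ss n).
have := I1_D mf (strongly_measurableN (strongly_measurableB mf msn)).
rewrite I1_opp; apply: le_trans; rewrite le_eqVlt; apply/orP; left; apply/eqP.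
by apply: eq_integral => t _; rewrite opprB addrC subrK.
Qed.

Lemma bochner_lin (a : R[i]) f g v w :
  is_bochner_integral mu f v -> is_bochner_integral mu g w ->
  is_bochner_integral mu (fun t => a *: f t + g t) (a *: v + w).
Proof.
move=> [mf [s [ss sf sv]]] [mg [r [sr rg rw]]].
have mZ (h : T -> X) : strongly_measurable h -> strongly_measurable (fun t => a *: h t).
  by move=> mh; apply: strongly_measurableZ => //; exact: strongly_measurable_cst.
split; first by apply: strongly_measurableD => //; exact: mZ.
exists (fun n t => a *: s n t + r n t); split=> [n||].
- exact: (pwcst_comp (fun p => a *: p.1 + p.2) (pwcst_pair (ss n) (sr n))).
- apply: (squeeze_ereal0 (b := fun n => (cabs a)%:E * I1 mu (fun t => f t - s n t)%R
      + I1 mu (fun t => g t - r n t)%R)%E); last first.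
    rewrite -[X in _ --> X]adde0; apply: cvgeD => //.
    by rewrite -(mule0 (cabs a)%:E); apply: cvgeZl.
  move=> n; rewrite I1_ge0/=.
  have m1 := strongly_measurableB mf (strongly_measurable_simple (ss n)).
  have m2 := strongly_measurableB mg (strongly_measurable_simple (sr n)).
  have := I1_D (mZ _ m1) m2.
  have -> : I1 mu (fun t => a *: (f t - s n t))%R = ((cabs a)%:E * I1 mu (fun t => f t - s n t)%R)%E.
    rewrite -ge0_integralZl_EFin ?cabs_ge0//; last exact: measurable_rnormE.
      by apply: eq_integral => t _; rewrite rnormZ EFinM.
    by move=> t _; rewrite lee_fin rnorm_ge0.
  apply: le_trans; rewrite le_eqVlt; apply/orP; left; apply/eqP.
  by apply: eq_integral => t _; rewrite scalerBr addrACA opprD.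
under eq_fun do rewrite simple_integral_lin//.
by apply: cvgD => //; apply: cvgZ => //; exact: cvg_cst.
Qed.

Lemma bochner_simple s : simple_fun s -> is_bochner_integral mu s (simple_integral mu s).
Proof.
move=> ss; split; first exact: strongly_measurable_simple.
exists (fun=> s); split=> //; last exact: cvg_cst.
under eq_fun do under eq_integral do rewrite subrr rnorm0.
by under eq_fun do rewrite integral0; exact: cvg_cst.
Qed.

Lemma bochner_unique f v w :
  is_bochner_integral mu f v -> is_bochner_integral mu f w -> v = w.
Proof.
move=> fv fw; have := bochner_le (bochner_lin (-1) fv fw).
rewrite /I1; under eq_integral do rewrite scaleN1r addNr rnorm0.
rewrite integral0 lee_fin scaleN1r => H; apply/esym/eqP; rewrite -subr_eq0 addrC.
by apply/eqP/rnorm_eq0/eqP; rewrite eq_le H rnorm_ge0.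
Qed.

Lemma bochner_integralE f v : is_bochner_integral mu f v -> bochner_integral mu f = v.
Proof.
move=> fv; rewrite /bochner_integral; case: xgetP => [w _ fw|/(_ v)//].
exact: bochner_unique fw fv.
Qed.

End Bochner.

Section BochnerComplete.
Context {R : realType} {X : completeNormedModType R[i]} d (T : measurableType d).
Variable mu : probability T R.
Implicit Types (f g : T -> X).

Lemma rnorm_cauchy_cvg (u : nat -> X) :
  (forall e : R, 0 < e -> exists n0, forall n m, (n0 <= n)%N -> (n0 <= m)%N -> rnorm (u n - u m) < e) ->
  cvgn u.
Proof.
move=> uc; apply: cauchy_cvg; apply/cauchyP => e e0.
have eE : e = (complex.Re e)%:C by rewrite RRe_real// gtr0_real.
have e0' : 0 < complex.Re e by rewrite -ltcR -eE.
have [n0 Hn] := uc _ e0'; exists (u n0).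
exists n0 => // n /= n0n; rewrite -ball_normE /ball_ /= normE eE ltcR.
exact: Hn.
Qed.

Lemma bochner_exists f : strongly_measurable f -> (I1 mu f < +oo)%E ->
  is_bochner_integral mu f (bochner_integral mu f).
Proof.
move=> mf If; have [s [ss sf sle]] := simple_approx mf.
have s0 : (fun n => \int[mu]_t (rnorm (f t - s n t))%:E)%E @ \oo --> 0%E.
  apply: (dominated_cvg0 (g := fun t => rnorm (f t))) => //.
  - move=> n; apply: measurable_rnorm; apply: strongly_measurableB => //.
    exact: strongly_measurable_simple.
  - exact: measurable_rnorm.
  - by move=> n t; rewrite rnorm_ge0 sle.
  - by move=> t; apply/cvg_rnorm/sf.
suff /cvg_ex[v sv] : cvgn (fun n => simple_integral mu (s n)).
  by rewrite (@bochner_integralE _ _ _ _ mu f v); split=> //; exists s.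
apply: rnorm_cauchy_cvg => e e0.
have e20 : 0 < e / 2 by rewrite divr_gt0.
have /fine_cvgP[s0f /cvgrPdist_lt/(_ _ e20) s0e] := s0.
have [n0 _ Hn] : \forall n \near \oo, (\int[mu]_t (rnorm (f t - s n t))%:E < (e / 2)%:E)%E.
  near=> n; have : `|0 - fine (\int[mu]_t (rnorm (f t - s n t))%:E)| < e / 2 by near: n.
  rewrite sub0r normrN => /ltr_normlW; rewrite -lte_fin fineK//.
  by near: n.
exists n0 => n k n0n n0k; rewrite -lte_fin.
apply: le_lt_trans (simple_integralB_le mu (ss n) (ss k)) _.
apply: le_lt_trans (I1_dist mu mf _ _) _; try exact: strongly_measurable_simple.
rewrite [e]splitr EFinD; apply: lteD; exact: Hn.
Unshelve. all: by end_near. Qed.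

End BochnerComplete.

Lemma open_lt_lip (R : realType) (X : normedModType R[i]) (h : X -> R) (a : R) :
  (forall x y, `|h x - h y| <= rnorm (x - y)) -> open [set x | a < h x].
Proof.
move=> hlip; rewrite openE => x /= ax; apply/nbhs_ballP.
exists (h x - a)%:C => /=; first by rewrite ltcR subr_gt0.
move=> y; rewrite -ball_normE /ball_ /= normE ltcR => xy.
by have := le_lt_trans (hlip x y) xy; rewrite ltr_norml; lra.
Qed.

Lemma rnorm_cabs (R : realType) (z : R[i]^o) : rnorm z = cabs z.
Proof. by []. Qed.

Section Torus.
Context {R : realType}.
Notation C := R[i].
Notation torus := (polytorus R).

Definition rot (w z : torus) : torus := fun i => circle_mul (w i) (z i).

Lemma circle_cabs (z : circle R) : cabs (sval z) = 1.
Proof. by case: z => z /= /eqP z1; apply: complexI; rewrite -normC_cabs z1. Qed.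

Lemma circle_neq0 (z : circle R) : sval z != 0.
Proof. by rewrite -normr_gt0 normC_cabs circle_cabs ltcR. Qed.

Definition to_circle (z : C) (z1 : cabs z = 1) : circle R.
Proof. by exists z; rewrite normC_cabs z1. Defined.

Lemma to_circleE (z : C) (z1 : cabs z = 1) : sval (to_circle z1) = z.
Proof. by []. Qed.

Lemma measurable_pow_nat_coord d (U : measurableType d) (i : nat) :
  measurable_fun setT (fun w : pow_nat U => w i).
Proof.
move=> _ A mA; rewrite setTI; apply: sub_gen_smallest; exists i => //.
by exists A => //; rewrite setTI.
Qed.

Lemma measurable_fun_pow_nat d d' (T : measurableType d') (U : measurableType d)
    (f : T -> pow_nat U) :
  (forall i, measurable_fun setT (fun t => f t i)) -> measurable_fun setT f.
Proof.
move=> mf; pose G : set (set (pow_nat U)) := \bigcup_(i in [set: nat])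
  preimage_set_system [set: pow_nat U] (fun w => w i) measurable.
apply: (@measurability _ _ _ _ setT f G erefl) => _ [_ [i _ [B mB <-]] <-].
rewrite setTI -comp_preimage setTI -[X in measurable X]setTI.
exact: mf.
Qed.

Lemma measurable_circle_open (U : set C^o) : open U ->
  measurable [set z : circle R | U (sval z)].
Proof. by move=> oU; apply: sub_gen_smallest; exists U. Qed.

Lemma measurable_circle_fun d' (T : measurableType d') (f : T -> circle R) :
  (forall U : set C^o, open U -> measurable (f @^-1` [set z : circle R | U (sval z)])) ->
  measurable_fun setT f.
Proof.
move=> mf; apply: (@measurability _ _ _ _ setT f
  [set [set z : circle R | U (sval z)] | U in @open C^o] erefl) => _ [_ [U oU <-] <-].
by rewrite setTI; exact: mf.
Qed.

Lemma measurable_circle_mul (w : circle R) : measurable_fun setT (circle_mul w).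
Proof.
apply: measurable_circle_fun => U oU.
have oU' : open [set z : C^o | U (sval w * z)].
  by apply: (@open_comp C^o C^o (fun z => sval w * z)) => // z _; exact: mulrl_continuous.
exact: measurable_circle_open oU'.
Qed.

Lemma measurable_rot (w : torus) : measurable_fun setT (rot w).
Proof.
apply: measurable_fun_pow_nat => i.
apply: (measurableT_comp (measurable_circle_mul (w i))).
exact: measurable_pow_nat_coord.
Qed.

Definition coord (i : nat) (z : torus) : C^o := sval (z i).

Lemma strongly_measurable_coord i : strongly_measurable (coord i).
Proof.
pose e k : C^o := if @choice.unpickle (rat * rat)%type k is Some p
  then (ratr p.1 +i* ratr p.2)%C else 0.
apply: (@dense_strongly_measurable _ _ _ _ e) => [z r r0|x].
  have r20 : 0 < r / 2 by rewrite divr_gt0.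
  case: (coord i z) => a b.
  have dense (t : R) : exists q : rat, `|t - ratr q| < r / 2.
    have : t - r / 2 < t + r / 2 by lra.
    by move=> /rat_in_itvoo[q]; rewrite in_itv/= => tq; exists q; rewrite ltr_norml; lra.
  have [[p pa] [q qb]] := (dense a, dense b).
  exists (choice.pickle (p, q)); rewrite /e choice.pickleK /=.
  rewrite [_ - _]complexE; apply: le_lt_trans (rnormD _ _) _.
  rewrite !rnorm_cabs cabsM cabs_i mul1r !cabs_real /=.
  by rewrite [r]splitr ltrD.
have mc : measurable_fun setT (fun c : circle R => rnorm (sval c - x : C^o)).
  apply: (measurability _ (RGenOInfty.measurableE R)) => _ [_ [a ->] <-].
  rewrite setTI (_ : _ @^-1` _ = [set c | [set z : C^o | a < rnorm (z - x)] (sval c)]).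
    apply: measurable_circle_open; apply: open_lt_lip => y z.
    by apply: le_trans (rnorm_dist _ _) _; rewrite opprB addrA subrK.
  by apply/seteqP; split=> c /=; rewrite in_itv/= andbT.
apply: (measurableT_comp mc); exact: measurable_pow_nat_coord.
Qed.

Variable mu : probability torus R.
Hypothesis mu_haar : haar (@circle_mul R) mu.

Lemma haar_rot (w : torus) (A : set torus) : measurable A -> mu (rot w @^-1` A) = mu A.
Proof. by move=> mA; exact: mu_haar. Qed.

Lemma integral_rot (w : torus) (F : torus -> \bar R) :
  measurable_fun setT F -> (forall z, 0 <= F z)%E ->
  (\int[mu]_z F (rot w z) = \int[mu]_z F z)%E.
Proof.
move=> mF F0; have := @ge0_integral_pushforward _ _ _ _ R _ (measurable_rot w) mu setT F measurableT mF.
rewrite preimage_setT => <-; last by move=> z _; exact: F0.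
by apply: eq_measure_integral => [|? A mA _]; [exact: measurable_rot|exact: haar_rot].
Qed.

Definition rot_inv (w : torus) : torus.
Proof.
move=> i; exists (sval (w i))^-1.
by rewrite normfV (eqP (svalP (w i))) invr1.
Defined.

Lemma rotK (w : torus) : cancel (rot (rot_inv w)) (rot w).
Proof.
by move=> z; apply/funext => i; apply: val_inj; rewrite /= mulrA divff ?mul1r// circle_neq0.
Qed.

Section RotX.
Context {X : normedModType C}.
Implicit Types f : torus -> X.

Lemma bochner_rot f (w : torus) v :
  is_bochner_integral mu f v -> is_bochner_integral mu (f \o rot w) v.
Proof.
move=> [mf [s [ss sf sv]]]; split; first exact: strongly_measurable_comp (measurable_rot w) mf.
have mW (A : set torus) : measurable A -> measurable (rot w @^-1` A).
  by move=> mA; rewrite -[X in measurable X]setTI; exact: measurable_rot.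
exists (fun n => s n \o rot w); split=> [n||].
- split=> [|x]; first by apply: sub_finite_set (ss n).1 => _ [t _ <-]; exists (rot w t).
  by rewrite comp_preimage; apply: mW; exact: (ss n).2.
- rewrite (_ : (fun n => _) = (fun n => (\int[mu]_t (rnorm (f t - s n t))%:E)%E))//.
  apply/funext => n; apply: (@integral_rot w (fun t => (rnorm (f t - s n t))%:E)).
    apply/measurable_rnormE/strongly_measurableB => //.
    exact: strongly_measurable_simple.
  by move=> z; rewrite lee_fin rnorm_ge0.
- rewrite (_ : (fun n => _) = (fun n => simple_integral mu (s n)))//.
  apply/funext => n; rewrite /simple_integral.
  have -> : range (s n \o rot w) = range (s n).
    apply/seteqP; split=> [_ [t _ <-]|_ [t _ <-]]; first by exists (rot w t).
    by exists (rot (rot_inv w) t) => //=; rewrite rotK.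
  apply: eq_fsbigr => x _; congr ((fine _)%:C *: _).
  by apply: (haar_rot w); exact: (ss n).2.
Qed.

Lemma I2_rot f (w : torus) : strongly_measurable f -> I2 mu (f \o rot w) = I2 mu f.
Proof.
move=> mf; apply: (@integral_rot w (fun t => (rnorm (f t) ^+ 2)%:E)).
  exact: measurable_rnorm_sqr.
by move=> z; rewrite lee_fin sqr_ge0.
Qed.

Lemma in_L2_rot f (w : torus) : in_Lp mu 2 f ->
  in_Lp mu 2 (f \o rot w) /\ N2 mu (f \o rot w) = N2 mu f.
Proof.
move=> Lf; have mf := strongly_measurable_comp (measurable_rot w) Lf.1.
have E := I2_rot w Lf.1.
have Lw : in_Lp mu 2 (f \o rot w).
  by apply/in_L2P; rewrite E; split=> //; exact: ((in_L2P mu f).1 Lf).2.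
split=> //; move: E; rewrite !N2_sqr// => -[] /eqP.
by rewrite eqrXn2 ?N2_ge0// => /eqP.
Qed.

End RotX.

End Torus.

Section MultiIndex.
Implicit Types a b : multi_index.

Definition mkidx (m : nat) (F : nat -> int) : multi_index :=
  [fsfun i in seq_fset tt (iota 0 m) => F i | 0].

Lemma mkidxE m F i : mkidx m F i = if (i < m)%N then F i else 0.
Proof. by rewrite fsfunE seq_fsetE mem_iota. Qed.

Definition idx_bound a : nat := \max_(i <- finsupp a) i.+1.

Lemma idx_boundP a i : (idx_bound a <= i)%N -> a i = 0.
Proof.
move=> ai; apply/eqP; rewrite -memNfinsupp; apply/negP => ia.
have : (i.+1 <= idx_bound a)%N by exact: leq_bigmax_seq.
by rewrite ltnNge ai.
Qed.

Definition idx0 : multi_index := mkidx 0 (fun=> 0).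
Definition idx_add a b := mkidx (maxn (idx_bound a) (idx_bound b)) (fun i => a i + b i).
Definition idx_opp a := mkidx (idx_bound a) (fun i => - a i).

Lemma idx0E i : idx0 i = 0. Proof. by rewrite mkidxE. Qed.

Lemma idx_addE a b i : idx_add a b i = a i + b i.
Proof.
rewrite mkidxE; case: ltnP => //; rewrite geq_max => /andP[ia ib].
by rewrite !idx_boundP.
Qed.

Lemma idx_oppE a i : idx_opp a i = - a i.
Proof. by rewrite mkidxE; case: ltnP => // ia; rewrite idx_boundP. Qed.

Lemma idxP a b : (forall i, a i = b i) -> a = b.
Proof. by move=> ab; apply/fsfunP. Qed.

Lemma idx_sub_eq0 a b : (idx_add a (idx_opp b) == idx0) = (a == b).
Proof.
apply/eqP/eqP => [ab|->]; apply: idxP => i.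
  by have /eqP := congr1 (fun c : multi_index => c i) ab; rewrite idx_addE idx_oppE idx0E subr_eq0 => /eqP.
by rewrite idx_addE idx_oppE idx0E subrr.
Qed.

End MultiIndex.

Section Monomials.
Context {R : realType}.
Notation C := R[i].
Notation torus := (polytorus R).
Implicit Types (a b : multi_index) (w z : torus).

Lemma monomialE m a z : (forall i, (m <= i)%N -> a i = 0) ->
  monomial a z = \prod_(i < m) sval (z i) ^ a i.
Proof.
move=> am; rewrite /monomial -(big_mkord xpredT (fun i => sval (z i) ^ a i)).
transitivity (\prod_(i <- [seq i <- index_iota 0 m | i \in finsupp a]) sval (z i) ^ a i).
  apply: perm_big; apply: uniq_perm; [exact: finmap.fset_uniq|exact/filter_uniq/iota_uniq|].
  move=> i; rewrite mem_filter mem_index_iota /= andb_idr// mem_finsupp => ai.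
  by rewrite ltnNge; apply: contra ai => /am ->.
rewrite big_filter big_mkcond; apply: eq_bigr => i _.
by case: ifPn => //; rewrite memNfinsupp => /eqP ->.
Qed.

Lemma monomial_add a b z : monomial (idx_add a b) z = monomial a z * monomial b z.
Proof.
pose m := maxn (idx_bound a) (idx_bound b).
have am i : (m <= i)%N -> a i = 0 by rewrite geq_max => /andP[/idx_boundP].
have bm i : (m <= i)%N -> b i = 0 by rewrite geq_max => /andP[_ /idx_boundP].
rewrite (monomialE z am) (monomialE z bm) (@monomialE m) => [|i mi]; last by rewrite idx_addE am ?bm.
rewrite -big_split; apply: eq_bigr => i _ /=.
by rewrite idx_addE expfzDr// circle_neq0.
Qed.

Lemma monomial0 z : monomial idx0 z = 1.
Proof. by rewrite (@monomialE 0) ?big_ord0// => i _; rewrite idx0E. Qed.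

Lemma monomial_opp a z : monomial (idx_opp a) z = (monomial a z)^-1.
Proof.
apply: (@mulrI _ (monomial a z)).
  rewrite unitfE (monomialE z (@idx_boundP a)); apply/prodf_neq0 => i _.
  by apply: expfz_neq0; exact: circle_neq0.
rewrite divff; last first.
  rewrite (monomialE z (@idx_boundP a)); apply/prodf_neq0 => i _.
  by apply: expfz_neq0; exact: circle_neq0.
rewrite -monomial_add -(monomial0 z); congr (monomial _ z).
by apply/eqP; rewrite idx_sub_eq0.
Qed.

Lemma monomial_rot a w z : monomial a (rot w z) = monomial a w * monomial a z.
Proof.
rewrite !(monomialE _ (@idx_boundP a)) -big_split; apply: eq_bigr => i _ /=.
by rewrite /rot/= expfzMl.
Qed.

Lemma cabs_exprz1 (c : C) (k : int) : cabs c = 1 -> cabs (c ^ k) = 1.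
Proof.
move=> c1; case: k => n; first by rewrite -exprnP cabsX c1 expr1n.
by rewrite NegzE -exprnN cabsV cabsX c1 expr1n invr1.
Qed.

Lemma cabs_prod (I : Type) (r : seq I) (F : I -> C) :
  cabs (\prod_(i <- r) F i) = \prod_(i <- r) cabs (F i).
Proof. by elim: r => [|i r IH]; rewrite ?big_nil ?cabs1// !big_cons cabsM IH. Qed.

Lemma monomial_cabs a z : cabs (monomial a z) = 1.
Proof.
by rewrite cabs_prod big1// => i _; apply: cabs_exprz1; exact: circle_cabs.
Qed.

Lemma monomial_neq0 a z : monomial a z != 0.
Proof.
by apply/eqP => m0; have := monomial_cabs a z; rewrite m0 (cabs_real 0) normr0 => /eqP; rewrite eq_sym oner_eq0.
Qed.

Lemma strongly_measurable_inv d (T : measurableType d) (c : T -> C^o) :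
  (forall t, c t != 0) -> strongly_measurable c -> strongly_measurable (fun t => (c t)^-1 : C^o).
Proof.
move=> c0 [s [ss sc]]; exists (fun n t => (s n t)^-1 : C^o); split=> [n|t].
  exact: (pwcst_comp (fun x => x^-1) (ss n)).
by apply: (@cvgV C); [exact: c0|exact: sc].
Qed.

Lemma strongly_measurable_mul d (T : measurableType d) (c e : T -> C^o) :
  strongly_measurable c -> strongly_measurable e -> strongly_measurable (fun t => c t * e t : C^o).
Proof. exact: strongly_measurableZ. Qed.

Lemma strongly_measurable_exp d (T : measurableType d) (c : T -> C^o) n :
  strongly_measurable c -> strongly_measurable (fun t => (c t) ^+ n : C^o).
Proof.
move=> mc; elim: n => [|n IH]; first exact: strongly_measurable_cst.
by under eq_fun do rewrite exprS; exact: strongly_measurable_mul.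
Qed.

Lemma strongly_measurable_prod d (T : measurableType d) (I : Type) (r : seq I)
    (F : I -> T -> C^o) : (forall i, strongly_measurable (F i)) ->
  strongly_measurable (fun t => \prod_(i <- r) F i t : C^o).
Proof.
move=> mF; elim: r => [|i r IH].
  by under eq_fun do rewrite big_nil; exact: strongly_measurable_cst.
have -> : (fun t => \prod_(j <- i :: r) F j t : C^o) = (fun t => F i t * \prod_(j <- r) F j t : C^o).
  by apply/funext => t; rewrite big_cons.
exact: (strongly_measurable_mul (mF i) IH).
Qed.

Lemma strongly_measurable_exprz (k : int) (i : nat) :
  strongly_measurable (fun z : torus => sval (z i) ^ k : C^o).
Proof.
have mi : strongly_measurable (fun z : torus => sval (z i) : C^o) := @strongly_measurable_coord R i.
case: k => n; first exact: (strongly_measurable_exp n mi).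
apply: (strongly_measurable_inv (c := fun z : torus => sval (z i) ^+ n.+1)).
  by move=> z; rewrite expf_neq0// circle_neq0.
exact: (strongly_measurable_exp n.+1 mi).
Qed.

Lemma strongly_measurable_monomial a :
  strongly_measurable (fun z : torus => monomial a z : C^o).
Proof.
apply: (strongly_measurable_prod (finsupp a) (F := fun i z => sval (z i) ^ a i)) => i.
exact: strongly_measurable_exprz.
Qed.

(** Rotations detect the monomials: a rotation of one coordinate by a root
    of [-1] changes the sign of the monomial, which therefore integrates to zero. *)
Lemma monomial_eqN1 a : a != idx0 -> exists w, monomial a w = -1.
Proof.
move=> a0; have [i ai] : exists i, a i != 0.
  apply: contrapT => na; move/eqP: a0; apply; apply: idxP => i; rewrite idx0E.
  by apply/eqP; apply: contrapT => /negP ai; apply: na; exists i.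
have : exists c : C, cabs c = 1 /\ c ^ a i = -1.
  have root1 n : (0 < n)%N -> exists c : C, cabs c = 1 /\ c ^+ n = -1.
    move=> n0; exists (n.-root (-1)); split; last exact: rootCK.
    have : cabs (n.-root (-1) : C) ^+ n = 1 by rewrite -cabsX rootCK// (cabs_sign true).
    move=> /eqP; rewrite -[X in _ == X](expr1n R n) eqrXn2// ?cabs_ge0// => /eqP//.
  move: ai; case: (a i) => n n0.
    have [|c [c1 cn]] := root1 n; first by rewrite lt0n.
    by exists c; split=> //.
  have [c [c1 cn]] := root1 n.+1 isT; exists c; split=> //.
  by rewrite NegzE -exprnN cn invrN invr1.
move=> [c [c1 ca]]; exists (fun j => if j == i then to_circle c1 else circle1 R).
rewrite (monomialE _ (@idx_boundP a)).
have iB : (i < idx_bound a)%N by rewrite ltnNge; apply: contra ai => /idx_boundP ->.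
rewrite (bigD1 (Ordinal iB))//= eqxx ca big1 ?mulr1// => j ji.
by rewrite ifF ?exp1rz//; apply: contraNF ji => /eqP ji; apply/eqP/val_inj.
Qed.

End Monomials.

Section Fourier.
Context {R : realType}.
Notation C := R[i].
Notation torus := (polytorus R).
Variable mu : probability torus R.

Section TrigPoly.
Context {X : normedModType C}.
Implicit Types (f : torus -> X) (a : multi_index) (z : torus) (x : X).

Lemma rnorm_monomial a z x : rnorm (monomial a z *: x) = rnorm x.
Proof. by rewrite rnormZ monomial_cabs mul1r. Qed.

Lemma rnorm_monomialV a z x : rnorm ((monomial a z)^-1 *: x) = rnorm x.
Proof. by rewrite -monomial_opp rnorm_monomial. Qed.

Lemma strongly_measurable_monomialZ a x : strongly_measurable (fun z => monomial a z *: x).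
Proof.
apply: strongly_measurableZ; [exact: strongly_measurable_monomial|exact: strongly_measurable_cst].
Qed.

Lemma in_L2_monomial a x : in_Lp mu 2 (fun z => monomial a z *: x).
Proof.
apply: (@in_L2_bounded _ _ _ _ _ _ (rnorm x)); first exact: strongly_measurable_monomialZ.
by move=> z; rewrite rnorm_monomial.
Qed.

Lemma in_L2_I1 f : in_Lp mu 2 f -> (I1 mu f < +oo)%E.
Proof. by move=> Lf; apply: le_lt_trans (I1_le_N2 Lf) _; rewrite ltry. Qed.

Lemma strongly_measurable_monomialV f a : strongly_measurable f ->
  strongly_measurable (fun z => (monomial a z)^-1 *: f z).
Proof.
move=> mf; under eq_fun do rewrite -monomial_opp.
by apply: strongly_measurableZ => //; exact: strongly_measurable_monomial.
Qed.

Definition tpoly (l : seq (multi_index * X)) z : X := \sum_(p <- l) monomial p.1 z *: p.2.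

Lemma in_L2_tpoly l : in_Lp mu 2 (tpoly l).
Proof. by apply: (in_L2_sum l xpredT _).1 => p; exact: in_L2_monomial. Qed.

Lemma tpoly_cat l1 l2 z : tpoly (l1 ++ l2) z = tpoly l1 z + tpoly l2 z.
Proof. by rewrite /tpoly big_cat. Qed.

End TrigPoly.

Hypothesis mu_haar : haar (@circle_mul R) mu.

Section FourierX.
Context {X : completeNormedModType C}.
Implicit Types (f g : torus -> X) (a b : multi_index) (w z : torus) (x : X).

Lemma fourierP f a : in_Lp mu 2 f ->
  is_bochner_integral mu (fun z => (monomial a z)^-1 *: f z) (fourier_coef mu f a).
Proof.
move=> Lf; apply: bochner_exists; first exact: strongly_measurable_monomialV Lf.1.
rewrite /I1; under eq_integral do rewrite rnorm_monomialV.
exact: in_L2_I1.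
Qed.

Lemma fourier_le f a : in_Lp mu 2 f -> rnorm (fourier_coef mu f a) <= N2 mu f.
Proof.
move=> Lf; rewrite -lee_fin; apply: le_trans (bochner_le (fourierP a Lf)) _.
rewrite /I1; under eq_integral do rewrite rnorm_monomialV.
exact: I1_le_N2.
Qed.

Lemma fourier_lin (c : C) f g a : in_Lp mu 2 f -> in_Lp mu 2 g ->
  fourier_coef mu (fun z => c *: f z + g z) a = c *: fourier_coef mu f a + fourier_coef mu g a.
Proof.
move=> Lf Lg; apply: bochner_integralE.
have := bochner_lin c (fourierP a Lf) (fourierP a Lg).
by under [X in is_bochner_integral _ X _]eq_fun do rewrite scalerA mulrC -scalerA -scalerDr.
Qed.

Lemma fourierD f g a : in_Lp mu 2 f -> in_Lp mu 2 g ->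
  fourier_coef mu (fun z => f z + g z) a = fourier_coef mu f a + fourier_coef mu g a.
Proof.
move=> Lf Lg; have := fourier_lin 1 a Lf Lg; rewrite scale1r => <-.
by congr fourier_coef; apply/funext => z; rewrite scale1r.
Qed.

Lemma fourierB f g a : in_Lp mu 2 f -> in_Lp mu 2 g ->
  fourier_coef mu (fun z => f z - g z) a = fourier_coef mu f a - fourier_coef mu g a.
Proof.
move=> Lf Lg; have := fourier_lin (-1) a Lg Lf; rewrite scaleN1r addrC => <-.
by congr fourier_coef; apply/funext => z; rewrite scaleN1r addrC.
Qed.

Lemma bochner_cst x : is_bochner_integral mu (fun=> x) x.
Proof.
have := bochner_simple mu (pwcst_cst torus x); congr is_bochner_integral.
rewrite /simple_integral (_ : range _ = [set x]) ?fsbig_set1.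
  rewrite (_ : _ @^-1` _ = setT) ?probability_setT ?scale1r//.
  by apply/seteqP; split.
by apply/seteqP; split=> [_ [t _ <-]//|_ ->]; exists point.
Qed.

Lemma fourier_rot f w a : in_Lp mu 2 f ->
  fourier_coef mu (f \o rot w) a = monomial a w *: fourier_coef mu f a.
Proof.
move=> Lf; apply: bochner_integralE.
have L0 := bochner_cst 0.
have := bochner_lin (monomial a w) (bochner_rot mu_haar w (fourierP a Lf)) L0.
rewrite addr0; under [X in is_bochner_integral _ X _]eq_fun do
  rewrite /= addr0 monomial_rot invfM scalerA mulrA divff ?monomial_neq0// mul1r.
by [].
Qed.

Lemma bochner_monomial a x :
  is_bochner_integral mu (fun z => monomial a z *: x) (if a == idx0 then x else 0).
Proof.
have L := in_L2_monomial a x.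
have [v bv] : exists v, is_bochner_integral mu (fun z => monomial a z *: x) v.
  by exists (bochner_integral mu (fun z => monomial a z *: x)); apply: bochner_exists L.1 (in_L2_I1 L).
case: eqVneq => [->|a0].
  under [X in is_bochner_integral _ X _]eq_fun do rewrite monomial0 scale1r.
  exact: bochner_cst.
have [w aw] := @monomial_eqN1 R _ a0.
have := bochner_lin (1 : C) bv (bochner_rot mu_haar w bv).
under [X in is_bochner_integral _ X _]eq_fun do
  rewrite /= monomial_rot aw mulN1r scale1r scaleNr subrr.
move=> /bochner_unique/(_ (bochner_cst 0)); rewrite scale1r -mulr2n => v0.
suff v00 : v = 0 by rewrite v00 in bv.
have := congr1 (fun x => 2^-1 *: x) v0.
by rewrite /= scaler0 -[v *+ 2]scaler_nat scalerA mulVf ?scale1r// pnatr_eq0.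
Qed.

Lemma fourier_monomial a b x :
  fourier_coef mu (fun z => monomial b z *: x) a = if b == a then x else 0.
Proof.
rewrite -idx_sub_eq0; apply: bochner_integralE.
have := bochner_monomial (idx_add b (idx_opp a)) x.
by under [X in is_bochner_integral _ X _]eq_fun do rewrite monomial_add monomial_opp mulrC -scalerA.
Qed.

Lemma fourier_tpoly (l : seq (multi_index * X)) a : fourier_coef mu (tpoly l) a = \sum_(p <- l | p.1 == a) p.2.
Proof.
elim: l => [|p l IH].
  rewrite big_nil -[RHS](_ : (if idx0 == a then 0 : X else 0) = 0); last by case: ifP.
  rewrite -fourier_monomial; congr fourier_coef; apply/funext => z.
  by rewrite /tpoly big_nil scaler0.
have -> : tpoly (p :: l) = fun z => monomial p.1 z *: p.2 + tpoly l z.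
  by apply/funext => z; rewrite /tpoly big_cons.
rewrite fourierD; [|exact: in_L2_monomial|exact: in_L2_tpoly].
by rewrite IH fourier_monomial big_cons; case: eqP => // _; rewrite add0r.
Qed.

Lemma tpoly_fourier (l : seq (multi_index * X)) (s : seq multi_index) z : uniq s -> {subset map fst l <= s} ->
  tpoly l z = \sum_(a <- s) monomial a z *: fourier_coef mu (tpoly l) a.
Proof.
move=> us ls; under eq_bigr do rewrite fourier_tpoly scaler_sumr big_mkcond.
rewrite exchange_big /tpoly big_seq [RHS]big_seq; apply: eq_bigr => p pl /=.
have ps : p.1 \in s by apply: ls; exact: map_f.
rewrite (bigD1_seq p.1)//= eqxx big1 ?addr0// => a /negPf.
by rewrite eq_sym => ->.
Qed.

End FourierX.
End Fourier.

Section SignIteration.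
Context {R : realType}.

(** Newton's iteration for the sign: the cubic [(3 x - x ^+ 3) / 2] has attracting
    fixed points at [1] and [-1]. *)
Fixpoint sgn_iter (k : nat) (x : R) : R :=
  if k is k'.+1 then (3 * sgn_iter k' x - sgn_iter k' x ^+ 3) / 2 else x.

Lemma sgn_iterN k x : sgn_iter k (- x) = - sgn_iter k x.
Proof. by elim: k => //= k ->; field. Qed.

Lemma sgn_iter0 k : sgn_iter k 0 = 0.
Proof. by elim: k => //= k ->; rewrite mulr0 expr0n subr0 mul0r. Qed.

Lemma sgn_iter_pos k x : 0 < x <= 1 -> x <= sgn_iter k x <= 1 /\ 1 - sgn_iter k x <= (1 - x / 2) ^+ k.
Proof.
move=> /andP[x0 x1]; elim: k => [|k [/andP[IH1 IH2] IH3]] /=; first by rewrite expr0 lexx x1; split => //; lra.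
set u := sgn_iter k x in IH1 IH2 IH3 *.
have uE : (3 * u - u ^+ 3) / 2 = 1 - (1 - u) ^+ 2 * (2 + u) / 2 by field.
have u0 : 0 < u by lra.
have v0 : 0 <= 1 - u by lra.
rewrite uE [(1 - x / 2) ^+ k.+1]exprS; split.
  apply/andP; split; last first.
    have : 0 <= (1 - u) ^+ 2 * (2 + u) by rewrite mulr_ge0 ?sqr_ge0//; lra.
    by lra.
  have : (1 - u) * ((1 - u) * (2 + u)) <= (1 - u) * 2 by apply: ler_wpM2l => //; nra.
  by rewrite mulrA -expr2; lra.
have -> : 1 - (1 - (1 - u) ^+ 2 * (2 + u) / 2) = ((1 - u) * (2 + u) / 2) * (1 - u) by field.
apply: ler_pM => //; first by rewrite divr_ge0// mulr_ge0//; lra.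
by nra.
Qed.

Lemma sgn_iter_bound k x : `|x| <= 1 -> `|sgn_iter k x| <= 1.
Proof.
rewrite !ler_norml => /andP[x1 x2].
have [x0|x0|->] := ltgtP x 0; last first.
- by rewrite sgn_iter0 lerN10 ler01.
- by have [|/andP[? ?] _] := @sgn_iter_pos k x; [rewrite x0|]; lra.
- have := @sgn_iter_pos k (- x); rewrite sgn_iterN => -[|/andP[? ?] _]; lra.
Qed.

Lemma sgn_iter_cvg x : `|x| <= 1 ->
  (fun k => (sgn_iter k x + sgn_iter k x ^+ 2) / 2) @ \oo --> (if 0 < x then 1 else 0 : R).
Proof.
move=> x1.
have H y : 0 < y <= 1 -> (fun k => sgn_iter k y) @ \oo --> (1 : R).
  move=> y01; have y2 : `|1 - y / 2| < 1 by rewrite ltr_norml; lra.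
  have := cvg_expr y2; move=> /cvgrPdist_lt c; apply/cvgrPdist_lt => e e0.
  near=> k; have [/andP[a1 a2] a3] := sgn_iter_pos k y01.
  rewrite ger0_norm ?subr_ge0//; apply: le_lt_trans a3 _.
  apply: le_lt_trans (ler_norm _) _; rewrite -normrN -sub0r.
  by near: k; exact: c.
have [x0|x0|->] := ltgtP x 0.
- have /H c : 0 < - x <= 1 by move: x1; rewrite ler_norml; lra.
  have -> : (0 : R) = (- 1 + (- 1) ^+ 2) / 2 by rewrite sqrrN expr1n addNr mul0r.
  have c' : (fun k => sgn_iter k x) @ \oo --> (-1 : R).
    rewrite (_ : (fun k => _) = (fun k => - sgn_iter k (- x))).
      exact: cvgN.
    by apply/funext => k; rewrite sgn_iterN opprK.
  by apply: cvgMl; apply: cvgD => //; under eq_fun do rewrite expr2; rewrite expr2; exact: cvgM.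
- have /H c : 0 < x <= 1 by move: x1; rewrite ler_norml; lra.
  have E : (1 : R) = (1 + 1 ^+ 2) / 2 by field.
  rewrite [X in _ --> X]E.
  by apply: cvgMl; apply: cvgD => //; under eq_fun do rewrite expr2; rewrite expr2; exact: cvgM.
- rewrite (_ : (fun k => _) = fun=> 0); first exact: cvg_cst.
  by apply/funext => k; rewrite sgn_iter0 expr0n addr0 mul0r.
Unshelve. all: by end_near. Qed.

End SignIteration.

Section Approx.
Context {R : realType}.
Notation C := R[i].
Notation torus := (polytorus R).
Variable mu : probability torus R.

Section ApproxX.
Context {X : normedModType C}.
Implicit Types (f g : torus -> X).

Definition approximable f : Prop := in_Lp mu 2 f /\
  forall e : R, 0 < e -> exists l, N2 mu (fun z => f z - tpoly l z) <= e.

Lemma N2_tri f g h : in_Lp mu 2 f -> in_Lp mu 2 g -> in_Lp mu 2 h ->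
  N2 mu (fun z => f z - h z) <= N2 mu (fun z => f z - g z) + N2 mu (fun z => g z - h z).
Proof.
move=> Lf Lg Lh; have := (N2D (N2B Lf Lg).1 (N2B Lg Lh).1).2.
by under [X in N2 _ X <= _ -> _]eq_fun do rewrite addrA subrK.
Qed.

Lemma approximable_lim f : in_Lp mu 2 f ->
  (forall e : R, 0 < e -> exists g, approximable g /\ N2 mu (fun z => f z - g z) <= e) ->
  approximable f.
Proof.
move=> Lf fg; split=> // e e0; have e2 : 0 < e / 2 by rewrite divr_gt0.
have [g [[Lg gl] H]] := fg _ e2; have [l Hl] := gl _ e2; exists l.
apply: le_trans (N2_tri Lf Lg (in_L2_tpoly mu l)) _.
by rewrite [e]splitr lerD.
Qed.

Lemma approximable_tpoly l : approximable (tpoly l).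
Proof.
split; first exact: in_L2_tpoly.
move=> e e0; exists l; under eq_fun do rewrite subrr.
by rewrite N2_0 ltW.
Qed.

Lemma approximableD f g : approximable f -> approximable g -> approximable (fun z => f z + g z).
Proof.
move=> [Lf fl] [Lg gl]; split; first exact: (N2D Lf Lg).1.
move=> e e0; have e2 : 0 < e / 2 by rewrite divr_gt0.
have [l Hl] := fl _ e2; have [k Hk] := gl _ e2; exists (l ++ k).
under eq_fun do rewrite tpoly_cat opprD addrACA.
apply: le_trans (N2D (N2B Lf (in_L2_tpoly mu l)).1 (N2B Lg (in_L2_tpoly mu k)).1).2 _.
by rewrite [e]splitr lerD.
Qed.

Lemma N2_dominated (Y : normedModType C) (fn : nat -> torus -> X) f (g : torus -> Y) :
  (forall n, strongly_measurable (fn n)) -> in_Lp mu 2 f -> in_Lp mu 2 g ->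
  (forall n z, rnorm (f z - fn n z) <= rnorm (g z)) ->
  (forall z, fn ^~ z @ \oo --> f z) ->
  forall e : R, 0 < e -> exists n, in_Lp mu 2 (fn n) /\ N2 mu (fun z => f z - fn n z) <= e.
Proof.
move=> mfn Lf Lg fg fc e e0.
have md n : strongly_measurable (fun z => f z - fn n z) by exact: strongly_measurableB Lf.1 (mfn n).
have Ig := ((in_L2P mu g).1 Lg).2.
have c : (fun n => \int[mu]_z (rnorm (f z - fn n z) ^+ 2)%:E)%E @ \oo --> 0%E.
  apply: (dominated_cvg0 (g := fun z => rnorm (g z) ^+ 2)) => //.
  - by move=> n; apply: measurable_funX; exact: measurable_rnorm.
  - by apply: measurable_funX; exact: measurable_rnorm Lg.1.
  - by move=> n z; rewrite sqr_ge0 ler_sqr ?nnegrE ?rnorm_ge0 ?fg.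
  - move=> z; have /cvg_rnorm H := fc z; rewrite -(mulr0 0); under eq_fun do rewrite expr2.
    exact: cvgM.
have e20 : 0 < e ^+ 2 by rewrite exprn_gt0.
have /fine_cvgP[cf /cvgrPdist_lt/(_ _ e20) [n0 _ Hn]] := c.
have [n1 _ Hn1] := cf; pose n := maxn n0 n1; exists n.
have := Hn n (leq_maxl _ _); have := Hn1 n (leq_maxr _ _) => /= fin.
rewrite sub0r normrN => /ltr_normlW; rewrite -/(I2 mu (fun z => f z - fn n z)) => H.
have Ld : in_Lp mu 2 (fun z => f z - fn n z).
  by apply/in_L2P; split=> //; rewrite -ge0_fin_numE// I2_ge0.
split; last by move: H; rewrite N2_sqr//= ltr_sqr ?nnegrE ?N2_ge0 ?(ltW e0)// => /ltW.
have -> : fn n = fun z => f z - (f z - fn n z) by apply/funext => z; rewrite subKr.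
exact: (N2B Lf Ld).1.
Qed.

End ApproxX.

Lemma tpoly_bounded (X : normedModType C) (l : seq (multi_index * X)) :
  exists2 K : R, 0 <= K & forall z, rnorm (tpoly l z) <= K.
Proof.
exists (\sum_(p <- l) rnorm p.2); first by apply: sumr_ge0 => p _; exact: rnorm_ge0.
move=> z; apply: le_trans (seminorm_sum rnorm_seminorm _ _ _) _.
by apply: ler_sum => p _; rewrite rnorm_monomial.
Qed.

Definition tmul (X : normedModType C) (k : seq (multi_index * C^o))
    (l : seq (multi_index * X)) : seq (multi_index * X) :=
  [seq (idx_add p.1 q.1, p.2 *: q.2) | p <- k, q <- l].

Lemma tmulE (X : normedModType C) k (l : seq (multi_index * X)) z :
  tpoly (tmul k l) z = tpoly k z *: tpoly l z.
Proof.
rewrite /tpoly /tmul big_allpairs_dep scaler_suml; apply: eq_bigr => p _.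
rewrite scaler_sumr; apply: eq_bigr => q _ /=.
by rewrite monomial_add !scalerA; congr (_ *: _); exact: mulrAC.
Qed.

(** Once a trigonometric polynomial close to [g] is chosen, it is bounded, and
    [f] can be approximated well enough for the product. *)
Lemma approximableM (X : normedModType C) (g : torus -> C^o) (f : torus -> X) (K : R) :
  approximable g -> approximable f -> (forall z, rnorm (f z) <= K) ->
  approximable (fun z => g z *: f z).
Proof.
move=> [Lg ga] [Lf fa] fK; have K0 : 0 <= K by apply: le_trans (fK point); exact: rnorm_ge0.
have mgf : strongly_measurable (fun z => g z *: f z) := strongly_measurableZ Lg.1 Lf.1.
have Lgf : in_Lp mu 2 (fun z => g z *: f z).
  apply: (in_L2_dom mgf Lg K0 _).1 => z; rewrite rnormZ -rnorm_cabs mulrC.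
  by rewrite ler_wpM2r// rnorm_ge0.
split=> // e e0; pose d := e / (2 * (K + 1)).
have d0 : 0 < d by rewrite divr_gt0// mulr_gt0// ltr_wpDl.
have [k Hk] := ga _ d0; have [B B0 kB] := tpoly_bounded k.
pose d' := e / (2 * (B + 1)).
have d'0 : 0 < d' by rewrite divr_gt0// mulr_gt0// ltr_wpDl.
have [l Hl] := fa _ d'0; exists (tmul k l).
have Lk := in_L2_tpoly mu k; have Ll := in_L2_tpoly mu l.
have Lgk := (N2B Lg Lk).1; have Lfl := (N2B Lf Ll).1.
have m1 : strongly_measurable (fun z => (g z - tpoly k z) *: f z) := strongly_measurableZ Lgk.1 Lf.1.
have m2 : strongly_measurable (fun z => tpoly k z *: (f z - tpoly l z)) := strongly_measurableZ Lk.1 Lfl.1.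
have [L1 H1] : in_Lp mu 2 (fun z => (g z - tpoly k z) *: f z) /\
    N2 mu (fun z => (g z - tpoly k z) *: f z) <= K * N2 mu (fun z => g z - tpoly k z).
  apply: in_L2_dom => // z; rewrite rnormZ -rnorm_cabs mulrC.
  by rewrite ler_wpM2r// rnorm_ge0.
have [L2 H2] : in_Lp mu 2 (fun z => tpoly k z *: (f z - tpoly l z)) /\
    N2 mu (fun z => tpoly k z *: (f z - tpoly l z)) <= B * N2 mu (fun z => f z - tpoly l z).
  apply: in_L2_dom => // z; rewrite rnormZ -rnorm_cabs.
  by rewrite ler_wpM2r// rnorm_ge0.
have -> : (fun z => g z *: f z - tpoly (tmul k l) z) =
    (fun z => (g z - tpoly k z) *: f z + tpoly k z *: (f z - tpoly l z)).
  by apply/funext => z; rewrite tmulE scalerBl scalerBr addrA subrK.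
apply: le_trans (N2D L1 L2).2 _.
have : K * N2 mu (fun z => g z - tpoly k z) <= e / 2.
  apply: (@le_trans _ _ (K * d)); first by rewrite ler_wpM2l.
  by rewrite /d invfM !mulrA ler_pdivrMr ?ltr_wpDl//; nra.
have : B * N2 mu (fun z => f z - tpoly l z) <= e / 2.
  apply: (@le_trans _ _ (B * d')); first by rewrite ler_wpM2l.
  by rewrite /d' invfM !mulrA ler_pdivrMr ?ltr_wpDl//; nra.
lra.
Qed.

(** ** Approximable sets *)

Definition ind (A : set torus) (z : torus) : C^o := if z \in A then 1 else 0.

Lemma rnorm_ind A z : rnorm (ind A z) <= 1.
Proof. by rewrite /ind rnorm_cabs; case: ifP => _; rewrite ?cabs1// (cabs_real 0) normr0. Qed.

Lemma in_L2_ind A : measurable A -> in_Lp mu 2 (ind A).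
Proof.
move=> mA; apply: (@in_L2_bounded _ _ _ _ _ _ 1); last exact: rnorm_ind.
apply: strongly_measurable_simple; apply: pwcst_if => //; exact: pwcst_cst.
Qed.

Definition approx_set : set (set torus) := [set A | measurable A /\ approximable (ind A)].

Lemma approximable_cst (X : normedModType C) (x : X) : approximable (fun=> x).
Proof.
have := approximable_tpoly [:: (idx0, x)]; congr approximable.
by apply/funext => z; rewrite /tpoly big_seq1 monomial0 scale1r.
Qed.

Lemma approximableZ (X : normedModType C) (c : C) (f : torus -> X) (K : R) :
  approximable f -> (forall z, rnorm (f z) <= K) -> approximable (fun z => c *: f z).
Proof. move=> fa; exact: (approximableM (approximable_cst (c : C^o)) fa). Qed.

Lemma approx_setC A : approx_set A -> approx_set (~` A).
Proof.
move=> [mA aA]; split; first exact: measurableC.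
have -> : ind (~` A) = fun z => (1 : C^o) + (-1) *: ind A z.
  apply/funext => z; rewrite /ind; case: ifPn => zA.
    by rewrite ifF ?scaler0 ?addr0//; apply/negbTE; rewrite notin_setE; exact: set_mem zA.
  have -> : z \in A.
    by apply: mem_set; apply: contrapT => nAz; move/negP: zA; apply; exact: mem_set.
  by rewrite scaleN1r subrr.
by apply: approximableD; [exact: approximable_cst|exact: approximableZ (rnorm_ind A)].
Qed.

Lemma approx_setI A B : approx_set A -> approx_set B -> approx_set (A `&` B).
Proof.
move=> [mA aA] [mB aB]; split; first exact: measurableI.
have -> : ind (A `&` B) = fun z => ind A z *: ind B z.
  by apply/funext => z; rewrite /ind in_setI; case: (z \in A); case: (z \in B); rewrite ?scale1r ?scale0r.
exact: approximableM (rnorm_ind B).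
Qed.

Lemma approx_setU A B : approx_set A -> approx_set B -> approx_set (A `|` B).
Proof.
by move=> aA aB; rewrite -[_ `|` _]setCK setCU; apply/approx_setC/approx_setI; exact: approx_setC.
Qed.

Lemma approx_set0 : approx_set set0.
Proof.
split=> //; have := approximable_cst (0 : C^o); congr approximable.
by apply/funext => z; rewrite /ind in_set0.
Qed.

Lemma approx_set_lim (fn : nat -> torus -> C^o) A : measurable A ->
  (forall n, approximable (fn n)) -> (forall n z, rnorm (fn n z) <= 1) ->
  (forall z, fn ^~ z @ \oo --> ind A z) -> approx_set A.
Proof.
move=> mA fa f1 fA; split=> //; apply: approximable_lim; first exact: in_L2_ind.
move=> e e0; have mf n : strongly_measurable (fn n) by have [[]] := fa n.
have dom n z : rnorm (ind A z - fn n z) <= rnorm (2 : C^o).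
  apply: le_trans (rnormD _ _) _; rewrite rnormN.
  have -> : rnorm (2 : C^o) = 2 by rewrite rnorm_cabs -(rmorph_nat (real_complex R)) cabs_real normr_nat.
  by have := rnorm_ind A z; have := f1 n z; lra.
have [n [_ Hn]] := N2_dominated mf (in_L2_ind mA) (approximable_cst (2 : C^o)).1 dom fA e0.
by exists (fn n).
Qed.

Lemma approx_bigcup (F : nat -> set torus) : (forall n, approx_set (F n)) ->
  approx_set (\bigcup_n F n).
Proof.
move=> aF; have aU n : approx_set (\big[setU/set0]_(i < n) F i).
  by elim/big_ind: _ => //; [exact: approx_set0|exact: approx_setU].
apply: (@approx_set_lim (fun n => ind (\big[setU/set0]_(i < n) F i))).
- by apply: bigcup_measurable => n _; have [] := aF n.
- by move=> n; have [] := aU n.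
- by move=> n z; exact: rnorm_ind.
move=> z; have [[k _ Fk]|nF] := pselect ((\bigcup_n F n) z).
  apply: cvg_near_cst; near=> n; rewrite /ind !ifT//; apply/mem_set; first by exists k.
  by rewrite -bigcup_mkord; exists k => //=; near: n; exact: nbhs_infty_gt.
apply: cvg_near_cst; apply: nearW => n; rewrite /ind !ifF//; apply/negbTE; rewrite notin_setE//.
by rewrite -bigcup_mkord => -[k _ Fk]; apply: nF; exists k.
Unshelve. all: by end_near. Qed.

Lemma approx_sigma_algebra : sigma_algebra setT approx_set.
Proof.
split; [exact: approx_set0| |exact: approx_bigcup].
by move=> A aA; rewrite setTD; exact: approx_setC.
Qed.

End Approx.

Section RealComplex.
Context {R : realType}.
Implicit Types a b : R.

Lemma realCB a b : (a - b)%:C = a%:C - b%:C. Proof. exact: rmorphB. Qed.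
Lemma realCD a b : (a + b)%:C = a%:C + b%:C. Proof. exact: rmorphD. Qed.
Lemma realCM a b : (a * b)%:C = a%:C * b%:C. Proof. exact: rmorphM. Qed.
Lemma realCV a : (a^-1)%:C = (a%:C)^-1. Proof. exact: fmorphV. Qed.
Lemma realCX a n : (a ^+ n)%:C = a%:C ^+ n. Proof. exact: rmorphXn. Qed.
Lemma realC_nat n : (n%:R : R)%:C = n%:R. Proof. exact: rmorph_nat. Qed.

End RealComplex.

Section Density.
Context {R : realType}.
Notation C := R[i].
Notation torus := (polytorus R).
Variable mu : probability torus R.

Definition istpoly (f : torus -> C^o) : Prop := exists l, f = tpoly l.

Lemma istpoly_cst (c : C) : istpoly (fun=> c).
Proof.
exists [:: (idx0, c : C^o)]; apply/funext => z.
by rewrite /tpoly big_seq1 monomial0 scale1r.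
Qed.

Lemma istpolyD f g : istpoly f -> istpoly g -> istpoly (fun z => f z + g z).
Proof. by move=> [k ->] [l ->]; exists (k ++ l); apply/funext => z; rewrite tpoly_cat. Qed.

Lemma istpolyM f g : istpoly f -> istpoly g -> istpoly (fun z => f z * g z : C^o).
Proof. by move=> [k ->] [l ->]; exists (tmul k l); apply/funext => z; rewrite tmulE. Qed.

Definition idx1 (i : nat) : multi_index := mkidx i.+1 (fun j => (j == i)%:Z).

Lemma idx1E i j : idx1 i j = (j == i)%:Z.
Proof. by rewrite mkidxE ltnS; case: leqP => // ij; rewrite gtn_eqF. Qed.

Lemma monomial_idx1 i (z : torus) : monomial (idx1 i) z = sval (z i).
Proof.
rewrite (@monomialE _ i.+1) => [|j ij]; last by rewrite idx1E gtn_eqF.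
rewrite big_ord_recr /= idx1E eqxx big1 ?mul1r// => j _.
by rewrite idx1E ltn_eqF// expr0z.
Qed.

Lemma istpoly_monomial a : istpoly (fun z => monomial a z).
Proof.
exists [:: (a, 1 : C^o)]; apply/funext => z.
by rewrite /tpoly big_seq1 /GRing.scale /= mulr1.
Qed.

Lemma circle_conj (c : circle R) : conjc (sval c) = (sval c)^-1.
Proof.
apply: (@mulfI _ (sval c)); first exact: circle_neq0.
by rewrite divff ?circle_neq0// mul_conjc circle_cabs expr1n.
Qed.

Definition half_plane (q : C) (t : R) : set C^o := [set c | t < complex.Re (conjc q * c)].

Lemma open_half_plane q t : open (half_plane q t).
Proof.
have q1 : 0 < cabs q + 1 by rewrite ltr_wpDl// cabs_ge0.
have -> : half_plane q t = [set c | t / (cabs q + 1) < complex.Re (conjc q * c) / (cabs q + 1)].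
  by apply/seteqP; split=> c /=; rewrite /half_plane /= ltr_pM2r// invr_gt0.
apply: open_lt_lip => x y; rewrite -mulrBl normrM [X in _ * X]ger0_norm ?invr_ge0 ?(ltW q1)//.
rewrite ler_pdivrMr//.
have -> : complex.Re (conjc q * x) - complex.Re (conjc q * y) = complex.Re (conjc q * (x - y)).
  by rewrite mulrBr; case: (_ * x) (_ * y) => [? ?] [? ?].
apply: le_trans (ler_Re_cabs _) _; rewrite cabsM cabs_conjc rnorm_cabs.
by rewrite mulrC ler_wpM2l ?cabs_ge0// lerDl.
Qed.

Lemma measurable_coord_set i (U : set (circle R)) : measurable U ->
  measurable [set z : torus | U (z i)].
Proof.
by move=> mU; have := @measurable_pow_nat_coord _ (circle R) i measurableT _ mU; rewrite setTI.
Qed.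

Lemma approx_half_plane i q t : approx_set mu [set z : torus | half_plane q t (sval (z i))].
Proof.
pose L := cabs q + `|t| + 1.
have L0 : 0 < L by rewrite ltr_wpDl// addr_ge0// cabs_ge0.
pose g (z : torus) : R := (complex.Re (conjc q * sval (z i)) - t) / L.
have g1 z : `|g z| <= 1.
  rewrite normrM [X in _ * X]ger0_norm ?invr_ge0 ?(ltW L0)// ler_pdivrMr// mul1r.
  apply: le_trans (ler_normB _ _) _.
  have := ler_Re_cabs (conjc q * sval (z i)); rewrite cabsM cabs_conjc circle_cabs mulr1.
  by rewrite /L; lra.
have tp_g : istpoly (fun z => (g z)%:C).
  have -> : (fun z => (g z)%:C : C^o) = fun z =>
     (conjc q / 2 / L%:C) * monomial (idx1 i) z +
     ((q / 2 / L%:C) * monomial (idx_opp (idx1 i)) z + (- (t / L)%:C) : C^o) : C^o.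
    apply/funext => z; rewrite monomial_opp monomial_idx1 -circle_conj.
    have key (c : C) : (complex.Re (conjc q * c))%:C = (conjc q * c + q * conjc c) / 2.
      by rewrite ReJ_add; congr ((_ + _) / _); case: (q) (c) => [? ?] [? ?]; simpc.
    rewrite /g 2!realCM realCB key realCV; ring.
  apply: istpolyD; first by apply: istpolyM; [exact: istpoly_cst|exact: istpoly_monomial].
  apply: istpolyD; last exact: istpoly_cst.
  by apply: istpolyM; [exact: istpoly_cst|exact: istpoly_monomial].
have tp_s k : istpoly (fun z => (sgn_iter k (g z))%:C).
  elim: k => //= k IH.
  have -> : (fun z => ((3 * sgn_iter k (g z) - sgn_iter k (g z) ^+ 3) / 2)%:C : C^o) =
    fun z => (2^-1 * (3 * (sgn_iter k (g z))%:C + (-1) * ((sgn_iter k (g z))%:C *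
      ((sgn_iter k (g z))%:C * (sgn_iter k (g z))%:C))) : C^o).
    apply/funext => z; rewrite realCM realCB realCX realCV !realCM !realC_nat.
    by ring.
  apply: istpolyM; first exact: istpoly_cst.
  apply: istpolyD; first by apply: istpolyM; [exact: istpoly_cst|exact: IH].
  apply: istpolyM; first exact: istpoly_cst.
  by apply: istpolyM; [exact: IH|apply: istpolyM].
pose h k z : R := (sgn_iter k (g z) + sgn_iter k (g z) ^+ 2) / 2.
apply: (@approx_set_lim _ mu (fun k z => (h k z)%:C)).
- apply: (@measurable_coord_set i [set c | half_plane q t (sval c)]).
  exact: measurable_circle_open (@open_half_plane q t).
- move=> k; suff [l ->] : istpoly (fun z => (h k z)%:C) by exact: approximable_tpoly.
  have -> : (fun z => (h k z)%:C : C^o) = fun z => (2^-1 * ((sgn_iter k (g z))%:C +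
      (sgn_iter k (g z))%:C * (sgn_iter k (g z))%:C) : C^o).
    apply/funext => z; rewrite /h realCM realCD realCX realCV !realC_nat.
    by ring.
  apply: istpolyM; first exact: istpoly_cst.
  by apply: istpolyD => //; apply: istpolyM.
- move=> k z; rewrite rnorm_cabs cabs_real /h normrM [X in _ * X]ger0_norm ?invr_ge0//.
  rewrite ler_pdivrMr// mul1r; apply: le_trans (ler_normD _ _) _; rewrite normrX.
  have := sgn_iter_bound k (g1 z); have := normr_ge0 (sgn_iter k (g z)).
  set u := `|sgn_iter k (g z)| => u0 u1; have : u ^+ 2 <= 1 by rewrite expr_le1.
  by lra.
- move=> z; have H := sgn_iter_cvg (g1 z).
  apply/cvg_rnormP => e e0; move/cvgrPdist_lt: H => /(_ e e0) H.
  near=> k; have -> : ind [set z0 | half_plane q t (sval (z0 i))] z = (if 0 < g z then 1 else 0 : R)%:C.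
    rewrite /ind; have -> : (z \in [set z0 | half_plane q t (sval (z0 i))]) = (0 < g z).
      apply/idP/idP => [|gz].
        by rewrite inE /= /half_plane /= => tz; rewrite divr_gt0// subr_gt0.
      by rewrite inE /= /half_plane /=; move: gz; rewrite /g pmulr_lgt0 ?invr_gt0// subr_gt0.
    by case: ifP.
  rewrite rnorm_cabs -realCB cabs_real; near: k; exact: H.
Unshelve. all: by end_near. Qed.

Lemma dist_circle (x y : circle R) :
  cabs (sval x - sval y) ^+ 2 = 2 - 2 * complex.Re (conjc (sval x) * sval y).
Proof.
have h (c : circle R) : complex.Re (sval c) ^+ 2 + complex.Im (sval c) ^+ 2 = 1.
  by rewrite -cabs_sqr circle_cabs expr1n.
move: (h x) (h y); rewrite cabs_sqr.
case: (sval x) (sval y) => a b [c e] /= ab ce.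
transitivity ((a ^+ 2 + b ^+ 2) + (c ^+ 2 + e ^+ 2) - 2 * (a * c + b * e)); first by ring.
by rewrite ab ce; ring.
Qed.

Lemma circle_half_plane (U : set C^o) (x : circle R) : open U -> U (sval x) ->
  exists (p : rat * rat) (t : rat),
    half_plane (ratr p.1 +i* ratr p.2)%C (ratr t) (sval x) /\
    forall y : circle R, half_plane (ratr p.1 +i* ratr p.2)%C (ratr t) (sval y) -> U (sval y).
Proof.
move=> oU Ux; have : nbhs (sval x : C^o) U by exact: open_nbhs_nbhs.
move=> /nbhs_ballP[r' /= r'0 rU].
have rE : r' = (complex.Re r')%:C by rewrite RRe_real// gtr0_real.
pose r := complex.Re r'; have r0 : 0 < r by rewrite -ltcR -rE.
pose n := r ^+ 2 / 8; have n0 : 0 < n by rewrite divr_gt0// exprn_gt0.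
have dense (s : R) : exists q : rat, `|s - ratr q| < n / 2.
  have : s - n / 2 < s + n / 2 by lra.
  by move=> /rat_in_itvoo[q]; rewrite in_itv/= => tq; exists q; rewrite ltr_norml; lra.
have [[p1 h1] [p2 h2]] := (dense (complex.Re (sval x)), dense (complex.Im (sval x))).
have : 1 - 3 * n < 1 - n by lra.
move=> /rat_in_itvoo[t]; rewrite in_itv/= => /andP[t1 t2].
exists (p1, p2), t => /=; set q := (_ +i* _)%C.
have qx : cabs (q - sval x) < n.
  rewrite [_ - _]complexE; apply: le_lt_trans (ler_cabsD _ _) _.
  rewrite cabsM cabs_i mul1r !cabs_real [n]splitr.
  by move: h1 h2; rewrite /q; case: (sval x) => a b /= h1 h2; rewrite ltrD// distrC.
have ReB (y : circle R) : `|complex.Re (conjc q * sval y) - complex.Re (conjc (sval x) * sval y)| < n.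
  have -> : complex.Re (conjc q * sval y) - complex.Re (conjc (sval x) * sval y) =
            complex.Re (conjc (q - sval x) * sval y).
    by rewrite rmorphB mulrBl; case: (_ * _) (conjc (sval x) * _) => [? ?] [? ?].
  apply: le_lt_trans (ler_Re_cabs _) _; by rewrite cabsM cabs_conjc circle_cabs mulr1.
split=> [|y].
  rewrite /half_plane/=; have := ReB x; have := dist_circle x x.
  by rewrite subrr (cabs_real 0) normr0 expr0n /= ltr_norml; lra.
rewrite /half_plane/= => ty; apply: rU; rewrite -ball_normE /ball_ /= normE rE ltcR -/r.
rewrite -(@ltr_pXn2r _ 2) ?nnegrE ?rnorm_ge0 ?(ltW r0)//.
have := ReB y; rewrite rnorm_cabs dist_circle ltr_norml.
have : 8 * n = r ^+ 2 by rewrite /n; field.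
by lra.
Qed.

Lemma approx_coord_open i (U : set C^o) : open U -> approx_set mu [set z : torus | U (sval (z i))].
Proof.
move=> oU.
pose Q p t : set C^o := half_plane (ratr p.1 +i* ratr p.2)%C (ratr t).
pose A k : set torus := if @choice.unpickle ((rat * rat) * rat)%type k is Some pt
  then (if `[< forall y : circle R, Q pt.1 pt.2 (sval y) -> U (sval y) >]
     then [set z | Q pt.1 pt.2 (sval (z i))] else set0) else set0.
have -> : [set z : torus | U (sval (z i))] = \bigcup_k A k.
  apply/seteqP; split=> [z /= Uz|z [k _]].
    have [p [t [Qz QU]]] := circle_half_plane oU Uz.
    have Apt : A (choice.pickle (p, t)) = [set z | Q p t (sval (z i))].
      by rewrite /A choice.pickleK /= ifT//; apply/asboolP.
    exists (choice.pickle (p, t)); first exact: I.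
    by rewrite Apt.
  rewrite /A; case: choice.unpickle => [[p t]|]//=; case: asboolP => // QU /= Qz.
  exact: QU.
apply: approx_bigcup => k; rewrite /A; case: choice.unpickle => [[p t]|]; last exact: approx_set0.
by case: ifP => _; [exact: approx_half_plane|exact: approx_set0].
Qed.

Lemma approx_measurable (A : set torus) : measurable A -> approx_set mu A.
Proof.
apply: smallest_sub; first exact: approx_sigma_algebra.
move=> _ [i _ [B mB <-]]; rewrite setTI -[X in approx_set _ X]/[set z : torus | B (z i)].
pose S : set (set (circle R)) := [set B | approx_set mu [set z : torus | B (z i)]].
have sS : sigma_algebra setT S.
  split; first exact: approx_set0.
    by move=> D SD; rewrite setTD; exact: (approx_setC SD).
  by move=> F SF; exact: (approx_bigcup SF).
suff : @measurable _ (circle R) `<=` S by move=> /(_ B mB).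
apply: smallest_sub; first exact: sS.
by move=> _ [U oU <-]; exact: approx_coord_open.
Qed.

End Density.

Section Tails.
Context {R : realType}.

Lemma bounded_tail (a : nat -> R) (M : R) : (forall k, 0 <= a k) ->
  (forall n, \sum_(k < n) a k <= M) ->
  forall e, 0 < e -> exists n0, forall n m, (n0 <= n)%N -> (n <= m)%N ->
    \sum_(n <= k < m) a k < e.
Proof.
move=> a0 aM e e0; pose S : set R := range (fun n => \sum_(k < n) a k).
have hS : has_sup S by split; [exists (\sum_(k < 0) a k), 0%N|exists M => _ [n _ <-]].
have [_ [n0 _ <-] Hn0] := sup_adherent e0 hS.
exists n0 => n m n0n nm.
have : \sum_(k < m) a k <= sup S by apply: sup_upper_bound => //; exists m.
have split_sum p q : (p <= q)%N -> \sum_(k < q) a k = \sum_(k < p) a k + \sum_(p <= k < q) a k.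
  by move=> pq; rewrite -!(big_mkord xpredT) -big_cat_nat.
rewrite (split_sum n m)// (split_sum n0 n)//.
have : 0 <= \sum_(n0 <= k < n) a k by apply: sumr_ge0.
lra.
Qed.

Lemma rnorm_telescope (X : normedModType R[i]) (s : nat -> X) n m : (n <= m)%N ->
  rnorm (s m - s n) <= \sum_(n <= k < m) rnorm (s k.+1 - s k).
Proof.
move=> nm; rewrite -telescope_sumr//.
exact: (seminorm_sum rnorm_seminorm).
Qed.

Lemma summable_cvgn (X : completeNormedModType R[i]) (s : nat -> X) (M : R) :
  (forall n, \sum_(k < n) rnorm (s k.+1 - s k) <= M) -> cvgn s.
Proof.
move=> sM; apply: rnorm_cauchy_cvg => e e0.
have [|n0 Hn] := bounded_tail (a := fun k => rnorm (s k.+1 - s k)) _ sM e0.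
  by move=> k; exact: rnorm_ge0.
exists n0 => n m n0n n0m; wlog nm : n m n0n n0m / (m <= n)%N.
  by case: (leqP m n) => [mn|/ltnW nm] H; [|rewrite rnormB]; exact: H.
by apply: le_lt_trans (rnorm_telescope s nm) _; exact: Hn.
Qed.

End Tails.

Section AeSummable.
Context {R : realType} d (T : measurableType d) (mu : probability T R).

Lemma ae_summable (g : nat -> T -> R) (M : R) :
  (forall k, measurable_fun setT (g k)) -> (forall k t, 0 <= g k t) ->
  (forall n, (\sum_(k < n) \int[mu]_t (g k t)%:E <= M%:E)%E) ->
  exists N, [/\ measurable N, mu N = 0%E &
    forall t, ~ N t -> exists B : R, forall n, \sum_(k < n) g k t <= B].
Proof.
move=> mg g0 gM.
pose G t := (\sum_(k <oo) (g k t)%:E)%E.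
have mgE k : measurable_fun setT (fun t => (g k t)%:E) by exact/measurable_EFinP.
have mG : measurable_fun setT G.
  apply: (@ge0_emeasurable_sum _ _ R setT (fun k t => (g k t)%:E) xpredT) => [k t _ _|k _ //].
  by rewrite lee_fin.
have iG : mu.-integrable setT G.
  apply/integrableP; split=> //.
  rewrite (eq_integral G); last first.
    by move=> t _; rewrite gee0_abs// nneseries_ge0// => k _ _; rewrite lee_fin.
  rewrite integral_nneseries//; last by move=> k t _; rewrite lee_fin.
  apply: (@le_lt_trans _ _ M%:E); last by rewrite ltry.
  apply: lime_le; first by apply: is_cvg_nneseries => k _ _; apply: integral_ge0 => t _; rewrite lee_fin.
  by apply: nearW => n; rewrite big_mkord.
have [N [mN N0 subN]] := integrable_ae measurableT iG.
exists N; split=> // t Nt; exists (fine (G t)) => n.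
have fG : G t \is a fin_num.
  by apply: contrapT => nf; apply: Nt; apply: subN => /(_ I).
rewrite -lee_fin fineK// -sumEFin.
have := @nneseries_lim_ge R (fun k => (g k t)%:E) xpredT 0 n.
by rewrite big_mkord; apply => k _ _; rewrite lee_fin.
Qed.

End AeSummable.

Section RieszFischer.
Context {R : realType} {X : completeNormedModType R[i]} d (T : measurableType d).
Variable mu : probability T R.

Lemma I2_le_sqr (f : T -> X) (K : R) : strongly_measurable f -> 0 <= K ->
  (I2 mu f <= (K ^+ 2)%:E)%E -> in_Lp mu 2 f /\ N2 mu f <= K.
Proof.
move=> mf K0 H; have Lf : in_Lp mu 2 f.
  by apply/in_L2P; split=> //; apply: le_lt_trans H _; rewrite ltry.
split=> //; move: H; rewrite (N2_sqr Lf) lee_fin ler_sqr ?nnegrE ?N2_ge0//.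
Qed.

Lemma N2_telescope (S : nat -> T -> X) n m : (forall n, in_Lp mu 2 (S n)) -> (n <= m)%N ->
  N2 mu (fun t => S m t - S n t) <= \sum_(n <= k < m) N2 mu (fun t => S k.+1 t - S k t).
Proof.
move=> LS nm.
have -> : (fun t => S m t - S n t) = fun t => \sum_(n <= k < m) (S k.+1 t - S k t).
  by apply/funext => t; rewrite (telescope_sumr (fun k => S k t)).
by apply: (in_L2_sum _ _ _).2 => k; exact: (N2B (LS _) (LS _)).1.
Qed.

Lemma riesz_fischer (S : nat -> T -> X) (M : R) : (forall n, in_Lp mu 2 (S n)) ->
  (forall n, \sum_(k < n) N2 mu (fun t => S k.+1 t - S k t) <= M) ->
  exists F, in_Lp mu 2 F /\ forall e : R, 0 < e -> exists n0, forall n, (n0 <= n)%N ->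
    N2 mu (fun t => F t - S n t) <= e.
Proof.
move=> LS SM; have mS n := (LS n).1.
pose g k t := rnorm (S k.+1 t - S k t).
have LD k : in_Lp mu 2 (fun t => S k.+1 t - S k t) := (N2B (LS k.+1) (LS k)).1.
have [|||N [mN N0 HN]] := @ae_summable _ _ _ mu g M.
- by move=> k; apply: measurable_rnorm; exact: (LD k).1.
- by move=> k t; exact: rnorm_ge0.
- move=> n; apply: (@le_trans _ _ (\sum_(k < n) N2 mu (fun t => S k.+1 t - S k t))%:E); last by rewrite lee_fin.
  by rewrite -sumEFin; apply: lee_sum => k _; exact: I1_le_N2.
pose S' n t := if t \in ~` N then S n t else 0.
have cS' t : cvgn (S' ^~ t).
  rewrite /S'; case: (boolP (t \in ~` N)) => [|_]; last exact: is_cvg_cst.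
  by rewrite inE /= => /HN[B HB]; exact: (@summable_cvgn _ _ (S ^~ t) B).
pose F t : X := limn (S' ^~ t).
have mS' n : strongly_measurable (S' n) by apply: strongly_measurable_if => //; exact: measurableC.
have SF t : S' ^~ t @ \oo --> F t by exact: cS'.
have mF : strongly_measurable F by exact: strongly_measurable_lim SF.
have I2S' n (f : T -> X) : strongly_measurable f ->
    I2 mu (fun t => f t - S n t)%R = I2 mu (fun t => f t - S' n t)%R.
  move=> mf; apply: ge0_ae_eq_integral => //.
  - by apply: measurable_rnorm_sqr; exact: strongly_measurableB.
  - by apply: measurable_rnorm_sqr; exact: strongly_measurableB.
  - by move=> t _; rewrite lee_fin sqr_ge0.
  - by move=> t _; rewrite lee_fin sqr_ge0.
  exists N; split=> // t /= nt; apply: contrapT => Nt; apply: nt => _.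
  by rewrite /S' ifT//; apply: mem_set.
have bnd n e : 0 < e -> (forall m, (n <= m)%N -> \sum_(n <= k < m) N2 mu (fun t => S k.+1 t - S k t) <= e) ->
    (I2 mu (fun t => F t - S n t)%R <= (e ^+ 2)%:E)%E.
  move=> e0 He; rewrite I2S'//.
  have cvg_sq t : (fun m => (rnorm (S' (n + m)%N t - S' n t) ^+ 2)%:E) @ \oo --> (rnorm (F t - S' n t) ^+ 2)%:E.
    apply: cvg_EFin; first exact: nearW.
    have : (fun m => S' (n + m)%N t - S' n t) @ \oo --> F t - S' n t.
      apply: cvgB; last exact: cvg_cst.
      by under eq_fun do rewrite addnC; have := SF t; rewrite -(cvg_shiftn n).
    move=> /cvg_rnorm_comp c; rewrite expr2; under eq_fun do rewrite expr2.
    exact: cvgM.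
  rewrite /I2 (eq_integral (fun t => limn_einf (fun m => (rnorm (S' (n + m)%N t - S' n t) ^+ 2)%:E))); last first.
    move=> t _; rewrite is_cvg_limn_einfE; last exact: cvgP (cvg_sq t).
    by apply/esym/cvg_lim => //; exact: cvg_sq.
  apply: le_trans (fatou _ _ _ _) _ => //.
  - by move=> m; apply: measurable_rnorm_sqr; exact: strongly_measurableB.
  - by move=> m t _; rewrite lee_fin sqr_ge0.
  rewrite limn_einf_lim; apply: lime_le; first exact: is_cvg_einfs.
  apply: nearW => m; apply: (@le_trans _ _ (I2 mu (fun t => S' (n + m)%N t - S' n t)%R)).
    by apply: ereal_inf_lbound; exists m => /=.
  apply: (@le_trans _ _ (I2 mu (fun t => S (n + m)%N t - S n t)%R)).
    apply: ge0_le_integral => //.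
    - by move=> t _; rewrite lee_fin sqr_ge0.
    - by apply: measurable_rnorm_sqr; exact: strongly_measurableB.
    - by apply: measurable_rnorm_sqr; exact: strongly_measurableB.
    move=> t _; rewrite lee_fin ler_sqr ?nnegrE ?rnorm_ge0// /S'.
    by case: ifP => _ //; rewrite subrr rnorm0 rnorm_ge0.
  have LB := (N2B (LS (n + m)%N) (LS n)).1.
  rewrite (N2_sqr LB) lee_fin ler_sqr ?nnegrE ?N2_ge0 ?(ltW e0)//.
  apply: le_trans (N2_telescope LS (leq_addr m n)) _.
  by apply: He; exact: leq_addr.
have H e : 0 < e -> exists n0, forall n, (n0 <= n)%N ->
    in_Lp mu 2 (fun t => F t - S n t) /\ N2 mu (fun t => F t - S n t) <= e.
  move=> e0; have [|n0 Hn] := bounded_tail (a := fun k => N2 mu (fun t => S k.+1 t - S k t)) _ SM e0.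
    by move=> k; exact: N2_ge0.
  exists n0 => n n0n; apply: I2_le_sqr; [exact: strongly_measurableB|exact: ltW|].
  by apply: bnd => // m nm; apply/ltW/Hn.
exists F; split; last by move=> e /H[n0 Hn]; exists n0 => n /Hn[].
have [n0 Hn] := H 1 ltr01; have [LF _] := Hn n0 (leqnn _).
by have := (N2D LF (LS n0)).1; under eq_fun do rewrite subrK.
Qed.

End RieszFischer.

Section DenseL2.
Context {R : realType} {X : normedModType R[i]}.
Notation C := R[i].
Notation torus := (polytorus R).
Variable mu : probability torus R.

Lemma approximable_simple (s : torus -> X) : simple_fun s -> approximable mu s.
Proof.
move=> ss.
have -> : s = fun z => \sum_(x <- pwcst_values s) ind (s @^-1` [set x]) z *: x.
  apply/funext => z; rewrite (bigD1_seq (s z))//=; last exact: values_uniq.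
    rewrite /ind mem_set// scale1r big1 ?addr0// => x xz.
    by rewrite memNset ?scale0r//= => /esym/eqP; apply/negP.
  exact: mem_values.
elim: (pwcst_values s) => [|x r IH].
  by under eq_fun do rewrite big_nil; exact: approximable_cst.
under eq_fun do rewrite big_cons; apply: approximableD => //.
apply: (@approximableM _ _ _ _ (fun=> x) (rnorm x)) => //; last exact: approximable_cst.
by apply: (approx_measurable mu _).2; exact: ss.2.
Qed.

(** Trigonometric polynomials are dense. *)
Lemma approximable_L2 (f : torus -> X) : in_Lp mu 2 f -> approximable mu f.
Proof.
move=> Lf; apply: approximable_lim => // e e0.
have [s [ss sf sle]] := simple_approx Lf.1.
have [n [_ Hn]] := N2_dominated (fun n => strongly_measurable_simple (ss n)) Lf Lf sle sf e0.
by exists (s n); split=> //; exact: approximable_simple.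
Qed.

Lemma I1_scale_le (c : torus -> C^o) (f : torus -> X) : in_Lp mu 2 c -> in_Lp mu 2 f ->
  (I1 mu (fun z => c z *: f z) <= (N2 mu c * N2 mu f)%:E)%E.
Proof.
move=> Lc Lf.
have := @hoelder _ _ _ mu _ _ 2 2 (measurable_rnorm Lc.1) (measurable_rnorm Lf.1).
have -> : 2^-1 + 2^-1 = 1 :> R by field.
rewrite ltr0n => /(_ isT isT erefl).
rewrite Lnorm1 EFinM -!N2_fin//; apply: le_trans; rewrite le_eqVlt; apply/orP; left; apply/eqP.
apply: eq_integral => z _.
by rewrite /= rnormZ -rnorm_cabs ger0_norm// mulr_ge0// rnorm_ge0.
Qed.

End DenseL2.

Section Uniqueness.
Context {R : realType} {X : completeNormedModType R[i]}.
Notation C := R[i].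
Notation torus := (polytorus R).
Variable mu : probability torus R.
Hypothesis mu_haar : haar (@circle_mul R) mu.
Implicit Types (f g h : torus -> X).

Lemma bochner_integrable f : in_Lp mu 2 f -> is_bochner_integral mu f (bochner_integral mu f).
Proof. by move=> Lf; apply: bochner_exists; [exact: Lf.1|exact: in_L2_I1]. Qed.

Lemma bochner_tpoly_scale h (l : seq (multi_index * C^o)) : in_Lp mu 2 h ->
  (forall a, fourier_coef mu h a = 0) ->
  is_bochner_integral mu (fun z => tpoly l z *: h z) 0.
Proof.
move=> Lh h0; elim: l => [|p l IH].
  under [X in is_bochner_integral _ X _]eq_fun do rewrite /tpoly big_nil scale0r.
  exact: bochner_cst.
have := fourierP (idx_opp p.1) Lh; rewrite h0 => Hp.
have := bochner_lin (p.2 : C) Hp IH; rewrite scaler0 addr0.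
under [X in is_bochner_integral _ X _]eq_fun do rewrite monomial_opp invrK scalerA -scalerDl.
congr is_bochner_integral; apply/funext => z.
by rewrite /tpoly big_cons; congr ((_ + _) *: _); exact: mulrC.
Qed.

Lemma bochner_ind (A : set torus) (x : X) : measurable A ->
  is_bochner_integral mu (fun z => ind A z *: x) ((fine (mu A))%:C *: x).
Proof.
move=> mA; pose q (z : torus) := z \in A; pose phi (b : bool) := if b then x else 0.
have qA : q @^-1` [set true] = A by apply/seteqP; split=> z; [exact: set_mem|exact: mem_set].
have pq : pwcst q.
  have := pwcst_if mA (pwcst_cst torus true) (pwcst_cst torus false); congr pwcst.
  by apply/funext => z; rewrite /q; case: (z \in A).
have E : (fun z => ind A z *: x) = phi \o q.
  by apply/funext => z; rewrite /phi /q /ind /=; case: (z \in A); rewrite ?scale1r ?scale0r.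
have ss : simple_fun (phi \o q) by exact: pwcst_comp.
have := bochner_simple mu ss; rewrite E; congr is_bochner_integral.
rewrite simple_integral_comp//.
have [tv|ntv] := boolP (true \in pwcst_values q).
  rewrite (bigD1_seq true)//=; last exact: values_uniq.
  by rewrite qA big1 ?addr0// => -[]//= _; rewrite scaler0.
rewrite big_seq big1 => [|[] bv]; first last.
- by rewrite /phi scaler0.
- by rewrite bv in ntv.
suff -> : A = set0 by rewrite measure0 scale0r.
apply/seteqP; split=> // z Az; move: ntv; rewrite -(mem_set Az : q z = true).
by rewrite mem_values.
Qed.

(** A function with null coefficients is orthogonal to the trigonometric
    polynomials, hence to indicators. *)
Lemma bochner_ind0 h (A : set torus) : measurable A -> in_Lp mu 2 h ->
  (forall a, fourier_coef mu h a = 0) ->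
  is_bochner_integral mu (fun z => ind A z *: h z) 0.
Proof.
move=> mA Lh h0.
have [Lg _] : in_Lp mu 2 (fun z => ind A z *: h z) /\ N2 mu (fun z => ind A z *: h z) <= 1 * N2 mu h.
  apply: in_L2Z => //; first exact: (in_L2_ind mu mA).1.
  by move=> z; rewrite -rnorm_cabs; exact: rnorm_ind.
have bv := bochner_integrable Lg; set v := bochner_integral _ _ in bv.
suff v0 : v = 0 by rewrite v0 in bv.
apply/rnorm_eq0/eqP; rewrite eq_le rnorm_ge0 andbT; apply/ler_addgt0Pr => e e0; rewrite add0r.
have Lind := in_L2_ind mu mA.
have e1 : 0 < e / (N2 mu h + 1) by rewrite divr_gt0// ltr_wpDl// N2_ge0.
have [l Hl] := (approx_measurable mu mA).2.2 _ e1.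
have Ld := (N2B Lind (in_L2_tpoly mu l)).1.
have := bochner_lin (-1 : C) (bochner_tpoly_scale l Lh h0) bv.
under [X in is_bochner_integral _ X _]eq_fun do rewrite scaleN1r addrC -scalerBl.
rewrite scaler0 add0r => /bochner_le H; rewrite -lee_fin.
apply: (le_trans H); apply: le_trans (I1_scale_le Ld Lh) _; rewrite lee_fin.
apply: (@le_trans _ _ (e / (N2 mu h + 1) * N2 mu h)); first by rewrite ler_wpM2r// N2_ge0.
rewrite mulrAC ler_pdivrMr ?ltr_wpDl ?N2_ge0// ler_wpM2l ?lerDl// ltW//.
Qed.

Lemma fourier_eq0 h : in_Lp mu 2 h -> (forall a, fourier_coef mu h a = 0) -> N2 mu h = 0.
Proof.
move=> Lh h0.
have I1h : I1 mu h = 0%E.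
  apply/eqP; rewrite eq_le I1_ge0 andbT; apply/lee_addgt0Pr => e e0; rewrite add0e.
  have [s [ss sf sle]] := simple_approx Lh.1.
  have e2 : 0 < e / 2 by rewrite divr_gt0.
  have [n [Ls Hn]] := N2_dominated (fun n => strongly_measurable_simple (ss n)) Lh Lh sle sf e2.
  have Ld := (N2B Lh Ls).1; have I1d := I1_le_N2 Ld.
  have I1s : (I1 mu (s n) <= I1 mu (fun z => h z - s n z)%R)%E.
    pose A x : set torus := s n @^-1` [set x].
    have mA x : measurable (A x) by exact: (ss n).2.
    have md : measurable_fun setT (fun z => (rnorm (h z - s n z))%:E).
      by apply/measurable_EFinP/measurable_rnorm; exact: Ld.1.
    have -> : I1 mu (fun z => h z - s n z)%R =
        (\sum_(x <- pwcst_values (s n)) \int[mu]_(z in A x) (rnorm (h z - s n z))%:E)%E.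
      rewrite -ge0_integral_bigsetU//.
      - rewrite /I1 (_ : [set: torus] = \big[setU/set0]_(x <- pwcst_values (s n)) A x)//.
        apply/seteqP; split=> // z _; rewrite -bigcup_seq.
        by exists (s n z) => //=; exact: (mem_values z (ss n)).
      - exact: values_uniq.
      - by apply/trivIsetP => x y _ _ /eqP xy; apply/seteqP; split=> // t [/= tx ty]; apply: xy; rewrite -tx.
      - exact: measurable_funTS.
      - by move=> z _; rewrite lee_fin rnorm_ge0.
    rewrite /I1 (integral_pwcst mu (ss n) (@rnorm_ge0 _ X)) -sumEFin; apply: lee_sum => x _.
    have -> : rnorm x * fine (mu (A x)) = rnorm ((fine (mu (A x)))%:C *: x).
      by rewrite (seminormZ_real rnorm_seminorm) ger0_norm ?fine_ge0// mulrC.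
    have := bochner_le (bochner_lin (-1 : C) (bochner_ind0 (mA x) Lh h0) (bochner_ind x (mA x))).
    rewrite scaler0 add0r => /le_trans; apply.
    rewrite [leRHS]integral_mkcond; apply: ge0_le_integral => //.
    + by move=> z _; rewrite lee_fin rnorm_ge0.
    + apply: measurable_rnormE; apply: strongly_measurableD.
        apply: strongly_measurableZ; first exact: strongly_measurable_cst.
        apply: strongly_measurableZ; [exact: (in_L2_ind mu (mA x)).1|exact: Lh.1].
      by apply: strongly_measurableZ; [exact: (in_L2_ind mu (mA x)).1|exact: strongly_measurable_cst].
    + by apply/(measurable_restrictT _ (mA x)); apply: measurable_funTS; exact: md.
    move=> z _; rewrite /patch /ind; case: ifPn => [|_].
      by rewrite inE /A /= => ->; rewrite !scale1r scaleN1r addrC rnormB lexx.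
    by rewrite !scale0r scaler0 addr0 rnorm0.
  have : (I1 mu h <= I1 mu (fun z => h z - s n z)%R + I1 mu (s n))%E.
    have := I1_D mu Ld.1 Ls.1.
    by rewrite (_ : (fun z => _) = h)//; apply/funext => z; rewrite subrK.
  move=> /le_trans; apply; apply: le_trans (leeD (lexx _) I1s) _.
  apply: le_trans (leeD I1d I1d) _; rewrite -EFinD lee_fin.
  by move: Hn; lra.
have mh := measurable_rnormE Lh.1.
have ae0 : ae_eq mu setT (fun z => (rnorm (h z) ^+ 2)%:E) (cst 0%E).
  have : (\int[mu]_z `|(rnorm (h z))%:E| = 0)%E.
    by rewrite -I1h; apply: eq_integral => z _; rewrite gee0_abs// lee_fin rnorm_ge0.
  move=> /(ae_eq_integral_abs mu measurableT mh) [N [mN N0 HN]].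
  exists N; split=> // z nz; apply: HN => /= H; apply: nz => _.
  by have [->] := H I; rewrite expr0n.
have I20 : I2 mu h = 0%E.
  rewrite /I2 (ge0_ae_eq_integral _ _ _ _ _ ae0)//; first by rewrite integral0.
  - exact: measurable_rnorm_sqr Lh.1.
  - by move=> z _; rewrite lee_fin sqr_ge0.
by apply/eqP; move: I20; rewrite N2_sqr// => -[] /eqP; rewrite sqrf_eq0.
Qed.

Lemma fourier_inj f g : in_Lp mu 2 f -> in_Lp mu 2 g ->
  (forall a, fourier_coef mu f a = fourier_coef mu g a) ->
  N2 mu (fun z => f z - g z) = 0.
Proof.
move=> Lf Lg fg; apply: fourier_eq0; first exact: (N2B Lf Lg).1.
by move=> a; rewrite fourierB// fg subrr.
Qed.

Lemma N2_dist f g : in_Lp mu 2 f -> in_Lp mu 2 g ->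
  `|N2 mu f - N2 mu g| <= N2 mu (fun z => f z - g z).
Proof.
move=> Lf Lg; have Lfg := (N2B Lf Lg).1; have Lgf := (N2B Lg Lf).1.
have := (N2D Lfg Lg).2; under [X in N2 _ X <= _ -> _]eq_fun do rewrite subrK.
have := (N2D Lgf Lf).2; under [X in N2 _ X <= _ -> _]eq_fun do rewrite subrK.
have [_] := in_L2N Lfg; under [X in N2 _ X = _ -> _]eq_fun do rewrite opprB.
by move=> ->; rewrite ler_norml; lra.
Qed.

Lemma fourier_eq_N2 f g : in_Lp mu 2 f -> in_Lp mu 2 g ->
  (forall a, fourier_coef mu f a = fourier_coef mu g a) -> N2 mu f = N2 mu g.
Proof.
move=> Lf Lg fg; have := N2_dist Lf Lg; rewrite fourier_inj// normr_le0 subr_eq0.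
by move=> /eqP.
Qed.

End Uniqueness.

Section Primes.

Lemma next_primeP n : (n < next_prime n)%N && prime (next_prime n).
Proof. by rewrite /next_prime; case: ex_minnP. Qed.

Lemma next_prime_min n p : (n < p)%N -> prime p -> (next_prime n <= p)%N.
Proof. by move=> np pp; rewrite /next_prime; case: ex_minnP => q _; apply; rewrite np. Qed.

Lemma nth_prime_prime i : prime (nth_prime i).
Proof. by case/andP: (next_primeP (iter i next_prime 0)). Qed.

Lemma nth_prime_ltS i : (nth_prime i < nth_prime i.+1)%N.
Proof. by case/andP: (next_primeP (nth_prime i)). Qed.

Lemma nth_prime_lt : {homo nth_prime : i j / (i < j)%N}.
Proof. exact: homo_ltn ltn_trans nth_prime_ltS. Qed.

Lemma nth_prime_inj : injective nth_prime.
Proof.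
move=> i j ij; case: (ltngtP i j) => // /nth_prime_lt; by rewrite ij ltnn.
Qed.

Lemma nth_prime_gt i : (i < nth_prime i)%N.
Proof.
elim: i => [|i IH]; first exact: prime_gt0 (nth_prime_prime 0).
exact: leq_ltn_trans IH (nth_prime_ltS i).
Qed.

Lemma nth_prime_surj p : prime p -> exists i, nth_prime i = p.
Proof.
move=> pp; have : exists i, (p <= nth_prime i)%N by exists p; exact/ltnW/nth_prime_gt.
move=> /ex_minnP[i pi imin]; exists i; apply/eqP; rewrite eqn_leq pi andbT.
case: i pi imin => [|i] _ imin; first by apply: next_prime_min => //; exact: prime_gt0.
by apply: next_prime_min => //; rewrite ltnNge; apply/negP => /imin; rewrite ltnn.
Qed.

Lemma nat_of_indexE m (a : multi_index) : (forall i, (m <= i)%N -> a i = 0) ->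
  nat_of_index a = (\prod_(i < m) nth_prime i ^ `|a i|)%N.
Proof.
move=> am; rewrite /nat_of_index -(big_mkord xpredT (fun i => nth_prime i ^ `|a i|)%N).
transitivity (\prod_(i <- [seq i <- index_iota 0 m | i \in finsupp a]) nth_prime i ^ `|a i|)%N.
  apply: perm_big; apply: uniq_perm; [exact: finmap.fset_uniq|exact/filter_uniq/iota_uniq|].
  move=> i; rewrite mem_filter mem_index_iota /= andb_idr// mem_finsupp => ai.
  by rewrite ltnNge; apply: contra ai => /am ->.
rewrite big_filter big_mkcond; apply: eq_bigr => i _.
by case: ifPn => //; rewrite memNfinsupp => /eqP ->.
Qed.

Lemma nat_of_index_gt0 a : (0 < nat_of_index a)%N.
Proof. by apply: prodn_gt0 => i; rewrite expn_gt0 prime_gt0// nth_prime_prime. Qed.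

Lemma logn_nat_of_index a j : logn (nth_prime j) (nat_of_index a) = `|a j|%N.
Proof.
pose m := maxn (idx_bound a) j.+1.
have am i : (m <= i)%N -> a i = 0 by rewrite geq_max => /andP[/idx_boundP].
have jm : (j < m)%N by rewrite leq_max leqnn orbT.
rewrite (nat_of_indexE am).
have H k : (k <= m)%N -> logn (nth_prime j) (\prod_(i < k) nth_prime i ^ `|a i|)%N =
    if (j < k)%N then `|a j|%N else 0%N.
  elim: k => [|k IH] km; first by rewrite big_ord0 logn1.
  have q0 i : (0 < nth_prime i ^ `|a i|)%N by rewrite expn_gt0 prime_gt0// nth_prime_prime.
  have g0 : (0 < \prod_(i < k) nth_prime i ^ `|a i|)%N.
    by elim/big_ind: _ => // x y x0 y0; rewrite muln_gt0 x0.
  rewrite big_ord_recr /= lognM// IH; last exact: ltnW.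
  rewrite lognX logn_prime ?nth_prime_prime// (inj_eq nth_prime_inj) ltnS.
  by case: (ltngtP j k) => [jk|kj|->]; rewrite ?muln0 ?addn0 ?muln1.
by rewrite H// jm.
Qed.

(** The multi-index of the integer [n.+1]. *)
Definition ix (n : nat) : multi_index := mkidx n.+1 (fun i => (logn (nth_prime i) n.+1)%:Z).

Lemma ixE n i : ix n i = (logn (nth_prime i) n.+1)%:Z.
Proof.
rewrite mkidxE; case: ltnP => // ni; rewrite ltn_log0//.
exact: leq_ltn_trans ni (nth_prime_gt i).
Qed.

Lemma ix_nonneg n : nonneg_index (ix n).
Proof. by move=> i; rewrite ixE. Qed.

Lemma ixK n : nat_of_index (ix n) = n.+1.
Proof.
apply: eqn_from_log => //; first exact: nat_of_index_gt0.
move=> p; have [pp|np] := boolP (prime p); last by rewrite lognE (negPf np) /= lognE (negPf np).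
by have [i <-] := nth_prime_surj pp; rewrite logn_nat_of_index ixE absz_nat.
Qed.

Lemma nat_of_indexK a : nonneg_index a -> ix (nat_of_index a).-1 = a.
Proof.
move=> a0; apply: idxP => i; rewrite ixE prednK ?nat_of_index_gt0// logn_nat_of_index.
rewrite gez0_abs//; exact: a0.
Qed.

Lemma ix_inj : injective ix.
Proof. by move=> m n mn; have := ixK m; rewrite mn ixK => -[]. Qed.

End Primes.

Section SignsHaar.
Context {R : realType}.
Variable P : probability signs R.
Hypothesis P_haar : haar addb P.

Notation cube m := {ffun 'I_m -> bool}.

Definition first_signs (m : nat) (eps : signs) : cube m := [ffun i => eps (val i)].

Lemma first_signs_pwcst m : pwcst (@first_signs m).
Proof.
split; first exact: finite_finset.
move=> e.
have -> : @first_signs m @^-1` [set e] =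
    \bigcap_(i in [set: 'I_m]) (fun eps : signs => eps (val i)) @^-1` [set e i].
  apply/seteqP; split=> [eps /= <- i _|eps H]; first by rewrite /= ffunE.
  by apply/ffunP => i; rewrite ffunE; exact: H.
apply: fin_bigcap_measurable => // i _; rewrite -[X in measurable X]setTI.
exact: (@measurable_pow_nat_coord _ bool (val i)).
Qed.

Definition extend_signs m (e : cube m) : signs :=
  fun k => if @insub nat (fun k => k < m)%N 'I_m k is Some i then e i else false.

Lemma extend_signsE m (e : cube m) (i : 'I_m) : extend_signs e (val i) = e i.
Proof. by rewrite /extend_signs valK. Qed.

Lemma first_signs_uniform m (e : cube m) :
  fine (P (@first_signs m @^-1` [set e])) = #|{: cube m}|%:R^-1.
Proof.
have pf := first_signs_pwcst m; have mf e' : measurable (@first_signs m @^-1` [set e']) := pf.2 e'.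
have same e1 : P (@first_signs m @^-1` [set e1]) = P (@first_signs m @^-1` [set e]).
  rewrite -(P_haar (extend_signs (addc e e1)) (mf e)); congr (P _).
  apply/seteqP; split=> eps /=.
    move=> <-; apply/ffunP => i; rewrite ffunE extend_signsE !ffunE.
    by rewrite -addbA addbb addbF.
  move=> H; apply/ffunP => i; have /ffunP/(_ i) := H; rewrite !ffunE extend_signsE !ffunE.
  by case: (e i) (e1 i) (eps i) => [] [] [].
have := measure_partition P pf measurableT; rewrite probability_setT /=.
have all_val e' : e' \in pwcst_values (@first_signs m).
  have -> : e' = first_signs m (extend_signs e') by apply/ffunP => i; rewrite ffunE extend_signsE.
  exact: (mem_values _ pf).
under eq_bigr do rewrite setTI same.
rewrite (big_uniq _ (values_uniq _))/= (eq_bigl xpredT) => [|e']; last by rewrite all_val.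
rewrite sumr_const -[_ *+ _]mulr_natl => H.
have N0 : #|{: cube m}|%:R != 0 :> R by rewrite pnatr_eq0 -lt0n; apply/card_gt0P; exists e.
by apply: (mulfI N0); rewrite -H divff.
Qed.

Lemma integral_first_signs m (h : cube m -> R) : (forall e, 0 <= h e) ->
  (\int[P]_eps (h (first_signs m eps))%:E)%E = (avg h)%:E.
Proof.
move=> h0; have pf := first_signs_pwcst m; rewrite (integral_pwcst P pf h0).
under eq_bigr do rewrite first_signs_uniform.
have all_val e' : e' \in pwcst_values (@first_signs m).
  have -> : e' = first_signs m (extend_signs e') by apply/ffunP => i; rewrite ffunE extend_signsE.
  exact: (mem_values _ pf).
rewrite (big_uniq _ (values_uniq _))/= (eq_bigl xpredT) => [|e']; last by rewrite all_val.
by rewrite -mulr_suml mulrC.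
Qed.

Lemma measurable_first_signs_set m (Q : pred (cube m)) :
  measurable [set eps | Q (first_signs m eps)].
Proof. exact: (pwcst_preimage [set e | Q e] (first_signs_pwcst m)). Qed.

Lemma probability_first_signs m (Q : pred (cube m)) :
  P [set eps | Q (first_signs m eps)] = (avg (fun e => (Q e)%:R))%:E.
Proof.
rewrite -integral_first_signs//; have mA := measurable_first_signs_set Q.
transitivity (\int[P]_(x in [set eps | Q (first_signs m eps)]) (cst 1%:E) x)%E.
  by rewrite integral_cst// mul1e.
rewrite [LHS]integral_mkcond; apply: eq_integral => eps _; rewrite /patch.
case: ifPn => [|]; first by rewrite inE /= => ->.
by rewrite notin_setE /= => /negP/negbTE ->.
Qed.

End SignsHaar.

Section RootsOfUnity.
Context {R : realType}.
Notation C := R[i].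

Lemma root_of_unity k : exists c : C, cabs c = 1 /\ c ^+ (2 ^ k) = -1.
Proof.
have k0 : (0 < 2 ^ k)%N by rewrite expn_gt0.
exists ((2 ^ k).-root (-1)); split; last exact: rootCK.
have : cabs ((2 ^ k).-root (-1) : C) ^+ (2 ^ k) = 1 by rewrite -cabsX rootCK// (cabs_sign true).
by move=> /eqP; rewrite -[X in _ == X](expr1n R (2 ^ k)) eqrXn2// ?cabs_ge0// => /eqP.
Qed.

Lemma root_expn_neq1 (c : C) k d : c ^+ (2 ^ k) = -1 -> (0 < d < 2 ^ k.+1)%N -> c ^+ d != 1.
Proof.
move=> ck /andP[d0 dk]; apply/eqP => cd.
have [ o odd_o dE] : exists2 o, odd o & d = (o * 2 ^ logn 2%N d)%N.
  by have [l cl dl] := pfactor_coprime (isT : prime 2) d0; exists l; rewrite // -coprime2n.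
have vk : (logn 2%N d <= k)%N.
  rewrite -ltnS -(ltn_exp2l _ _ (isT : 1 < 2)%N); apply: leq_ltn_trans dk.
  by apply: dvdn_leq => //; exact: pfactor_dvdnn.
have : (c ^+ d) ^+ (2 ^ (k - logn 2%N d)) = -1.
  by rewrite -exprM {1}dE -mulnA -expnD subnKC// mulnC exprM ck -signr_odd odd_o expr1.
rewrite cd expr1n => /eqP; rewrite -subr_eq0 opprK -[1 + 1](natrD _ 1 1) pnatr_eq0.
by [].
Qed.

Lemma sum_root_exprz (c : C) k (d : int) : cabs c = 1 -> c ^+ (2 ^ k) = -1 ->
  (`|d| < 2 ^ k.+1)%N -> \sum_(t < 2 ^ k.+1) (c ^+ t) ^ d = if d == 0 then (2 ^ k.+1)%:R else 0.
Proof.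
move=> c1 ck dk; case: eqP => [->|/eqP d0].
  by rewrite (eq_bigr (fun=> 1)) => [|t _]; rewrite ?expr0z// sumr_const card_ord.
have c0 : c != 0 by apply/eqP => c0; move: c1; rewrite c0 (cabs_real 0) normr0 => /eqP; rewrite eq_sym oner_eq0.
have wM : (c ^ d) ^+ (2 ^ k.+1) = 1.
  by rewrite exprnP exprz_exp mulrC -exprz_exp -exprnP expnSr exprM ck sqrrN expr1n exp1rz.
have w1 : c ^ d != 1.
  case: d d0 dk {wM} => [n|n] n0 nk.
    by rewrite -exprnP; apply: (root_expn_neq1 ck); rewrite lt0n nk andbT.
  rewrite NegzE -exprnN invr_eq1; apply: (root_expn_neq1 ck).
  by rewrite NegzE abszN in nk.
have := subrX1 (c ^ d) (2 ^ k.+1); rewrite wM subrr => /esym/eqP; rewrite mulf_eq0 subr_eq0 (negPf w1) /= => /eqP H.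
rewrite -[RHS]H; apply: eq_bigr => t _.
by rewrite [c ^+ t]exprnP [RHS]exprnP !exprz_exp mulrC.
Qed.

End RootsOfUnity.

Section Type2Core.
Context {R : realType} {X : completeNormedModType R[i]}.
Notation C := R[i].
Notation torus := (polytorus R).
Variable mu : probability torus R.
Hypothesis mu_haar : haar (@circle_mul R) mu.

Lemma type2_sqr : type2 X -> exists2 K : R, 0 <= K & forall N (x : 'I_N -> X),
  avg (fun e : {ffun 'I_N -> bool} => rnorm (rsum e x) ^+ 2) <= K * \sum_n rnorm (x n) ^+ 2.
Proof.
move=> [c tc]; exists (c ^+ 2) => [|N x]; first exact: sqr_ge0.
have := tc N x; rewrite Esign_avg; set a := avg _; set b := \sum_n _ => H.
have a0 : 0 <= a by apply: avg_ge0 => e; exact: sqr_ge0.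
have b0 : 0 <= b by apply: sumr_ge0 => i _; exact: sqr_ge0.
rewrite -[X in X <= _](sqr_sqrtr a0) -[X in _ * X](sqr_sqrtr b0) -exprMn.
by rewrite ler_sqr ?nnegrE ?sqrtr_ge0// (le_trans _ H)// sqrtr_ge0.
Qed.

Lemma integral_avg (T : finType) (F : T -> torus -> R) (c : T -> R) :
  (forall t, measurable_fun setT (F t)) -> (forall t z, 0 <= F t z) ->
  (forall t, \int[mu]_z (F t z)%:E = (c t)%:E)%E ->
  (\int[mu]_z (avg (fun t => F t z))%:E = (avg c)%:E)%E.
Proof.
move=> mF F0 Fc; rewrite /avg; under eq_integral do rewrite EFinM.
have F0E : forall t z, setT z -> (0 <= (F t z)%:E)%E by move=> t z _; rewrite lee_fin.
have mFE t : measurable_fun setT (fun z => (F t z)%:E) by exact/measurable_EFinP.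
rewrite ge0_integralZl_EFin ?invr_ge0//.
- under eq_integral do rewrite -sumEFin.
  rewrite ge0_integral_sum//; under eq_bigr do rewrite Fc.
  by rewrite sumEFin -EFinM.
- by move=> z _; rewrite lee_fin sumr_ge0.
- by apply/measurable_EFinP; exact: measurable_sum.
Qed.

Variables (I : finType) (a : I -> multi_index).
Hypothesis a_inj : injective a.

(** Points of the torus with coordinates in the [2 ^ k.+1]-th roots of unity:
    for large [k] the characters [a i] are orthogonal on this finite group. *)
Lemma orthogonal_points : exists n (rho : 'I_n.+1 -> torus), forall i i',
  \sum_j monomial (idx_add (a i) (idx_opp (a i'))) (rho j) = if i == i' then n.+1%:R else 0.
Proof.
pose L := (\max_i idx_bound (a i))%N.
have aL i l : (L <= l)%N -> a i l = 0.
  by move=> Ll; apply: idx_boundP; apply: leq_trans Ll; exact: leq_bigmax.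
pose B := (\max_i \max_(l < L) `|a i l|)%N.
have aB i l : (`|a i l| <= B)%N.
  case: (ltnP l L) => [lL|/aL ->//].
  apply: leq_trans (leq_bigmax i); exact: (leq_bigmax (Ordinal lL)).
pose k := (B + B)%N; have [c [c1 ck]] := @root_of_unity R k.
pose G : finType := {ffun 'I_L -> 'I_(2 ^ k.+1)}.
pose pt (p : G) : torus := fun l => if @insub nat (fun l => l < L)%N 'I_L l is Some l'
   then to_circle (etrans (cabsX c (p l')) (etrans (congr1 (fun r => r ^+ p l') c1) (expr1n R (p l'))))
   else circle1 R.
have sumG i i' : \sum_p monomial (idx_add (a i) (idx_opp (a i'))) (pt p) =
    if i == i' then #|G|%:R else 0.
  set d := idx_add _ _; have dL l : (L <= l)%N -> d l = 0.
    by move=> Ll; rewrite idx_addE idx_oppE !aL.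
  transitivity (\sum_(p : G) \prod_l (c ^+ p l) ^ d l).
    apply: eq_bigr => p _; rewrite (monomialE _ dL); apply: eq_bigr => l _.
    by rewrite /pt valK.
  rewrite -(bigA_distr_bigA (fun (l : 'I_L) (t : 'I_(2 ^ k.+1)) => (c ^+ t) ^ d l)) /=.
  have dk l : (`|d l| < 2 ^ k.+1)%N.
    rewrite idx_addE idx_oppE; apply: leq_ltn_trans (ltn_expl k.+1 (isT : 1 < 2)%N).
    by have := aB i l; have := aB i' l; rewrite /k; lia.
  under eq_bigr do rewrite (sum_root_exprz c1 ck (dk _)).
  case: eqP => [ii'|ii'].
    rewrite (eq_bigr (fun=> (2 ^ k.+1)%:R)) => [|l _]; last by rewrite /d ii' idx_addE idx_oppE subrr eqxx.
    by rewrite prodr_const card_ord card_ffun !card_ord [RHS]natrX.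
  have [l dl] : exists l, d l != 0.
    apply: contrapT => nd; apply: ii'; apply: a_inj; apply/eqP; rewrite -idx_sub_eq0 -/d.
    by apply/eqP/idxP => l; rewrite idx0E; apply/eqP; apply: contrapT => /negP dl; apply: nd; exists l.
  have lL : (l < L)%N by rewrite ltnNge; apply: contra dl => /dL ->.
  by apply/eqP/prodf_eq0; exists (Ordinal lL) => //=; rewrite (negPf dl).
have G0 : (0 < #|G|)%N by rewrite card_ffun card_ord expn_gt0 expn_gt0.
exists #|G|.-1, (fun j => pt (enum_val (cast_ord (prednK G0) j))) => i i'.
rewrite [X in _ = if _ then X%:R else _](prednK G0) -sumG [RHS](reindex (fun j => enum_val (cast_ord (prednK G0) j)))//.
apply: onW_bij; exists (fun p => cast_ord (esym (prednK G0)) (enum_rank p)) => j.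
  by rewrite enum_valK cast_ordK.
by rewrite cast_ordKV enum_rankK.
Qed.

End Type2Core.

Section Type2Torus.
Context {R : realType} {X : completeNormedModType R[i]}.
Notation C := R[i].
Notation torus := (polytorus R).
Variable mu : probability torus R.
Hypothesis mu_haar : haar (@circle_mul R) mu.

Lemma conjc_unit (c : C) : cabs c = 1 -> conjc c = c^-1.
Proof.
move=> c1; have c0 : c != 0 by rewrite -cabs_eq0 c1 oner_eq0.
by apply: (mulfI c0); rewrite mul_conjc c1 expr1n divff.
Qed.

Lemma in_L2_monomials (I : finType) (a : I -> multi_index) (x : I -> X) :
  in_Lp mu 2 (fun z => \sum_i monomial (a i) z *: x i).
Proof. by apply: (in_L2_sum _ xpredT _).1 => i; exact: in_L2_monomial. Qed.

Lemma in_L2_rsum (I : finType) (e : {ffun I -> bool}) (a : I -> multi_index) (x : I -> X) :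
  in_Lp mu 2 (fun z => rsum e (fun i => monomial (a i) z *: x i)).
Proof.
rewrite (_ : (fun z => _) = fun z => \sum_i monomial (a i) z *: ((-1) ^+ e i *: x i)).
  exact: in_L2_monomials.
by apply/funext => z; apply: eq_bigr => i _; rewrite !scalerA mulrC.
Qed.

Lemma rotation_points K m (a : 'I_m -> multi_index) (x : 'I_m -> X) : injective a ->
  (forall N (x : 'I_N -> X), avg (fun e : {ffun 'I_N -> bool} => rnorm (rsum e x) ^+ 2)
     <= K * \sum_n rnorm (x n) ^+ 2) ->
  exists n (rho : 'I_n.+1 -> torus), forall z,
    avg (fun e : {ffun 'I_m -> bool} => rnorm (rsum e (fun i => monomial (a i) z *: x i)) ^+ 2) <=
    8 * K * avg (fun j => rnorm (\sum_i monomial (a i) (rot (rho j) z) *: x i) ^+ 2).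
Proof.
move=> a_inj typeK; have [n [rho orth]] := @orthogonal_points R _ a a_inj.
exists n, rho => z.
pose J : R := n.+1%:R; have J0 : 0 < J by [].
pose s : R := Num.sqrt J^-1.
have s2 : s ^+ 2 = J^-1 by rewrite sqr_sqrtr// invr_ge0.
pose f j := \sum_i monomial (a i) (rot (rho j) z) *: x i.
pose u : 'M[C]_(m, n.+1) := \matrix_(i, j) (s%:C * monomial (a i) (rho j)).
have conjS (w : C) : conjc (s%:C * w) = s%:C * conjc w.
  by rewrite [LHS]rmorphM; congr (_ * _); exact: conjc_real.
have uE i i' j : u i j * conjc (u i' j) =
    (J^-1)%:C * monomial (idx_add (a i) (idx_opp (a i'))) (rho j).
  rewrite !mxE monomial_add monomial_opp -s2.
  rewrite conjS conjc_unit ?monomial_cabs// realCX; ring.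
have JC : (J^-1)%:C * n.+1%:R = 1 :> C.
  by rewrite -(realC_nat) -realCM mulVf// lt0r_neq0.
have uu : u *m adj u = 1%:M.
  apply/matrixP => i i'; rewrite !mxE.
  under eq_bigr do rewrite adjE uE.
  rewrite -mulr_sumr orth; case: eqP => _; last by rewrite mulr0.
  exact: JC.
have uflat i j : cabs (u i j) ^+ 2 = n.+1%:R^-1.
  by rewrite mxE cabsM monomial_cabs mulr1 cabs_real ger0_norm ?sqrtr_ge0.
have := rotation_type2 (fun j => s%:C *: f j) (@rnorm_seminorm _ X) uu uflat (typeK n.+1).
rewrite (_ : \sum_j _ = avg (fun j => rnorm (f j) ^+ 2)); last first.
  rewrite /avg card_ord mulr_sumr; apply: eq_bigr => j _.
  by rewrite rnormZ cabs_real ger0_norm ?sqrtr_ge0// exprMn s2.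
rewrite (@eq_avg _ _ _ (fun e : {ffun 'I_m -> bool} =>
   rnorm (rsum e (fun i => monomial (a i) z *: x i)) ^+ 2))// => e.
congr (rnorm _ ^+ 2); apply: eq_rsum => i.
transitivity (\sum_i' (\sum_j (J^-1)%:C * monomial (idx_add (a i') (idx_opp (a i))) (rho j)) *:
     (monomial (a i') z *: x i')).
  under [RHS]eq_bigr do rewrite scaler_suml.
  rewrite exchange_big; apply: eq_bigr => j _ /=; rewrite /f !scaler_sumr; apply: eq_bigr => i' _.
  rewrite monomial_rot -uE !scalerA; congr (_ *: _); rewrite !mxE; ring.
rewrite (bigD1 i)//= -mulr_sumr orth eqxx JC scale1r big1 ?addr0// => i' /negPf ii'.
by rewrite -mulr_sumr orth ii' mulr0 scale0r.
Qed.

Lemma type2_ruc : type2 X -> exists2 K : R, 0 <= K &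
  forall m (a : 'I_m -> multi_index) (x : 'I_m -> X), injective a ->
  avg (fun e : {ffun 'I_m -> bool} => N2 mu (fun z => rsum e (fun i => monomial (a i) z *: x i)) ^+ 2) <=
  K * N2 mu (fun z => \sum_i monomial (a i) z *: x i) ^+ 2.
Proof.
move=> /type2_sqr[K K0 typeK]; exists (8 * K) => [|m a x a_inj]; first by rewrite mulr_ge0.
have [n [rho le_rho]] := rotation_points x a_inj typeK.
pose f z := \sum_i monomial (a i) z *: x i.
have Lf : in_Lp mu 2 f by exact: in_L2_monomials.
have mF (g : torus -> X) : in_Lp mu 2 g -> measurable_fun setT (fun z => rnorm (g z) ^+ 2).
  by move=> Lg; exact/measurable_EFinP/measurable_rnorm_sqr/Lg.1.
have H1 := integral_avg (mu := mu) (F := fun (e : {ffun 'I_m -> bool}) z =>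
     rnorm (rsum e (fun i => monomial (a i) z *: x i)) ^+ 2)
  (fun e => mF _ (in_L2_rsum e a x)) (fun e z => sqr_ge0 _) (fun e => N2_sqr (in_L2_rsum e a x)).
have H2 := integral_avg (mu := mu) (F := fun j z => rnorm (f (rot (rho j) z)) ^+ 2)
  (fun j => mF _ (in_L2_rot mu_haar (rho j) Lf).1) (fun j z => sqr_ge0 _)
  (fun j => N2_sqr (in_L2_rot mu_haar (rho j) Lf).1).
rewrite -lee_fin -H1.
have -> : (8 * K * N2 mu f ^+ 2)%:E =
   (\int[mu]_z (8 * K * avg (fun j => rnorm (f (rot (rho j) z)) ^+ 2))%:E)%E.
  under eq_integral do rewrite EFinM.
  rewrite ge0_integralZl_EFin ?mulr_ge0//.
  - rewrite H2 -EFinM; congr (_ * _)%:E; rewrite (@eq_avg _ _ _ (fun=> N2 mu f ^+ 2)) => [|j].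
      by rewrite (avg_cst ord0).
    by rewrite (in_L2_rot mu_haar (rho j) Lf).2.
  - by move=> z _; rewrite lee_fin avg_ge0// => j; exact: sqr_ge0.
  - apply/measurable_EFinP; apply: measurable_funM => //; apply: measurable_sum => j.
    exact: mF (in_L2_rot mu_haar (rho j) Lf).1.
apply: ge0_le_integral => //.
- by move=> z _; rewrite lee_fin avg_ge0// => e; exact: sqr_ge0.
- apply/measurable_EFinP; apply: measurable_funM => //; apply: measurable_sum => e.
  exact: mF (in_L2_rsum e a x).
- apply/measurable_EFinP; apply: measurable_funM => //; apply: measurable_funM => //; apply: measurable_sum => j.
  exact: mF (in_L2_rot mu_haar (rho j) Lf).1.
- by move=> z _; rewrite lee_fin; exact: le_rho.
Qed.

End Type2Torus.

Section DirichletPolynomials.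
Context {R : realType} {X : completeNormedModType R[i]}.
Notation C := R[i].
Notation torus := (polytorus R).
Notation cube m := {ffun 'I_m -> bool}.
Variable mu : probability torus R.
Hypothesis mu_haar : haar (@circle_mul R) mu.
Implicit Types (c : nat -> X) (m n : nat) (a : multi_index).

Section TrigonometricSums.
Variable a : nat -> multi_index.

Definition tsum m c (z : torus) : X := \sum_(n < m) monomial (a n) z *: c n.

Definition Nt m c : R := N2 mu (tsum m c).

Lemma in_L2_tsum m c : in_Lp mu 2 (tsum m c).
Proof. exact: (@in_L2_monomials _ _ mu 'I_m (fun n : 'I_m => a n) (fun n : 'I_m => c n)). Qed.

Lemma tsumD m c1 c2 z : tsum m (c1 + c2) z = tsum m c1 z + tsum m c2 z.
Proof. by rewrite /tsum -big_split; apply: eq_bigr => n _; rewrite /= scalerDr. Qed.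

Lemma tsumZ m (k : C) c z : tsum m (k *: c) z = k *: tsum m c z.
Proof. by rewrite /tsum scaler_sumr; apply: eq_bigr => n _; rewrite /= !scalerA mulrC. Qed.

Lemma Nt_seminorm m : seminorm (Nt m).
Proof.
split=> [c1 c2|k c].
  apply: le_trans (N2D (in_L2_tsum m c1) (in_L2_tsum m c2)).2.
  by rewrite le_eqVlt; apply/orP; left; apply/eqP; congr N2; apply/funext => z; rewrite tsumD.
have Lc := in_L2_tsum m c; have Lk := in_L2_tsum m (k *: c).
apply/eqP; rewrite eq_le; apply/andP; split.
  apply: (in_L2_le Lk.1 Lc (cabs_ge0 k) _).2 => z.
  by rewrite tsumZ rnormZ.
have [->|k0] := eqVneq k 0; first by rewrite (cabs_real 0) normr0 mul0r N2_ge0.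
have kp : 0 < cabs k by rewrite lt_def cabs_eq0 k0 cabs_ge0.
rewrite -ler_pdivlMl//; apply: (in_L2_le Lc.1 Lk _ _).2; first by rewrite invr_ge0 cabs_ge0.
by move=> z; rewrite tsumZ rnormZ mulrA mulVf ?mul1r// lt0r_neq0.
Qed.

End TrigonometricSums.

Notation dpoly := (tsum ix).
Notation Nd := (Nt ix).

Lemma fourier_dpoly m c a :
  fourier_coef mu (dpoly m c) a = \sum_(n < m | ix n == a) c n.
Proof.
have -> : dpoly m c = tpoly [seq (ix n, c n) | n : 'I_m <- index_enum 'I_m].
  by apply/funext => z; rewrite /tpoly big_map.
by rewrite fourier_tpoly// big_map.
Qed.

Lemma fourier_dpoly_ix m c n : fourier_coef mu (dpoly m c) (ix n) = if (n < m)%N then c n else 0.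
Proof.
rewrite fourier_dpoly; case: ltnP => [nm|mn].
  by rewrite (big_pred1 (Ordinal nm)) => // i; rewrite (inj_eq ix_inj).
by rewrite big_pred0 => // i; rewrite (inj_eq ix_inj); apply: ltn_eqF; apply: leq_trans mn.
Qed.

Lemma fourier_dpoly_neg m c a : ~ nonneg_index a -> fourier_coef mu (dpoly m c) a = 0.
Proof.
move=> na; rewrite fourier_dpoly big_pred0// => n; apply/eqP => na'; apply: na.
by rewrite -na'; exact: ix_nonneg.
Qed.

Lemma bohr_lift_ix (D : nat -> X) (f : torus -> X) : in_Lp mu 2 f ->
  (forall n, fourier_coef mu f (ix n) = D n) ->
  (forall a, ~ nonneg_index a -> fourier_coef mu f a = 0) -> bohr_lift mu 2 D f.
Proof. by move=> Lf fD f0; split=> // a /nat_of_indexK {1}<-. Qed.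

Lemma bohr_lift_coef (D : nat -> X) (f : torus -> X) n :
  bohr_lift mu 2 D f -> fourier_coef mu f (ix n) = D n.
Proof. by move=> [_ ->]; [rewrite ixK|exact: ix_nonneg]. Qed.

Lemma bohr_lift_dpoly m c : (forall n, (m <= n)%N -> c n = 0) -> bohr_lift mu 2 c (dpoly m c).
Proof.
move=> c0; apply: bohr_lift_ix => [|n|a]; [exact: in_L2_tsum| |exact: fourier_dpoly_neg].
by rewrite fourier_dpoly_ix; case: ltnP => // /c0.
Qed.

Lemma HDnorm_lift (D : nat -> X) (f : torus -> X) : bohr_lift mu 2 D f -> HDnorm mu 2 D = N2 mu f.
Proof.
move=> lf; have H (g : torus -> X) : bohr_lift mu 2 D g -> N2 mu g = N2 mu f.
  move=> lg; apply: (fourier_eq_N2 lg.1.1 lf.1.1) => a.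
  have [na|na] := pselect (nonneg_index a); first by rewrite lg.2 ?lf.2.
  by rewrite lg.1.2 ?lf.1.2.
by apply: H; apply: xgetPex; exists f.
Qed.

Lemma HDnorm_dpoly m c : (forall n, (m <= n)%N -> c n = 0) -> HDnorm mu 2 c = Nd m c.
Proof. by move=> c0; apply: HDnorm_lift; exact: bohr_lift_dpoly. Qed.

Lemma dirichlet_term_sum (x : nat -> X) m (b : 'I_m -> C) n :
  (\sum_(i < m) b i *: dirichlet_term x i) n =
  \sum_(i < m | n == i :> nat) b i *: x n.
Proof.
rewrite fct_sumE [RHS]big_mkcond; apply: eq_bigr => i _.
rewrite -[LHS]/(b i *: dirichlet_term x i n) /dirichlet_term.
by case: eqP => [->//|_]; rewrite scaler0.
Qed.

Lemma dirichlet_term_sum0 (x : nat -> X) m (b : 'I_m -> C) n : (m <= n)%N ->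
  (\sum_(i < m) b i *: dirichlet_term x i) n = 0.
Proof.
move=> mn; rewrite dirichlet_term_sum big_pred0// => i.
by apply/eqP => ni; move: (ltn_ord i); rewrite -ni ltnNge mn.
Qed.

Lemma dirichlet_term_sumE (x : nat -> X) m (b : 'I_m -> C) (n : 'I_m) :
  (\sum_(i < m) b i *: dirichlet_term x i) n = b n *: x n.
Proof. by rewrite dirichlet_term_sum (big_pred1 n)// => i; rewrite eq_sym. Qed.

(** The unconditionality inequality, read on the Hardy norms of Dirichlet
    polynomials instead of the abstract norm of their Bohr lifts. *)
Lemma RUC_dirichlet (x : nat -> X) : RUC (HDnorm mu 2) (dirichlet_term x) <->
  exists K : R, forall m (b : 'I_m -> C),
    avg (fun e : cube m => Nd m (rsum e (fun n : 'I_m => b n *: dirichlet_term x n))) <=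
    K * Nd m (\sum_(n < m) b n *: dirichlet_term x n).
Proof.
have E m (b : 'I_m -> C) (e : cube m) : HDnorm mu 2 (\sum_(n < m) ((-1) ^+ (e n) * b n) *: dirichlet_term x n) =
    Nd m (rsum e (fun n : 'I_m => b n *: dirichlet_term x n)).
  rewrite (@HDnorm_dpoly m) => [|n mn]; last exact: dirichlet_term_sum0.
  by congr Nd; apply: eq_bigr => n _; rewrite scalerA.
have E1 m (b : 'I_m -> C) : HDnorm mu 2 (\sum_(n < m) b n *: dirichlet_term x n) =
    Nd m (\sum_(n < m) b n *: dirichlet_term x n).
  by apply: HDnorm_dpoly => n mn; exact: dirichlet_term_sum0.
split=> -[K HK]; exists K => m b; have := HK m b.
  by rewrite Esign_avg E1 (eq_avg (E m b)).
by rewrite Esign_avg E1 (eq_avg (E m b)).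
Qed.

Lemma type2_RUC (x : nat -> X) : type2 X -> RUC (HDnorm mu 2) (dirichlet_term x).
Proof.
move=> /(type2_ruc mu_haar)[K K0 HK]; apply/RUC_dirichlet; exists (Num.sqrt K) => m b.
pose u : nat -> X := \sum_(n < m) b n *: dirichlet_term x n.
rewrite -/u; have := HK m (fun n : 'I_m => ix n) (fun n : 'I_m => b n *: x n) (inj_comp ix_inj val_inj).
set f := (fun z => \sum_(i < m) _); have -> : f = dpoly m u.
  by apply/funext => z; apply: eq_bigr => n _; rewrite /u dirichlet_term_sumE.
rewrite (@eq_avg _ _ _ (fun e => Nd m (rsum e (fun n : 'I_m => b n *: dirichlet_term x n)) ^+ 2)); last first.
  move=> e; congr (_ ^+ 2); congr N2; apply/funext => z; apply: eq_bigr => n _.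
  have -> : rsum e (fun n : 'I_m => b n *: dirichlet_term x n) n = ((-1) ^+ e n * b n) *: x n.
    rewrite -(dirichlet_term_sumE x (fun i => (-1) ^+ e i * b i)); congr (_ (val n)).
    by apply: eq_bigr => i _; rewrite scalerA.
  by rewrite !scalerA mulrCA mulrA.
move=> H; apply: (le_trans (y := Num.sqrt (K * Nd m u ^+ 2))); last first.
  by rewrite sqrtrM// sqrtr_sqr ger0_norm// N2_ge0.
have A0 : 0 <= avg (fun e : cube m => Nd m (rsum e (fun n : 'I_m => b n *: dirichlet_term x n))).
  by apply: avg_ge0 => e; exact: N2_ge0.
rewrite -[leLHS]ger0_norm// -sqrtr_sqr ler_wsqrtr//.
exact: le_trans (avg_sqr_le _) H.
Qed.

End DirichletPolynomials.

Section RandomProjection.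
Context {R : realType} {X : completeNormedModType R[i]}.
Notation C := R[i].
Notation torus := (polytorus R).
Notation cube m := {ffun 'I_m -> bool}.
Variable mu : probability torus R.
Hypothesis mu_haar : haar (@circle_mul R) mu.
Variable P : probability signs R.
Hypothesis P_haar : haar addb P.
Implicit Types (c : nat -> X) (m n : nat) (l : seq (multi_index * X)).

Notation dpoly := (tsum ix).
Notation Nd := (Nt mu ix).

Definition twist (eps : signs) c : nat -> X := fun n => (-1) ^+ (eps n) *: c n.

Lemma measurable_first_signs m (h : cube m -> R) :
  measurable_fun setT (fun eps => h (first_signs m eps)).
Proof.
move=> _ A _; rewrite setTI.
exact: (pwcst_preimage [set e | A (h e)] (first_signs_pwcst m)).
Qed.

Lemma Nd_twist m c : exists h : cube m -> R, forall eps, Nd m (twist eps c) = h (first_signs m eps).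
Proof.
exists (fun e => Nd m (fun n => (-1) ^+ (extend_signs e n) *: c n)) => eps.
congr N2; apply/funext => z; apply: eq_bigr => n _; congr (_ *: (_ ^+ _ *: _)).
by rewrite extend_signsE ffunE.
Qed.

Lemma measurable_Nd_twist m c : measurable_fun setT (fun eps => Nd m (twist eps c)).
Proof.
have [h hE] := Nd_twist m c.
by under eq_fun do rewrite hE; exact: measurable_first_signs.
Qed.

Lemma tsum_widen m m' (a : nat -> multi_index) c : (m <= m')%N -> (forall n, (m <= n)%N -> c n = 0) ->
  tsum (R := R) a m' c = tsum a m c.
Proof.
move=> mm' c0; apply/funext => z; rewrite /tsum (@big_ord_widen _ _ _ m m' (fun n => monomial (a n) z *: c n))//.
rewrite [RHS]big_mkcond; apply: eq_bigr => n _; case: ltnP => // /c0 ->.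
by rewrite scaler0.
Qed.

(** In type 2 spaces, randomly signing the analytic part of a trigonometric
    polynomial is bounded on average: the signs on the whole spectrum are
    controlled by the type, and those outside the analytic part can be dropped by
    contraction. *)
Lemma random_projection : type2 X -> exists2 K : R, 0 <= K & forall l m,
  (forall b, b \in map fst l -> nonneg_index b -> (nat_of_index b <= m)%N) ->
  (\int[P]_eps (Nd m (twist eps (fun n => fourier_coef mu (tpoly l) (ix n))))%:E
    <= (K * N2 mu (tpoly l))%:E)%E.
Proof.
move=> /(type2_ruc mu_haar)[K K0 HK]; exists (Num.sqrt K) => [|l m lm]; first exact: sqrtr_ge0.
pose t := [seq ix n | n <- iota 0 m] ++ [seq b <- undup (map fst l) | ~~ `[< nonneg_index b >]].
pose a n := nth idx0 t n; pose M := size t.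
have sz0 : size [seq ix n | n <- iota 0 m] = m by rewrite size_map size_iota.
have mM : (m <= M)%N by rewrite /M size_cat sz0 leq_addr.
have a_ix n : (n < m)%N -> a n = ix n.
  by move=> nm; rewrite /a nth_cat sz0 nm (nth_map 0%N) ?size_iota// nth_iota.
have ut : uniq t.
  rewrite cat_uniq map_inj_uniq ?iota_uniq; last exact: ix_inj.
  rewrite filter_uniq ?undup_uniq// andbT /=; apply/hasPn => b.
  rewrite mem_filter => /andP[/asboolPn nb _]; apply/negP => /mapP[n _ bE]; apply: nb.
  by rewrite bE; exact: ix_nonneg.
have lt : {subset map fst l <= t}.
  move=> b bl; rewrite mem_cat mem_filter mem_undup bl andbT.
  case: (pselect (nonneg_index b)) => [nb|/asboolPn ->]; last by rewrite orbT.
  rewrite -[b]nat_of_indexK// map_f// mem_iota /= add0n prednK ?nat_of_index_gt0//.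
  exact: lm.
have a_inj : injective (fun i : 'I_M => a i).
  by move=> i j /eqP; rewrite nth_uniq// => /eqP/val_inj.
pose x n := fourier_coef mu (tpoly l) (a n).
have := HK M (fun i : 'I_M => a i) (fun i : 'I_M => x i) a_inj.
have -> : (fun z => \sum_(i < M) monomial (a i) z *: x i) = tpoly l.
  apply/funext => z; rewrite (tpoly_fourier mu_haar z ut lt) (big_nth idx0) big_mkord.
  by [].
rewrite (@eq_avg _ _ _ (fun e : cube M => Nt mu a M (rsum e (fun i : 'I_M => dirichlet_term x i)) ^+ 2)); last first.
  move=> e; congr (_ ^+ 2); congr N2; apply/funext => z; apply: eq_bigr => i _.
  have -> : rsum e (fun i : 'I_M => dirichlet_term x i) i = (-1) ^+ e i *: x i.
    exact: (dirichlet_term_sumE x (fun i => (-1) ^+ e i)).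
  by rewrite !scalerA mulrC.
set A := avg _ => HA.
pose h (e : cube M) := Nt mu a M (rsum e (fun i : 'I_M => ((val i < m)%N%:R)%:C *: dirichlet_term x i)).
have Hh : avg (fun e => h e ^+ 2) <= A.
  apply: (contraction (fun i : 'I_M => dirichlet_term x i) (Nt_seminorm mu a M) jensen_sqr) => i.
  by case: (_ < _)%N; rewrite ?normr0 ?normr1.
have E eps : Nd m (twist eps (fun n => fourier_coef mu (tpoly l) (ix n))) = h (first_signs M eps).
  congr N2; apply/funext => z; rewrite /tsum.
  rewrite (@big_ord_widen _ _ _ m M (fun n => monomial (ix n) z *: twist eps (fun n => fourier_coef mu (tpoly l) (ix n)) n))//.
  rewrite big_mkcond; apply: eq_bigr => i _.
  have -> : rsum (first_signs M eps) (fun i : 'I_M => ((val i < m)%N%:R)%:C *: dirichlet_term x i) i =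
     ((-1) ^+ eps i * ((val i < m)%N%:R)%:C) *: x i.
    rewrite -(dirichlet_term_sumE x (fun i : 'I_M => (-1) ^+ eps i * ((val i < m)%N%:R)%:C)).
    by congr (_ (val i)); apply: eq_bigr => j _; rewrite scalerA ffunE.
  case: ltnP => im; last by rewrite mulr0 scale0r scaler0.
  by rewrite mulr1 /x a_ix.
under eq_integral do rewrite E.
rewrite (integral_first_signs P_haar) => [|e]; last exact: N2_ge0.
rewrite lee_fin; apply: (le_trans (y := Num.sqrt (K * N2 mu (tpoly l) ^+ 2))); last first.
  by rewrite sqrtrM// sqrtr_sqr ger0_norm// N2_ge0.
have h0 : 0 <= avg h by apply: avg_ge0 => e; exact: N2_ge0.
rewrite -[leLHS]ger0_norm// -sqrtr_sqr ler_wsqrtr//.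
by apply: le_trans (avg_sqr_le _) _; exact: le_trans HA.
Qed.

End RandomProjection.

Section TypeToRad.
Context {R : realType} {X : completeNormedModType R[i]}.
Notation C := R[i].
Notation torus := (polytorus R).
Variable mu : probability torus R.
Hypothesis mu_haar : haar (@circle_mul R) mu.
Variable P : probability signs R.
Hypothesis P_haar : haar addb P.
Implicit Types (c : nat -> X) (m n : nat) (l : seq (multi_index * X)).

Notation dpoly := (tsum ix).
Notation Nd := (Nt mu ix).

Definition tdeg l : nat := \max_(p <- l) nat_of_index p.1.

Lemma tdegP l b : b \in map fst l -> (nat_of_index b <= tdeg l)%N.
Proof. by move=> /mapP[p pl ->]; exact: leq_bigmax_seq. Qed.

Definition tneg l : seq (multi_index * X) := [seq (p.1, - p.2) | p <- l].

Lemma tpoly_neg l (z : torus) : tpoly (tneg l) z = - tpoly l z.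
Proof. by rewrite /tpoly big_map -sumrN; apply: eq_bigr => p _; rewrite scalerN. Qed.

Lemma tdeg_cat_neg l1 l2 : tdeg (l1 ++ tneg l2) = maxn (tdeg l1) (tdeg l2).
Proof. by rewrite /tdeg big_cat big_map. Qed.

Lemma fourier_tdeg l n : (tdeg l <= n)%N -> fourier_coef mu (tpoly l) (ix n) = 0.
Proof.
move=> ln; rewrite fourier_tpoly// big_seq_cond big_pred0// => p.
apply/negP => /andP[pl /eqP pn].
by have := leq_trans (tdegP (map_f fst pl)) ln; rewrite pn ixK ltnn.
Qed.

Lemma geometric_sum n : \sum_(k < n) (2 ^+ k)^-1 <= 2 :> R.
Proof.
suff -> : \sum_(k < n) (2 ^+ k)^-1 = 2 - 2 * (2 ^+ n)^-1 :> R.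
  by rewrite gerBl mulr_ge0// invr_ge0 exprn_ge0.
elim: n => [|n IH]; first by rewrite big_ord0 expr0 invr1 mulr1 subrr.
by rewrite big_ord_recr/= IH exprS; field; rewrite expf_neq0.
Qed.

Lemma small_eq (x y : X) : (forall e : R, 0 < e -> rnorm (x - y) <= e) -> x = y.
Proof.
move=> H; apply/eqP; rewrite -subr_eq0; apply/eqP/rnorm_eq0/eqP; rewrite eq_le rnorm_ge0 andbT.
by apply/ler_addgt0Pr => e e0; rewrite add0r; exact: H.
Qed.

Lemma type2_rad (D : nat -> X) : type2 X -> in_HDp mu 2 D -> in_HDrad mu P 2 D.
Proof.
move=> /(random_projection mu_haar P_haar)[K K0 HK] [f lf]; have Lf : in_Lp mu 2 f := lf.1.1.
have /boolp.choice[l lE] k : exists l, N2 mu (fun z => f z - tpoly l z) <= (2 ^+ k)^-1.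
  by apply: (approximable_L2 Lf).2; rewrite invr_gt0 exprn_gt0.
pose c k n := fourier_coef mu (tpoly (l k)) (ix n).
have c0 k n : (tdeg (l k) <= n)%N -> c k n = 0 by exact: fourier_tdeg.
pose d k := l k.+1 ++ tneg (l k).
have dE k z : tpoly (d k) z = tpoly (l k.+1) z - tpoly (l k) z by rewrite tpoly_cat tpoly_neg.
have Ll k := in_L2_tpoly mu (l k).
have dN k : N2 mu (tpoly (d k)) <= 2 * (2 ^+ k)^-1.
  rewrite (_ : tpoly (d k) = fun z => tpoly (l k.+1) z - tpoly (l k) z); last exact/funext.
  apply: le_trans (N2_tri (Ll k.+1) Lf (Ll k)) _.
  have := lE k.+1; have := lE k; have := (in_L2N (N2B Lf (Ll k.+1)).1).2.
  under [X in N2 _ X = _ -> _]eq_fun do rewrite opprB.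
  move=> ->; rewrite exprS invfM; have : 0 < (2 ^+ k)^-1 :> R by rewrite invr_gt0 exprn_gt0.
  by move: (2 ^+ k)^-1 => q; lra.
pose S (eps : signs) k := dpoly (tdeg (l k)) (twist eps (c k)).
have LS eps k : in_Lp mu 2 (S eps k) by exact: in_L2_tsum.
pose m k := tdeg (d k).
have SE eps k : (fun z => S eps k.+1 z - S eps k z) =
    dpoly (m k) (twist eps (fun n => fourier_coef mu (tpoly (d k)) (ix n))).
  have tw0 k' n : (tdeg (l k') <= n)%N -> twist eps (c k') n = 0.
    by move=> /c0 ckn; rewrite /twist ckn scaler0.
  rewrite /S -(@tsum_widen _ _ _ (m k) _ _ _ (@tw0 k.+1)); last by rewrite /m tdeg_cat_neg leq_maxl.
  rewrite -(@tsum_widen _ _ _ (m k) _ _ _ (@tw0 k)); last by rewrite /m tdeg_cat_neg leq_maxr.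
  apply/funext => z; rewrite /tsum -sumrB; apply: eq_bigr => n _; rewrite -scalerBr /twist -scalerBr.
  rewrite /c -(fourierB (ix n) (Ll k.+1) (Ll k)); congr (_ *: (_ *: fourier_coef _ _ _)).
  by apply/funext => z'; rewrite dE.
pose g k eps := N2 mu (fun z => S eps k.+1 z - S eps k z).
have gE k : g k = fun eps => Nd (m k) (twist eps (fun n => fourier_coef mu (tpoly (d k)) (ix n))).
  by apply/funext => eps; rewrite /g SE.
have [|k eps|n|N [mN N0 HN]] := @ae_summable R _ _ P g (4 * K).
- by move=> k; rewrite gE; exact: measurable_Nd_twist.
- exact: N2_ge0.
- apply: (@le_trans _ _ (\sum_(k < n) (K * (2 * (2 ^+ k)^-1))%:E)%E).
    apply: lee_sum => k _; rewrite gE; apply: le_trans (HK (d k) (m k) _) _.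
      by move=> b /tdegP.
    by rewrite lee_fin ler_wpM2l.
  rewrite sumEFin lee_fin -!mulr_sumr; have := geometric_sum n.
  by move: K0; nra.
exists N; split=> // eps /= neps; apply: contrapT => /HN[B HB]; apply: neps.
have [F [LF FS]] := riesz_fischer (LS eps) HB.
have coef (a : multi_index) e : 0 < e -> exists n0, forall n, (n0 <= n)%N ->
    rnorm (fourier_coef mu F a - fourier_coef mu (S eps n) a) <= e.
  move=> e0; have [n0 H] := FS _ e0; exists n0 => n nn0.
  by rewrite -fourierB//; apply: le_trans (H _ nn0); apply: fourier_le; exact: (N2B LF (LS eps n)).1.
exists F; apply: bohr_lift_ix => // [n|a na].
  apply: small_eq => e e0; have e2 : 0 < e / 2 by rewrite divr_gt0.
  have [n0 H] := coef (ix n) _ e2.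
  have [k [kn0 ke]] : exists k, (n0 <= k)%N /\ (2 ^+ k)^-1 <= e / 2.
    exists (maxn n0 (Num.truncn (e / 2)^-1).+1); split; first exact: leq_maxl.
    rewrite invf_ple ?posrE ?exprn_gt0//; apply: ltW; apply: (lt_le_trans (truncnS_gt _)).
    by rewrite -natrX ler_nat; apply: leq_trans (leq_maxr n0 _) _; exact/ltnW/ltn_expl.
  have SC : fourier_coef mu (S eps k) (ix n) = (-1) ^+ (eps n) *: c k n.
    by rewrite fourier_dpoly_ix//; case: ltnP => // /c0 ->; rewrite scaler0.
  have := H _ kn0; rewrite SC => H1.
  rewrite -(subrKA ((-1) ^+ eps n *: c k n)) (splitr e).
  apply: le_trans (rnormD _ _) _; apply: lerD => //.
  rewrite -scalerBr rnormZ cabs_sign mul1r rnormB -(bohr_lift_coef n lf) -fourierB//.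
  by apply: le_trans ke; apply: le_trans (lE k); apply: fourier_le; exact: (N2B Lf (Ll k)).1.
apply: small_eq => e e0; have [n0 H] := coef a _ e0.
by have := H n0 (leqnn n0); rewrite fourier_dpoly_neg.
Qed.

End TypeToRad.

Section Parseval.
Context {R : realType}.
Notation C := R[i].
Notation torus := (polytorus R).
Variable mu : probability torus R.
Hypothesis mu_haar : haar (@circle_mul R) mu.

Definition tpolyC (I : finType) (a : I -> multi_index) (b : I -> C) (z : torus) : C :=
  \sum_i b i * monomial (a i) z.

Lemma measurable_tpolyC (I : finType) (a : I -> multi_index) (b : I -> C) :
  measurable_fun setT (fun z => cabs (tpolyC a b z)).
Proof.
apply: (@measurable_rnorm _ C^o _ _ (tpolyC a b)); apply: strongly_measurable_sum => i.
apply: strongly_measurable_mul; first exact: strongly_measurable_cst.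
exact: strongly_measurable_monomial.
Qed.

Lemma conjc_sum (I : finType) (F : I -> C) : conjc (\sum_i F i) = \sum_i conjc (F i).
Proof. exact: rmorph_sum. Qed.

Lemma conjcM (a b : C) : conjc (a * b) = conjc a * conjc b.
Proof. exact: rmorphM. Qed.

Lemma parseval_points (I : finType) (a : I -> multi_index) (b : I -> C) n (rho : 'I_n.+1 -> torus) :
  (forall i i', \sum_j monomial (idx_add (a i) (idx_opp (a i'))) (rho j) =
     if i == i' then n.+1%:R else 0) ->
  forall z, avg (fun j => cabs (tpolyC a b (rot (rho j) z)) ^+ 2) = \sum_i cabs (b i) ^+ 2.
Proof.
move=> orth z; apply: complexI; rewrite /avg card_ord realCM realCV realC_nat.
have n0 : n.+1%:R != 0 :> C by rewrite pnatr_eq0.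
apply: (mulfI n0); rewrite mulrA divff// mul1r.
transitivity (\sum_j tpolyC a b (rot (rho j) z) * conjc (tpolyC a b (rot (rho j) z))).
  by rewrite [LHS]rmorph_sum; apply: eq_bigr => j _; rewrite mul_conjc.
transitivity (\sum_i \sum_i' (b i * monomial (a i) z * conjc (b i' * monomial (a i') z)) *
    \sum_j monomial (idx_add (a i) (idx_opp (a i'))) (rho j)).
  under [RHS]eq_bigr do under eq_bigr do rewrite mulr_sumr.
  under [RHS]eq_bigr do rewrite exchange_big.
  rewrite [RHS]exchange_big; apply: eq_bigr => j _.
  rewrite conjc_sum /tpolyC big_distrlr; apply: eq_bigr => i _; apply: eq_bigr => i' _ /=.
  rewrite monomial_add monomial_opp !monomial_rot !conjcM !(conjc_unit (monomial_cabs _ _)).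
  ring.
rewrite [X in _ = _ * X]rmorph_sum mulr_sumr; apply: eq_bigr => i _ /=.
rewrite (bigD1 i)//= orth eqxx big1 ?addr0 => [|i' /negPf ii']; last by rewrite orth eq_sym ii' mulr0.
by rewrite mul_conjc cabsM monomial_cabs mulr1 mulrC.
Qed.

Lemma parseval (I : finType) (a : I -> multi_index) (b : I -> C) : injective a ->
  (\int[mu]_z (cabs (tpolyC a b z) ^+ 2)%:E = (\sum_i cabs (b i) ^+ 2)%:E)%E.
Proof.
move=> a_inj; have [n [rho orth]] := @orthogonal_points R _ a a_inj.
pose f (z : torus) : C^o := tpolyC a b z.
have Lf : in_Lp mu 2 f.
  rewrite (_ : f = fun z => \sum_i monomial (a i) z *: (b i : C^o)); last first.
    by apply/funext => z; apply: eq_bigr => i _; rewrite /GRing.scale /= mulrC.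
  have := @in_L2_sum _ C^o _ _ mu I (index_enum I) xpredT (fun i z => monomial (a i) z *: (b i : C^o)).
  by move=> H; apply: (H _).1 => i; exact: (@in_L2_monomial _ mu C^o).
have mf : measurable_fun setT (fun z => rnorm (f z) ^+ 2).
  by apply: measurable_funX; exact: measurable_tpolyC.
have Lrot j := in_L2_rot mu_haar (rho j) Lf.
have := integral_avg (mu := mu) (F := fun j z => rnorm (f (rot (rho j) z)) ^+ 2)
  (fun j => measurable_funX _ (measurable_rnorm (Lrot j).1.1)) (fun j z => sqr_ge0 _) (fun j => N2_sqr (Lrot j).1).
rewrite (@eq_avg _ _ _ (fun=> N2 mu f ^+ 2)) => [|j]; last by rewrite (Lrot j).2.
rewrite (avg_cst ord0) -N2_sqr// /I2 /f => <-.
under eq_integral do rewrite (parseval_points b orth).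
by rewrite integral_cst// [X in (_ * X)%E]probability_setT mule1.
Qed.

End Parseval.

Section FejerBlocks.
Context {R : realType}.
Notation C := R[i].
Notation torus := (polytorus R).
Variable mu : probability torus R.
Hypothesis mu_haar : haar (@circle_mul R) mu.

Lemma integral_sum_fin (T : finType) (F : T -> torus -> R) (c : T -> R) :
  (forall t, measurable_fun setT (F t)) -> (forall t z, 0 <= F t z) ->
  (forall t, \int[mu]_z (F t z)%:E = (c t)%:E)%E ->
  (\int[mu]_z (\sum_t F t z)%:E = (\sum_t c t)%:E)%E.
Proof.
move=> mF F0 Fc; under eq_integral do rewrite -sumEFin.
rewrite ge0_integral_sum//.
- by under eq_bigr do rewrite Fc; rewrite sumEFin.
- by move=> t; exact/measurable_EFinP.
- by move=> t z _; rewrite lee_fin.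
Qed.

Definition fejer_coef (m d : nat) : R :=
  m%:R^-1 * \sum_(st : 'I_m * 'I_m) (st.1 + st.2 == d)%N%:R.

Lemma fejer_factor m (w : C) : (0 < m)%N ->
  \sum_(d < m.*2) (fejer_coef m d)%:C * w ^+ d = (m%:R^-1 : R)%:C * (\sum_(s < m) w ^+ s) ^+ 2.
Proof.
move=> m0; rewrite expr2 big_distrlr /= -(sum_pair (fun st : 'I_m * 'I_m => w ^+ st.1 * w ^+ st.2)) /=.
transitivity (\sum_(d < m.*2) \sum_(st : 'I_m * 'I_m)
    (m%:R^-1 : R)%:C * ((st.1 + st.2 == d)%N%:R * (w ^+ st.1 * w ^+ st.2))).
  apply: eq_bigr => d _; rewrite /fejer_coef realCM -mulrA -mulr_sumr; congr (_ * _).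
  rewrite [X in X * _]rmorph_sum mulr_suml; apply: eq_bigr => st _ /=.
  by rewrite -exprD realC_nat; case: eqP => [->//|_]; rewrite !mul0r.
rewrite exchange_big mulr_sumr; apply: eq_bigr => st _ /=; rewrite -mulr_sumr; congr (_ * _).
have std : (st.1 + st.2 < m.*2)%N by rewrite -addnn -addSn; apply: leq_add => //; exact: ltnW.
rewrite (bigD1 (Ordinal std))//= eqxx mul1r big1 ?addr0// => d dne.
by case: eqP => [sd|_]; [case/eqP: dne; exact: val_inj|rewrite mul0r].
Qed.

Lemma fejer_energy m : (0 < m)%N -> m%:R / 2 <= \sum_(d < m.*2) fejer_coef m d ^+ 2 :> R.
Proof.
move=> m0; have mR : 0 < m%:R :> R by rewrite ltr0n.
have tot : \sum_(d < m.*2) fejer_coef m d = m%:R :> R.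
  apply: (@complexI R); have := fejer_factor (1 : C) m0.
  under eq_bigr do rewrite expr1n mulr1.
  under [in RHS]eq_bigr do rewrite expr1n.
  rewrite sumr_const card_ord -realC_nat -realCX -realCM expr2 mulrA mulVf ?lt0r_neq0// mul1r => <-.
  by rewrite rmorph_sum.
have := avg_sqr_le (fun d : 'I_(m.*2) => fejer_coef m d); rewrite /avg card_ord tot -mul2n natrM.
set L := \sum_d _ => H.
have -> : L = 2 * m%:R * ((2 * m%:R)^-1 * L) by field; rewrite lt0r_neq0.
apply: le_trans (ler_wpM2l _ H); last by rewrite mulr_ge0// ltW.
by rewrite le_eqVlt; apply/orP; left; apply/eqP; field; rewrite lt0r_neq0.
Qed.

Lemma fejer_coef_ge0 m d : 0 <= fejer_coef m d.
Proof. by rewrite mulr_ge0 ?invr_ge0 ?sumr_ge0. Qed.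

Definition blk (r d : nat) : multi_index :=
  mkidx r.*2.+2 (fun i => if i == r.*2.+1 then 1 else if i == r.*2 then d%:Z else 0).

Lemma blkE r d i : blk r d i = if i == r.*2.+1 then 1 else if i == r.*2 then d%:Z else 0.
Proof.
rewrite mkidxE; case: ltnP => // ri; case: eqP => [ir|_]; first by rewrite ir ltnn in ri.
by case: eqP => // ir; rewrite ir ltnNge leqnSn in ri.
Qed.

Lemma blk_nonneg r d : nonneg_index (blk r d).
Proof. by move=> i; rewrite blkE; case: eqP => // _; case: eqP. Qed.

Lemma monomial_blk r d (z : torus) : monomial (blk r d) z = sval (z r.*2.+1) * sval (z r.*2) ^+ d.
Proof.
rewrite (@monomialE _ r.*2.+2) => [|i ri]; last by rewrite mkidxE ltnNge ri.
rewrite !big_ord_recr /= !blkE eqxx (_ : (_ == _.+1) = false) ?eqxx; last by rewrite ltn_eqF.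
rewrite big1 ?mul1r => [|i _]; first by rewrite expr1z exprnP mulrC.
by rewrite blkE !ltn_eqF// ?expr0z//; apply: ltn_trans (ltn_ord i) _.
Qed.

Lemma blk_inj r r' d d' : blk r d = blk r' d' -> r = r' /\ d = d'.
Proof.
move=> H; have := congr1 (fun a : multi_index => a r.*2.+1) H.
rewrite /= !blkE eqxx eqSS; case: eqP => [/double_inj rr' _|_]; last first.
  by case: eqP => // /(congr1 odd) /=; rewrite !odd_double.
split=> //; have := congr1 (fun a : multi_index => a r.*2) H.
by rewrite /= !blkE -rr' eqxx (_ : (_ == _.+1) = false); [case|rewrite ltn_eqF].
Qed.

Definition two_idx (p q s t : nat) : multi_index :=
  mkidx (maxn p q).+1 (fun i => if i == p then s%:Z else if i == q then t%:Z else 0).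

Lemma two_idxE p q s t i : two_idx p q s t i = if i == p then s%:Z else if i == q then t%:Z else 0.
Proof.
rewrite mkidxE ltnS; case: leqP => //; rewrite gtn_max => /andP[pi qi].
by rewrite !gtn_eqF.
Qed.

Lemma monomial_two_idx p q s t (z : torus) : p != q ->
  monomial (two_idx p q s t) z = sval (z p) ^+ s * sval (z q) ^+ t.
Proof.
move=> pq; rewrite (@monomialE _ (maxn p q).+1) => [|i ri]; last by rewrite mkidxE ltnNge ri.
have pm : (p < (maxn p q).+1)%N by rewrite ltnS leq_maxl.
have qm : (q < (maxn p q).+1)%N by rewrite ltnS leq_maxr.
rewrite (bigD1 (Ordinal pm))//= (bigD1 (Ordinal qm))/=; last by rewrite -val_eqE /= eq_sym.
rewrite !two_idxE eqxx eq_sym (negPf pq) eqxx big1 ?mulr1// => i /andP[].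
by rewrite -!val_eqE /= => /negPf ip /negPf iq; rewrite two_idxE ip iq expr0z.
Qed.

Lemma two_idx_inj p q s t s' t' : p != q -> two_idx p q s t = two_idx p q s' t' -> s = s' /\ t = t'.
Proof.
move=> pq H; split.
  by have := congr1 (fun a : multi_index => a p) H; rewrite /= !two_idxE eqxx => -[].
have := congr1 (fun a : multi_index => a q) H.
by rewrite /= !two_idxE eqxx eq_sym (negPf pq) => -[].
Qed.

Section Correlations.
Variable m : nat.
Hypothesis m0 : (0 < m)%N.

Definition fejer (r : nat) (z : torus) : R :=
  cabs (tpolyC (fun d : 'I_m.*2 => blk r d) (fun d => (fejer_coef m d)%:C) z).

Lemma fejerE r z : fejer r z = m%:R^-1 * cabs (\sum_(s < m) sval (z r.*2) ^+ s) ^+ 2.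
Proof.
transitivity (cabs (sval (z r.*2.+1) * \sum_(d < m.*2) (fejer_coef m d)%:C * sval (z r.*2) ^+ d)).
  congr cabs; rewrite mulr_sumr; apply: eq_bigr => d _.
  by rewrite monomial_blk mulrCA.
by rewrite cabsM circle_cabs mul1r fejer_factor// cabsM cabs_real cabsX ger0_norm// invr_ge0.
Qed.

Lemma fejer_sqr r : (\int[mu]_z (fejer r z * fejer r z)%:E = (\sum_(d < m.*2) fejer_coef m d ^+ 2)%:E)%E.
Proof.
under eq_integral do rewrite -expr2.
rewrite (parseval mu_haar); last by move=> d d' /blk_inj[_ /val_inj].
by congr (_%:E); apply: eq_bigr => d _; rewrite cabs_real ger0_norm// fejer_coef_ge0.
Qed.

Lemma fejer_indep r r' : r != r' -> (\int[mu]_z (fejer r z * fejer r' z)%:E = 1%:E)%E.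
Proof.
move=> rr'; have mR : 0 < m%:R :> R by rewrite ltr0n.
have rr2 : r.*2 != r'.*2 by apply: contra rr' => /eqP/double_inj ->.
pose a (st : 'I_m * 'I_m) := two_idx r.*2 r'.*2 st.1 st.2.
pose b (st : 'I_m * 'I_m) : C := (m%:R^-1 : R)%:C.
have a_inj : injective a by move=> [s t] [s' t'] /(two_idx_inj rr2)/= [/val_inj -> /val_inj ->].
rewrite (@eq_integral _ _ _ _ _ (fun z => (cabs (tpolyC a b z) ^+ 2)%:E)) => [|z _].
  rewrite (parseval mu_haar)//; congr (_%:E).
  rewrite (eq_bigr (fun=> (m%:R^-1) ^+ 2)) => [|st _]; last by rewrite cabs_real ger0_norm ?invr_ge0.
  rewrite sumr_const card_prod card_ord -[_ *+ _]mulr_natl natrM.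
  by field; rewrite lt0r_neq0.
congr (_%:E); rewrite !fejerE.
have -> : tpolyC a b z = (m%:R^-1 : R)%:C *
    ((\sum_(s < m) sval (z r.*2) ^+ s) * (\sum_(s < m) sval (z r'.*2) ^+ s)).
  rewrite /tpolyC big_distrlr -mulr_sumr; congr (_ * _) => /=.
  rewrite -(sum_pair (fun st : 'I_m * 'I_m => sval (z r.*2) ^+ st.1 * sval (z r'.*2) ^+ st.2)).
  by apply: eq_bigr => st _; rewrite monomial_two_idx.
rewrite !cabsM cabs_real ger0_norm ?invr_ge0//; ring.
Qed.

End Correlations.

End FejerBlocks.

Lemma avg_restrict (R : realType) (I J : finType) (iota : I -> J) (F : {ffun I -> bool} -> R) :
  injective iota ->
  avg (fun e : {ffun J -> bool} => F [ffun i => e (iota i)]) = avg F.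
Proof.
move=> inj; pose res (e : {ffun J -> bool}) : {ffun I -> bool} := [ffun i => e (iota i)].
pose ext (d : {ffun I -> bool}) : {ffun J -> bool} :=
  [ffun j => if [pick i | iota i == j] is Some i then d i else false].
have resD d e : res (addc (ext d) e) = addc d (res e).
  apply/ffunP => i; rewrite !ffunE; case: pickP => [i' /eqP/inj ->//|/(_ i)].
  by rewrite eqxx.
transitivity (avg (fun _ : {ffun I -> bool} => avg (fun e => F (res e)))).
  by rewrite (avg_cst [ffun=> true]).
rewrite (@eq_avg _ _ _ (fun d => avg (fun e => F (addc d (res e))))) => [|d]; last first.
  by rewrite -(avg_addc (ext d)); apply: eq_avg => e /=; rewrite resD.
rewrite avg_exchange (@eq_avg _ _ _ (fun=> avg F)) => [|e]; first by rewrite (avg_cst [ffun=> true]).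
rewrite -[RHS](avg_addc (res e)); apply: eq_avg => d; congr F.
by apply/ffunP => i; rewrite !ffunE addbC.
Qed.

Section Blocks.
Context {R : realType} {X : completeNormedModType R[i]}.
Notation C := R[i].
Notation torus := (polytorus R).
Notation cube I := {ffun I -> bool}.
Variable mu : probability torus R.
Hypothesis mu_haar : haar (@circle_mul R) mu.

Definition signed m (e : cube 'I_m) (u : nat -> X) : nat -> X :=
  rsum e (fun n : 'I_m => dirichlet_term u n).

Lemma signedE m (e : cube 'I_m) (u : nat -> X) (n : 'I_m) : signed e u n = (-1) ^+ e n *: u n.
Proof. exact: (dirichlet_term_sumE u (fun n : 'I_m => (-1) ^+ e n)). Qed.

Lemma signed_lower (a : nat -> multi_index) m (u : nat -> X) :
  avg (fun e : cube 'I_m => rnorm (rsum e (fun n : 'I_m => u n)) ^+ 2) <=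
  4 * avg (fun e : cube 'I_m => Nt mu a m (signed e u) ^+ 2).
Proof.
have Ls (e : cube 'I_m) := in_L2_tsum mu a m (signed e u : nat -> X).
have H := integral_avg (mu := mu) (F := fun (e : cube 'I_m) z => rnorm (tsum a m (signed e u) z) ^+ 2)
  (fun e => measurable_funX _ (measurable_rnorm (Ls e).1)) (fun e z => sqr_ge0 _) (fun e => N2_sqr (Ls e)).
rewrite -ler_pdivrMl// -lee_fin -[leRHS]H.
set A := 4^-1 * _; have A0 : 0 <= A by rewrite mulr_ge0 ?invr_ge0// avg_ge0// => e; exact: sqr_ge0.
rewrite -[leLHS]mule1 -[X in (_ * X)%E](probability_setT mu) -integral_cst//.
apply: ge0_le_integral => //.
- by apply/measurable_EFinP; apply: measurable_funM => //; apply: measurable_sum => e;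
    exact: measurable_funX _ (measurable_rnorm (Ls e).1).
move=> z _; rewrite lee_fin /A ler_pdivrMl//.
have mon1 (n : 'I_m) : cabs (monomial (a n) z)^-1 <= 1 by rewrite cabsV monomial_cabs invr1.
have E1 (e : cube 'I_m) : rsum e (fun n : 'I_m => u n) =
    rsum e (fun n : 'I_m => (monomial (a n) z)^-1 *: (monomial (a n) z *: u n)).
  by apply: eq_rsum => n; rewrite scalerA mulVf ?monomial_neq0// scale1r.
have E2 (e : cube 'I_m) : tsum a m (signed e u) z = rsum e (fun n : 'I_m => monomial (a n) z *: u n).
  by apply: eq_bigr => n _; rewrite signedE !scalerA mulrC.
under eq_avg do rewrite E1.
under [X in _ <= _ * X]eq_avg do rewrite E2.
exact: contraction_complex_sqr (@rnorm_seminorm _ X) mon1.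
Qed.

Section Spread.
Variables (I : finType) (nb : I -> nat) (w : I -> X).
Hypothesis nb_inj : injective nb.

Definition spread (n : nat) : X := \sum_(i | nb i == n) w i.

Lemma spread_sum (V : lmodType C) m (F : nat -> X -> V) : (forall i, nb i < m)%N ->
  (forall n, F n 0 = 0) ->
  \sum_(n < m) F n (spread n) = \sum_i F (nb i) (w i).
Proof.
move=> nbm F0; pose b i := Ordinal (nbm i).
have E i : spread (nb i) = w i by rewrite /spread (big_pred1 i)// => j; rewrite (inj_eq nb_inj).
rewrite (bigID (mem (b @: I))) /= [X in _ + X]big1 => [|n nn]; last first.
  rewrite /spread big_pred0 ?F0// => i; apply/eqP => bi; case/negP: nn.
  by apply/imsetP; exists i => //; apply: val_inj; rewrite /= bi.
rewrite addr0 big_imset => [|i j _ _ [] /nb_inj//]; apply: eq_big => // i _.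
by rewrite /= E.
Qed.

Lemma tsum_spread m (z : torus) : (forall i, nb i < m)%N ->
  tsum ix m spread z = \sum_i monomial (ix (nb i)) z *: w i.
Proof.
move=> nbm; apply: (@spread_sum _ m (fun n x => monomial (ix n) z *: x)) => // n.
by rewrite scaler0.
Qed.

Lemma avg_spread m : (forall i, nb i < m)%N ->
  avg (fun e : cube 'I_m => rnorm (rsum e (fun n : 'I_m => spread n))) =
  avg (fun e : cube I => rnorm (rsum e w)).
Proof.
move=> nbm; pose b i := Ordinal (nbm i).
rewrite -(avg_restrict (iota := b)) => [|i j [] /nb_inj//]; apply: eq_avg => e; congr rnorm.
rewrite /rsum; under [RHS]eq_bigr do rewrite ffunE.
rewrite (bigID (mem (b @: I))) /= [X in _ + X]big1 => [|n nn]; last first.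
  rewrite /spread big_pred0 ?scaler0// => i; apply/eqP => bi; case/negP: nn.
  by apply/imsetP; exists i => //; apply: val_inj; rewrite /= bi.
rewrite addr0 big_imset => [|i j _ _ [] /nb_inj//]; apply: eq_big => // i _.
by rewrite /= /spread (big_pred1 i)// => j; rewrite (inj_eq nb_inj).
Qed.

End Spread.

Section Block.
Variables (N : nat) (y : 'I_N -> X) (r : 'I_N -> nat).
Hypothesis r_inj : injective r.

Let m := N.*2.+1.
Notation blocks := ('I_N * 'I_m.*2)%type.
Let c (d : nat) : R := fejer_coef m d.
Let energy : R := \sum_(d < m.*2) c d ^+ 2.
Let total : R := \sum_j rnorm (y j) ^+ 2.

Let energy_ge : N%:R <= energy.
Proof.
have := @fejer_energy R m isT; apply: le_trans; rewrite ler_pdivlMr//.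
rewrite -natrM ler_nat /m; lia.
Qed.

Lemma block_energy_gt0 : 0 < energy.
Proof. by have := @fejer_energy R m isT; apply: lt_le_trans; rewrite divr_gt0. Qed.

Definition block_sum (z : torus) : X :=
  \sum_(i : blocks) monomial (blk (r i.1) i.2) z *: ((c i.2)%:C *: y i.1).

Lemma block_upper : N2 mu block_sum ^+ 2 <= 2 * energy * total.
Proof.
have Lb : in_Lp mu 2 block_sum by exact: in_L2_monomials.
have bound z : rnorm (block_sum z) <= \sum_j fejer m (r j) z * rnorm (y j).
  rewrite /block_sum sum_pair; apply: le_trans (seminorm_sum (@rnorm_seminorm _ X) _ _ _) _.
  apply: ler_sum => j _; rewrite -rnormZ /tpolyC scaler_suml le_eqVlt; apply/orP; left; apply/eqP.
  by congr rnorm; apply: eq_bigr => d _; rewrite scalerA mulrC.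
pose G (p : 'I_N * 'I_N) z := rnorm (y p.1) * rnorm (y p.2) * (fejer m (r p.1) z * fejer m (r p.2) z).
have fejer0 j z : 0 <= fejer m (r j) z by exact: cabs_ge0.
have mfejer j : measurable_fun setT (fejer m (r j)) by exact: measurable_tpolyC.
have mG p : measurable_fun setT (G p) by apply: measurable_funM; [exact: measurable_cst|apply: measurable_funM; exact: mfejer].
have G0 p z : 0 <= G p z by apply: mulr_ge0; apply: mulr_ge0; rewrite ?rnorm_ge0 ?fejer0.
have intG p : (\int[mu]_z (G p z)%:E =
    (rnorm (y p.1) * rnorm (y p.2) * (if p.1 == p.2 then energy else 1))%:E)%E.
  under eq_integral do rewrite /G EFinM.
  rewrite ge0_integralZl_EFin ?mulr_ge0 ?rnorm_ge0//; last 2 first.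
  - by move=> z _; rewrite lee_fin mulr_ge0 ?fejer0.
  - by apply/measurable_EFinP; apply: measurable_funM; exact: mfejer.
  rewrite [RHS]EFinM; apply: congr1; case: eqP => [->|/eqP p12]; first exact: fejer_sqr.
  by apply: fejer_indep => //; rewrite (inj_eq r_inj).
have sumG z : \sum_p G p z = (\sum_j fejer m (r j) z * rnorm (y j)) ^+ 2.
  rewrite expr2 big_distrlr sum_pair; apply: eq_bigr => j _; apply: eq_bigr => j' _.
  by rewrite /G /=; ring.
rewrite -lee_fin -(N2_sqr Lb).
apply: (@le_trans _ _ (\int[mu]_z (\sum_p G p z)%:E)%E).
  apply: ge0_le_integral => //.
  - by move=> z _; rewrite lee_fin sqr_ge0.
  - exact: measurable_rnorm_sqr Lb.1.
  - by apply/measurable_EFinP; exact: measurable_sum.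
  by move=> z _; rewrite lee_fin sumG ler_sqr ?nnegrE ?rnorm_ge0 ?sumr_ge0// => j _;
    rewrite mulr_ge0 ?rnorm_ge0 ?fejer0.
rewrite (integral_sum_fin mG G0 intG) lee_fin sum_pair /=.
apply: (@le_trans _ _ (energy * total + (\sum_j rnorm (y j)) ^+ 2)).
  have -> : (\sum_j rnorm (y j)) ^+ 2 = \sum_j \sum_j' rnorm (y j) * rnorm (y j').
    by rewrite expr2 big_distrlr.
  rewrite [energy * total]mulr_sumr -big_split; apply: ler_sum => j _ /=.
  rewrite (bigD1 j)//= eqxx [X in _ <= _ + X](bigD1 j)//= addrA; apply: lerD.
    by rewrite expr2 mulrC lerDl mulr_ge0 ?rnorm_ge0.
  by apply: ler_sum => j' /negPf jj'; rewrite eq_sym jj' mulr1.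
have cs : (\sum_j rnorm (y j)) ^+ 2 <= N%:R * total.
  have := avg_sqr_le (fun j : 'I_N => rnorm (y j)); rewrite /avg card_ord -/total.
  have [N0|N0] := posnP N.
    move=> _; rewrite [X in X ^+ 2]big1 ?expr0n ?mulr_ge0 ?sumr_ge0// => [j _|j _]; first exact: sqr_ge0.
    by move: (ltn_ord j); rewrite {2}N0.
  have NR : 0 < N%:R :> R by rewrite ltr0n.
  rewrite exprMn -(ler_pM2l (exprn_gt0 2 NR)) mulrA -exprMn divff ?lt0r_neq0// expr1n mul1r.
  by rewrite expr2 !mulrA mulfK ?lt0r_neq0.
apply: le_trans (lerD (lexx _) cs) _; rewrite -mulrDl ler_wpM2r//.
  by apply: sumr_ge0 => j _; exact: sqr_ge0.
by rewrite mulrDl !mul1r lerD2l.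
Qed.

Definition block_index (i : blocks) : nat := (nat_of_index (blk (r i.1) i.2)).-1.

Lemma ix_block_index i : ix (block_index i) = blk (r i.1) i.2.
Proof. by rewrite nat_of_indexK//; exact: blk_nonneg. Qed.

Lemma block_index_inj : injective block_index.
Proof.
move=> [j d] [j' d'] H; have := congr1 ix H; rewrite !ix_block_index => /blk_inj[/= /r_inj -> /val_inj ->].
by [].
Qed.

Definition block : nat -> X := spread block_index (fun i => (c i.2)%:C *: y i.1).

Lemma tsum_block M : (forall i, block_index i < M)%N -> tsum ix M block = block_sum.
Proof.
move=> iM; apply/funext => z; rewrite (tsum_spread _ block_index_inj)//.
by apply: eq_bigr => i _; rewrite ix_block_index.
Qed.

Lemma block_lower M : (forall i, block_index i < M)%N ->
  energy * avg (fun e : cube 'I_N => rnorm (rsum e y) ^+ 2) <=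
  32 * avg (fun e : cube 'I_M => Nt mu ix M (signed e block)) ^+ 2.
Proof.
move=> iM; pose k : R := Num.sqrt (energy / 2).
have k2 : k ^+ 2 * 2 = energy by rewrite sqr_sqrtr ?divfK// divr_ge0// ltW// block_energy_gt0.
have k2le : k ^+ 2 * 2 <= \sum_(d < m.*2) c d ^+ 2 by rewrite k2.
pose T2 := avg (fun e : cube 'I_N => rnorm (rsum e y) ^+ 2).
pose T1 := avg (fun e : cube 'I_N => rnorm (rsum e y)).
pose A2 := avg (fun e : cube 'I_M => rnorm (rsum e (fun n : 'I_M => block n)) ^+ 2).
pose A1 := avg (fun e : cube 'I_M => rnorm (rsum e (fun n : 'I_M => block n))).
pose B2 := avg (fun e : cube 'I_M => Nt mu ix M (signed e block) ^+ 2).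
pose B1 := avg (fun e : cube 'I_M => Nt mu ix M (signed e block)).
have H1 : T2 <= 2 * T1 ^+ 2 := kahane y (@rnorm_seminorm _ X).
have H2 : k * T1 <= A1.
  by rewrite /A1 (avg_spread _ block_index_inj iM); exact: rsum_blocks_ge (@rnorm_seminorm _ X) (sqrtr_ge0 _) k2le.
have H3 : A1 ^+ 2 <= A2 := avg_sqr_le _.
have H4 : A2 <= 4 * B2 := signed_lower ix M block.
have H5 : B2 <= 2 * B1 ^+ 2 := kahane (fun n : 'I_M => dirichlet_term block n) (Nt_seminorm mu ix M).
have k0 : 0 <= k by exact: sqrtr_ge0.
have T0 : 0 <= T1 by apply: avg_ge0 => e; exact: rnorm_ge0.
rewrite -/T2 -/B1 -k2.
have kT0 : 0 <= k * T1 by exact: mulr_ge0.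
have : (k * T1) ^+ 2 <= A1 ^+ 2 by rewrite ler_sqr// nnegrE// (le_trans kT0 H2).
have := sqr_ge0 k; rewrite exprMn; nra.
Qed.

End Block.
End Blocks.

Section BadSequence.
Context {R : realType} {X : completeNormedModType R[i]}.
Notation C := R[i].
Notation torus := (polytorus R).
Notation cube I := {ffun I -> bool}.
Variable mu : probability torus R.
Hypothesis mu_haar : haar (@circle_mul R) mu.

Lemma not_type2 (K : R) : ~ type2 X -> 0 <= K -> exists N (y : 'I_N -> X),
  K * \sum_j rnorm (y j) ^+ 2 < avg (fun e : cube 'I_N => rnorm (rsum e y) ^+ 2).
Proof.
move=> nt K0; apply: contrapT => H; apply: nt; exists (Num.sqrt K) => N x.
rewrite Esign_avg -sqrtrM// ler_wsqrtr//.
by rewrite leNgt; apply/negP => lt; apply: H; exists N, x.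
Qed.

Lemma signedZ m (e : cube 'I_m) (k : C) (u : nat -> X) : signed e (k *: u) = k *: signed e u.
Proof.
rewrite -rsum_scale; apply: eq_rsum => n; apply/funext => i.
rewrite -[RHS]/(k *: dirichlet_term u n i) /dirichlet_term.
by case: eqP => //; rewrite scaler0.
Qed.

Lemma bad_block (r : nat -> nat) (eta : R) : ~ type2 X -> injective r -> 0 < eta ->
  exists (u : nat -> X) M, [/\ forall n, (M <= n)%N -> u n = 0,
    forall n, u n <> 0 -> exists j d, ix n = blk (r j) d,
    Nt mu ix M u <= eta &
    1 <= avg (fun e : cube 'I_M => Nt mu ix M (signed e u))].
Proof.
move=> nt r_inj eta0; have [|N [y Hy]] := not_type2 (K := 64 / eta ^+ 2) nt _.
  by rewrite divr_ge0// sqr_ge0.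
pose rN (j : 'I_N) := r j; have rN_inj : injective rN by move=> j j' /r_inj/val_inj.
pose M := (\max_i block_index rN i).+1.
have iM i : (block_index rN i < M)%N by rewrite ltnS; exact: (leq_bigmax i).
have up := block_upper mu_haar y rN_inj; rewrite -(tsum_block y rN_inj iM) -/(Nt mu ix M _) in up.
have low := block_lower mu y rN_inj iM.
pose v := block y rN; rewrite -/v in up low.
have E0 := @block_energy_gt0 R N.
set E := \sum_(d < _) _ in up low E0; set S := \sum_j _ in up Hy.
set T2 := avg _ in low Hy; set B := avg _ in low.
have B0 : 0 <= B by apply: avg_ge0 => e; exact: N2_ge0.
have S0 : 0 <= S by apply: sumr_ge0 => j _; exact: sqr_ge0.
have eta2 : 0 < eta ^+ 2 by rewrite exprn_gt0.
have H1 : 64 * S < eta ^+ 2 * T2 by rewrite -ltr_pdivrMl// mulrA [_^-1 * 64]mulrC.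
have T0 : 0 < T2.
  by rewrite -(pmulr_rgt0 _ eta2); apply: le_lt_trans H1; rewrite mulr_ge0.
have Bp : 0 < B.
  rewrite lt_def B0 andbT; apply/eqP => Bz; move: low; rewrite Bz expr0n mulr0.
  by rewrite leNgt mulr_gt0.
have NB : Nt mu ix M v <= eta * B.
  have v0 : 0 <= Nt mu ix M v by exact: N2_ge0.
  have eB0 : 0 <= eta * B by exact: mulr_ge0 (ltW eta0) B0.
  rewrite -(ler_pXn2r (isT : (0 < 2)%N)) ?nnegrE// exprMn.
  have : E * (64 * S) <= E * (eta ^+ 2 * T2) by rewrite ler_pM2l// ltW.
  have : eta ^+ 2 * (E * T2) <= eta ^+ 2 * (32 * B ^+ 2) by rewrite ler_pM2l.
  by move: up; nra.
exists ((B^-1)%:C *: v), M; have sN := Nt_seminorm mu ix M; split.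
- move=> n Mn; rewrite -[LHS]/((B^-1)%:C *: v n) /v /block /spread big_pred0 ?scaler0// => i.
  by apply/eqP => ni; move: (iM i); rewrite ni ltnNge Mn.
- move=> n; rewrite -[X in X <> 0]/((B^-1)%:C *: v n) => vn; apply: contrapT => H; apply: vn.
  rewrite /v /block /spread big_pred0 ?scaler0// => i; apply/eqP => ni; apply: H.
  by exists i.1, i.2; rewrite -ni ix_block_index.
- by rewrite seminormZ_real// ger0_norm ?invr_ge0// mulrC ler_pdivrMr.
rewrite (@eq_avg _ _ _ (fun e => B^-1 * Nt mu ix M (signed e v))) => [|e].
  by rewrite avgZ -/B mulVf// lt0r_neq0.
by rewrite signedZ seminormZ_real// ger0_norm ?invr_ge0.
Qed.

Definition block_var (k j : nat) : nat := @choice.pickle (nat * nat)%type (k, j).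

Definition circleN1 : circle R.
Proof. by exists (-1); rewrite normrN normr1. Defined.

Definition marker (k : nat) : torus := fun i =>
  if odd i && (if @choice.unpickle (nat * nat)%type i./2 is Some p then p.1 != k else false)
  then circleN1 else circle1 R.

Lemma monomial_marker k k' j d :
  monomial (blk (block_var k' j) d) (marker k) = if k' == k then 1 else -1.
Proof.
rewrite monomial_blk /marker /block_var /= !odd_double /= expr1n mulr1 uphalf_double choice.pickleK /=.
by case: eqP.
Qed.

Lemma bad_sequence (eta : nat -> R) : ~ type2 X -> (forall k, 0 < eta k) ->
  exists (u : nat -> nat -> X) (M : nat -> nat), forall k,
    [/\ forall n, (M k <= n)%N -> u k n = 0,
        forall n k', u k n <> 0 -> monomial (ix n) (marker k') = if k == k' then 1 else -1,
        Nt mu ix (M k) (u k) <= eta k &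
        1 <= avg (fun e : cube 'I_(M k) => Nt mu ix (M k) (signed e (u k)))].
Proof.
move=> nt eta0.
have r_inj k : injective (block_var k).
  by move=> j j' /(pcan_inj choice.pickleK)[].
have /boolp.choice[u uP] k := bad_block nt (r_inj k) (eta0 k).
have /boolp.choice[M MP] := uP; exists u, M => k; have [u0 un uN u1] := MP k.
split=> // n k' /un[j [d ->]]; exact: monomial_marker.
Qed.

Section Glue.
Variables (u : nat -> nat -> X).
Hypothesis u_marker : forall k n k', u k n <> 0 ->
  monomial (ix n) (marker k') = if k == k' then 1 else -1.

Definition glue (n : nat) : X := xget 0 [set v | v <> 0 /\ exists k, v = u k n].

Lemma u_disjoint k k' n : u k n <> 0 -> u k' n <> 0 -> k = k'.
Proof.
move=> /(@u_marker _ _ k) + /(@u_marker _ _ k) => ->; rewrite eqxx.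
case: eqP => // _ /eqP; rewrite -subr_eq0 opprK -[1 + 1](natrD _ 1 1) pnatr_eq0.
by [].
Qed.

Lemma glueE k n : u k n <> 0 -> glue n = u k n.
Proof.
move=> ukn; rewrite /glue; case: xgetP => [v _ [v0 [k' vE]]|/(_ (u k n))].
  by rewrite vE; congr (u _ n); apply: (@u_disjoint _ _ n) => //; rewrite -vE.
by case; split=> //; exists k.
Qed.

Lemma glue0 n : (forall k, u k n = 0) -> glue n = 0.
Proof.
by move=> u0; rewrite /glue; case: xgetP => // v _ [v0 [k vE]]; case: v0; rewrite vE u0.
Qed.

End Glue.

Lemma RUC_type2 : (forall x : nat -> X, RUC (HDnorm mu 2) (dirichlet_term x)) -> type2 X.
Proof.
move=> ruc; apply: contrapT => nt.
have [|u [M uM]] := bad_sequence (eta := fun k => k.+1%:R^-1) nt; first by move=> k; rewrite invr_gt0.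
have u_marker k n k' : u k n <> 0 -> monomial (ix n) (marker k') = if k == k' then 1 else -1.
  by have [_ H _ _] := uM k; exact: H.
have [K HK] := (RUC_dirichlet mu_haar (glue u)).1 (ruc _).
pose k := Num.truncn K; have [u0 _ uN u1] := uM k.
pose b (n : 'I_(M k)) : C := if u k n == 0 then 0 else 1.
have bE (n : 'I_(M k)) : b n *: dirichlet_term (glue u) n = dirichlet_term (u k) n.
  apply/funext => i; rewrite -[LHS]/(b n *: dirichlet_term (glue u) n i) /dirichlet_term /b.
  case: (i =P n :> nat) => [_|_]; last by rewrite scaler0.
  case: eqP => [->|ukn]; first by rewrite scale0r.
  by rewrite scale1r (glueE u_marker ukn).
have := HK (M k) b.
rewrite (@eq_avg _ _ _ (fun e => Nt mu ix (M k) (signed e (u k)))) => [|e]; last first.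
  by congr Nt; apply: eq_rsum => n; exact: bE.
have -> : Nt mu ix (M k) (\sum_(n < M k) b n *: dirichlet_term (glue u) n) = Nt mu ix (M k) (u k).
  congr N2; apply/funext => z; apply: eq_bigr => n _; congr (_ *: _).
  have := dirichlet_term_sumE (u k) (fun=> 1) n; rewrite scale1r => <-; congr (_ (val n)).
  by apply: eq_bigr => i _; rewrite bE scale1r.
move=> H; have {H} := le_trans u1 H; apply/negP; rewrite -ltNge.
have N0 : 0 <= Nt mu ix (M k) (u k) by exact: N2_ge0.
have Kk : K < k.+1%:R by exact: truncnS_gt.
have [K0|K0] := leP K 0; first by apply: (@le_lt_trans _ _ 0) => //; rewrite mulr_le0_ge0.
apply: le_lt_trans (ler_wpM2l (ltW K0) uN) _.
by rewrite ltr_pdivrMr// mul1r.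
Qed.

End BadSequence.

Section PaleyZygmund.
Context {R : realType}.

Lemma paley_zygmund (T : finType) (h : T -> R) : 0 < avg h -> (forall t, 0 <= h t) ->
  avg (fun t => h t ^+ 2) <= 2 * avg h ^+ 2 ->
  8^-1 <= avg (fun t => (avg h / 2 <= h t)%R%:R : R).
Proof.
move=> a0 h0; set a := avg h in a0 *; set p := avg (fun t => _%:R : R) => H.
(* Pointwise, [h <= a / 2 + (h ^+ 2 / (4 * a) + 4 * a * 1_{h >= a / 2}) / 2],
   the second summand bounding [h] by the arithmetic-geometric inequality. *)
have : a <= a / 2 + (avg (fun t => h t ^+ 2) / (4 * a) + 4 * a * p) / 2.
  have [t0 _|T0] := pickP T; last first.
    by move: a0; rewrite /a /avg eq_card0// invr0 mul0r ltxx.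
  have <- : avg (fun t => a / 2 + (h t ^+ 2 / (4 * a) + 4 * a * (a / 2 <= h t)%R%:R) / 2) =
      a / 2 + (avg (fun t => h t ^+ 2) / (4 * a) + 4 * a * p) / 2.
    by rewrite avgD (avg_cst t0) avgZr avgD avgZr avgZ.
  apply: ler_avg => t; have a4 : 0 < 4 * a by rewrite mulr_gt0.
  case: (leP (a / 2) (h t)) => [_|ht].
    rewrite mulr1 -lerBlDl; have : 0 <= a / 2 by rewrite divr_ge0// ltW.
    have : h t <= (h t ^+ 2 / (4 * a) + 4 * a) / 2.
      rewrite -subr_ge0 (_ : _ - _ = (h t - 4 * a) ^+ 2 / (8 * a)).
        by apply: divr_ge0; [exact: sqr_ge0|apply: mulr_ge0 => //; exact: ltW].
      by field; rewrite lt0r_neq0.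
    by lra.
  by rewrite mulr0 addr0 (le_trans (ltW ht))// lerDl; apply: divr_ge0 => //; apply: divr_ge0; [exact: sqr_ge0|exact: ltW].
move=> H1; have : avg (fun t => h t ^+ 2) / (4 * a) <= a / 2.
  have a4 : 0 < 4 * a by exact: mulr_gt0.
  rewrite ler_pdivrMr//; apply: (le_trans H).
  by rewrite le_eqVlt; apply/orP; left; apply/eqP; field.
move=> H2; have {H1 H2} : a <= 8 * a * p by lra.
by rewrite mulrAC -[leLHS]mul1r ler_pM2r// => H1; lra.
Qed.

Variable P : probability signs R.
Hypothesis P_haar : haar addb P.

Lemma unbounded_signs (M : nat -> nat) (h : forall k, {ffun 'I_(M k) -> bool} -> R) (N : set signs) :
  (forall k e, 0 <= h k e) -> (forall k, k.+1%:R <= avg (h k)) ->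
  (forall k, avg (fun e => h k e ^+ 2) <= 2 * avg (h k) ^+ 2) ->
  measurable N -> P N = 0%E ->
  (forall eps, ~ N eps -> exists B : R, forall k, h k (first_signs (M k) eps) <= B) -> False.
Proof.
move=> h0 hk h2 mN N0 bN.
pose E (j : nat) := \bigcap_(k in [set: nat]) [set eps : signs | h k (first_signs (M k) eps) <= j%:R].
have mE j : measurable (E j).
  by apply: bigcapT_measurable => k; exact: (measurable_first_signs_set (fun e => h k e <= j%:R)).
have mU : measurable (\bigcup_j E j) by exact: bigcup_measurable.
have ndE : nondecreasing_seq E.
  move=> i j ij; apply/subsetPset => eps Ei k _; apply: (le_trans (Ei k I)).
  by rewrite ler_nat.
have PE j : (P (E j) <= (7 / 8)%:E)%E.
  pose k := j.*2; pose Q (e : {ffun 'I_(M k) -> bool}) := avg (h k) / 2 <= h k e.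
  have a0 : 0 < avg (h k) by apply: lt_le_trans (hk k).
  have H := paley_zygmund a0 (h0 k) (h2 k).
  apply: (@le_trans _ _ (P (~` [set eps | Q (first_signs (M k) eps)]))).
    apply: le_measure; rewrite ?inE; [exact: mE|apply: measurableC; exact: measurable_first_signs_set|].
    move=> eps /(_ k I) /= Ejk; apply/negP; rewrite /Q -ltNge; apply: le_lt_trans Ejk _.
    rewrite ltr_pdivlMr//; apply: lt_le_trans (hk k); rewrite -natrM ltr_nat muln2.
    by rewrite ltnS.
  rewrite probability_setC; last exact: measurable_first_signs_set.
  rewrite (probability_first_signs P_haar) -EFinB lee_fin; move: H; rewrite -/Q.
  by move: (avg _) => q; lra.
have cP := nondecreasing_cvg_mu (mu := P) mE mU ndE.
have PU : (P (\bigcup_j E j) <= (7 / 8)%:E)%E.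
  by rewrite -(cvg_lim _ cP)//; apply: lime_le; [exact: cvgP cP|near=> j; exact: PE].
have PC : P (~` \bigcup_j E j) = 0%E.
  apply/eqP; rewrite -measure_le0 -N0 le_measure ?inE//; first exact: measurableC.
  move=> eps /= nE; apply: contrapT => /bN[B HB]; apply: nE.
  exists (Num.truncn B).+1 => // k _; apply: le_trans (HB k) _.
  exact/ltW/truncnS_gt.
move: PC; rewrite probability_setC// => PC.
have : (P (\bigcup_j E j) = 1)%E.
  move: PC; case: (P _) (fin_num_measure P _ mU) => // r _; rewrite -EFinB => -[/eqP].
  by rewrite subr_eq0 => /eqP <-.
move=> PU1; move: PU; rewrite PU1 lee_fin; lra.
Unshelve. all: end_near. Qed.

End PaleyZygmund.

Section RadToType.
Context {R : realType} {X : completeNormedModType R[i]}.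
Notation C := R[i].
Notation torus := (polytorus R).
Notation cube I := {ffun I -> bool}.
Variable mu : probability torus R.
Hypothesis mu_haar : haar (@circle_mul R) mu.
Variable P : probability signs R.
Hypothesis P_haar : haar addb P.

Notation dpoly := (tsum ix).
Notation Nd := (Nt mu ix).

Lemma fourier_lim (F : torus -> X) (S : nat -> torus -> X) (a : multi_index) (x : X) :
  in_Lp mu 2 F -> (forall n, in_Lp mu 2 (S n)) ->
  (forall e : R, 0 < e -> exists n0, forall n, (n0 <= n)%N -> N2 mu (fun t => F t - S n t) <= e) ->
  (exists n0, forall n, (n0 <= n)%N -> fourier_coef mu (S n) a = x) ->
  fourier_coef mu F a = x.
Proof.
move=> LF LS FS [n1 Sx]; apply: small_eq => e e0; have [n0 H] := FS _ e0.
rewrite -(Sx (maxn n0 n1) (leq_maxr _ _)) -(fourierB a LF (LS _)).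
apply: le_trans (H _ (leq_maxl n0 n1)).
by apply: fourier_le; exact: (N2B LF (LS _)).1.
Qed.

Section Glued.
Variables (v : nat -> nat -> X) (M : nat -> nat).
Hypothesis v0 : forall k n, (M k <= n)%N -> v k n = 0.
Hypothesis v_marker : forall k n k', v k n <> 0 ->
  monomial (ix n) (@marker R k') = if k == k' then 1 else -1.

Lemma glue_sum n : exists m0, forall m, (m0 <= m)%N -> \sum_(k < m) v k n = glue v n.
Proof.
have [[k vk]|nv] := pselect (exists k, v k n <> 0).
  exists k.+1 => m km; rewrite (glueE v_marker vk) (bigD1 (Ordinal km))//= big1 ?addr0// => k' /eqP kk'.
  by apply: contrapT => vk'; apply: kk'; apply: val_inj; exact: (u_disjoint v_marker vk' vk).
exists 0%N => m _; have vz k : v k n = 0 by apply: contrapT => vk; apply: nv; exists k.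
by rewrite glue0// big1.
Qed.

Lemma glue_HD : (forall k, Nd (M k) (v k) <= (2 ^+ k)^-1) -> in_HDp mu 2 (glue v).
Proof.
move=> vN; pose S n z := \sum_(k < n) dpoly (M k) (v k) z.
have LS n : in_Lp mu 2 (S n).
  have H := @in_L2_sum _ X _ _ mu _ (index_enum 'I_n) xpredT (fun k z => dpoly (M k) (v k) z).
  by apply: (H _).1 => k; exact: in_L2_tsum.
have SE n : (fun z => S n.+1 z - S n z) = dpoly (M n) (v n).
  by apply/funext => z; rewrite /S big_ord_recr/= addrAC subrr add0r.
have [|F [LF FS]] := riesz_fischer LS (M := 2).
  move=> n; apply: le_trans (geometric_sum n); apply: ler_sum => k _.
  by rewrite SE; exact: vN.
have fourier_S n a : fourier_coef mu (S n) a = \sum_(k < n) fourier_coef mu (dpoly (M k) (v k)) a.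
  elim: n => [|n IH].
    rewrite big_ord0; have -> : S 0%N = tpoly [::].
      by apply/funext => z; rewrite /S /tpoly big_ord0 big_nil.
    by rewrite fourier_tpoly// big_nil.
  rewrite big_ord_recr /= -IH -(fourierD a (LS n) (in_L2_tsum mu ix (M n) (v n))).
  by congr fourier_coef; apply/funext => z; rewrite /S big_ord_recr.
exists F; apply: bohr_lift_ix => // [n|a na]; apply: fourier_lim LF LS FS _.
  have [m0 Hm] := glue_sum n; exists m0 => m mm0; rewrite fourier_S -(Hm m mm0).
  by apply: eq_bigr => k _; rewrite fourier_dpoly_ix//; case: ltnP => // /v0 ->.
by exists 0%N => n _; rewrite fourier_S big1// => k _; exact: fourier_dpoly_neg.
Qed.

(** Averaging with the rotation that changes the sign of the markers of the other
    blocks extracts one block from any lift, without increasing the norm. *)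
Lemma glue_block (eps : signs) : in_HDp mu 2 (twist eps (glue v)) ->
  exists B : R, forall k, Nd (M k) (twist eps (v k)) <= B.
Proof.
move=> [G lG]; have LG : in_Lp mu 2 G := lG.1.1; exists (N2 mu G) => k.
have [Lr Nr] := in_L2_rot mu_haar (marker k) LG; have [Ls Ns] := N2D LG Lr.
pose c : C := (2^-1 : R)%:C; have c2 : c * 2%:R = 1 by rewrite -realC_nat -realCM mulVf.
have [||Lh Nh] := @in_L2Z _ _ _ _ mu (fun=> c : C^o) _ 2^-1 (strongly_measurable_cst _ _) Ls.
- by rewrite invr_ge0.
- by move=> z; rewrite cabs_real ger0_norm// invr_ge0.
apply: (@le_trans _ _ (2^-1 * (N2 mu G + N2 mu G))); last first.
  by rewrite le_eqVlt; apply/orP; left; apply/eqP; field.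
apply: le_trans (le_trans Nh _); last by rewrite ler_wpM2l ?invr_ge0// (le_trans Ns)// Nr.
rewrite le_eqVlt; apply/orP; left; apply/eqP.
apply: fourier_eq_N2 => [||a]; [exact: in_L2_tsum|exact: Lh|].
have -> : fourier_coef mu (fun z => c *: (G z + (G \o rot (marker k)) z)) a =
    c *: (fourier_coef mu G a + monomial a (marker k) *: fourier_coef mu G a).
  have := fourier_lin c a Ls (in_L2_tpoly mu [::]).
  rewrite (fourier_tpoly mu_haar [::]) big_nil addr0 (fourierD a LG Lr) (fourier_rot mu_haar (marker k) a LG) => <-.
  by congr fourier_coef; apply/funext => z; rewrite /tpoly big_nil addr0.
have [na|na] := pselect (nonneg_index a); last first.
  by rewrite fourier_dpoly_neg// lG.1.2// scaler0 addr0 scaler0.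
rewrite -(nat_of_indexK na); set n := _.-1.
have -> : fourier_coef mu (dpoly (M k) (twist eps (v k))) (ix n) = (-1) ^+ eps n *: v k n.
  by rewrite fourier_dpoly_ix//; case: ltnP => // /v0 ->; rewrite scaler0.
rewrite (bohr_lift_coef n lG) /twist.
have half (x : X) : c *: (x + 1 *: x) = x.
  by rewrite scale1r -mulr2n -[x *+ 2]scaler_nat scalerA c2 scale1r.
have [vk|vk] := pselect (v k n <> 0).
  by rewrite (glueE v_marker vk) (v_marker k vk) eqxx half.
have -> : v k n = 0 by apply: contrapT.
have [[k' vk']|nv] := pselect (exists k', v k' n <> 0).
  have kk' : k' != k by apply/eqP => E; apply: vk; rewrite -E.
  by rewrite (v_marker k vk') (negPf kk') scaleN1r subrr !scaler0.
by rewrite glue0 ?scaler0 ?addr0 ?scaler0// => k'; apply: contrapT => vk'; apply: nv; exists k'.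
Qed.

End Glued.

Lemma rad_type2 : (forall D : nat -> X, in_HDp mu 2 D -> in_HDrad mu P 2 D) -> type2 X.
Proof.
move=> rad; apply: contrapT => nt.
have eta0 k : 0 < (2 ^+ k)^-1 / k.+1%:R :> R by rewrite divr_gt0// invr_gt0 exprn_gt0.
have [u [M uM]] := bad_sequence mu_haar nt eta0.
pose v k : nat -> X := (k.+1%:R : R)%:C *: u k.
have vE k n : v k n = (k.+1%:R : R)%:C *: u k n by [].
have v0 k n : (M k <= n)%N -> v k n = 0.
  by have [u0 _ _ _] := uM k; rewrite vE => /u0 ->; rewrite scaler0.
have v_marker k n k' : v k n <> 0 -> monomial (ix n) (@marker R k') = if k == k' then 1 else -1.
  have [_ um _ _] := uM k; rewrite vE => vk; apply: (um) => uk; apply: vk.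
  by rewrite uk scaler0.
have sN k := @Nt_seminorm R X mu ix (M k).
have vN k : Nd (M k) (v k) <= (2 ^+ k)^-1.
  have [_ _ uN _] := uM k; rewrite /v (seminormZ_real (sN k)) ger0_norm// mulrC.
  by rewrite -ler_pdivlMr.
pose h k (e : cube 'I_(M k)) := Nd (M k) (signed e (v k)).
have [N [mN N0 badN]] := rad _ (glue_HD v0 v_marker vN).
apply: (@unbounded_signs R P P_haar M h N) => //.
- by move=> k e; exact: N2_ge0.
- move=> k; have [_ _ _ u1] := uM k.
  rewrite (@eq_avg _ _ _ (fun e => k.+1%:R * Nd (M k) (signed e (u k)))) => [|e].
    by rewrite avgZ ler_peMr.
  by rewrite /h /v signedZ (seminormZ_real (sN k)) ger0_norm.
- by move=> k; exact: (kahane (fun n : 'I_(M k) => dirichlet_term (v k) n) (sN k)).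
move=> eps neps; have : in_HDp mu 2 (twist eps (glue v)).
  by apply: contrapT => bad; apply: neps; exact: badN.
move=> /(glue_block v0 v_marker)[B HB]; exists B => k; apply: le_trans (HB k).
rewrite le_eqVlt; apply/orP; left; apply/eqP; congr N2; apply/funext => z.
by apply: eq_bigr => n _; rewrite signedE ffunE.
Qed.

End RadToType.

Theorem theoremA (R : realType) (X : completeNormedModType R[i])
    (mu : probability (polytorus R) R) (P : probability signs R)
    (mu_haar : haar (@circle_mul R) mu) (P_haar : haar addb P) :
  let a := forall x : nat -> X, RUC (HDnorm mu 2) (dirichlet_term x) in
  let b := forall D : nat -> X, in_HDp mu 2 D -> in_HDrad mu P 2 D in
  let c := type2 X in
  (a <-> b) /\ (b <-> c).
Proof.
move=> a b c.
have ca : c -> a by move=> t2 x; exact: type2_RUC.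
have ac : a -> c by exact: RUC_type2.
have cb : c -> b by move=> t2 D; exact: type2_rad.
have bc : b -> c by exact: rad_type2.
by split; split; auto.
Qed.
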